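(* Let $t>0$ and let $a,b,c>0$ satisfy $\min\{a,b\}\le c\le\max\{a,b\}$. Then $$\mathbb{E}^{(3)}_{a,b}\left[F\bigl(\rho-a,\ \overline{\mathcal{P}}(\rho)+a,\ \overline{\mathcal{M}}_{a+b-2c}(\rho-a)\bigr)\right]$$ $$=\mathbb{E}^{(3)}_{c,a+b-c}\left[F\bigl(\overline{\mathcal{M}}_{b-a}(\rho-c),\ \overline{\mathcal{P}}(\rho)+c,\ \rho-c\bigr)\ \middle|\ \min_{0\le u\le t}\rho_u\le\min\{a,b\}\right]$$ for any nonnegative measurable function $F$ on $C([0,t];\mathbb{R}^3)$.
   Context: Fix $t>0$. $C([0,t];\mathbb{R}^d)$ is the space of continuous $\mathbb{R}^d$-valued functions on $[0,t]$ with the topology of uniform convergence; measurable means Borel-measurable. For $\phi\in C([0,t];\mathbb{R})$, $x\in\mathbb{R}$ and $0\le s\le t$, $$\overline{\mathcal{M}}_x(\phi)(s):=\phi_s-\frac{\phi_t-x}{2}+\left|\frac{\phi_t-x}{2}+\min_{0\le u\le s}\phi_u-\min_{s\le u\le t}\phi_u\right|-\Bigl|\min_{0\le u\le s}\phi_u-\min_{s\le u\le t}\phi_u\Bigr|,$$ $$\overline{\mathcal{P}}(\phi)(s):=\phi_s-2\min_{0\le u\le s}\phi_u .$$ For a constant $k$, $\phi\pm k$ denotes the function $s\mapsto\phi_s\pm k$. For $a,b>0$, $\mathbb{P}^{(3)}_{a,b}$ is the law on $C([0,t];\mathbb{R})$ of a three-dimensional Bessel bridge from $a$ to $b$ over $[0,t]$,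 $\mathbb{E}^{(3)}_{a,b}$ is the corresponding expectation, and $\rho$ is the coordinate process $\rho_s(\phi)=\phi_s$. The three-dimensional Bessel bridge from $a$ to $b$ is the nonnegative continuous process on $[0,t]$ starting at $a$ and ending at $b$ (a three-dimensional Bessel process started at $a$ conditioned to be at $b$ at time $t$) whose finite-dimensional laws at times $0<s_1<\dots<s_n<t$ are $$\frac{q_{s_1}(a,x_1)q_{s_2-s_1}(x_1,x_2)\cdots q_{t-s_n}(x_n,b)}{q_t(a,b)}\prod_{i=1}^n x_i^2\,dx_i$$ on $(0,\infty)^n$, where $q_r(x,y)=\frac{1}{xy\sqrt{2\pi r}}\left(e^{-(x-y)^2/(2r)}-e^{-(x+y)^2/(2r)}\right)$ for $x,y>0$. *)

(* Defs.v *)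
From HB Require Import structures.
From mathcomp Require Import all_boot all_order all_algebra.
From mathcomp Require Import all_classical all_reals all_analysis.
From mathcomp Require Import measurable_realfun lra.

Set Implicit Arguments.
Unset Strict Implicit.
Unset Printing Implicit Defensive.

Import Order.TTheory GRing.Theory Num.Theory.
Import numFieldNormedType.Exports.

Local Open Scope classical_set_scope.
Local Open Scope ring_scope.

(* [0, t] as a topological space of its own, with the subspace topology, so
   that a path carries no values outside [0, t]. *)
Notation tset t := (set_type `[0%R, t%:num]%classic).

Lemma time0_subproof (R : realType) (t : {posnum R}) :
  (0 : R) \in `[0, t%:num]%classic.
Proof. by rewrite inE /= in_itv /= lexx /=. Qed.

Lemma timeT_subproof (R : realType) (t : {posnum R}) :
  t%:num \in `[0, t%:num]%classic.
Proof. by rewrite inE /= in_itv /= lexx andbT. Qed.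

Definition time0 (R : realType) (t : {posnum R}) : tset t :=
  exist _ 0 (time0_subproof t).
Definition timeT (R : realType) (t : {posnum R}) : tset t :=
  exist _ t%:num (timeT_subproof t).

(* C([0, t]; V), with the topology of uniform convergence and its Borel
   sigma-algebra. *)
Definition cpath (R : realType) (t : {posnum R}) (V : puniformType) : Type :=
  continuousType (tset t) V.

Definition cpath_fun (R : realType) (t : {posnum R}) (V : puniformType)
  (phi : cpath t V) : {uniform tset t -> V} := Continuous.sort phi.

HB.instance Definition _ (R : realType) (t : {posnum R}) (V : puniformType) :=
  Uniform.copy (cpath t V) (initial_topology (@cpath_fun R t V)).

HB.instance Definition _ (R : realType) (t : {posnum R}) (V : puniformType) :=
  isPointed.Build (cpath t V) (cst (point : V) : continuousType (tset t) V).

HB.instance Definition _ (R : realType) (t : {posnum R}) (V : puniformType) :=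
  @isMeasurable.Build (sigma_display (@open (cpath t V))) (cpath t V)
    <<s @open (cpath t V) >> (@sigma_algebra0 _ setT (@open (cpath t V)))
    (@sigma_algebraC (cpath t V) (@open (cpath t V)))
    (@sigma_algebra_bigcup _ setT (@open (cpath t V))).

Definition mk_cpath (R : realType) (t : {posnum R}) (V : puniformType)
  (f : tset t -> V) (cf : continuous f) : cpath t V := mkcts cf.

Section continuity_formulas.
Variables (R : realType) (T : topologicalType).
Implicit Types f g h : T -> R.

Lemma continuous_addc f k : continuous f -> continuous (fun s => f s + k).
Proof. by move=> cf s; apply: cvgD; [exact: cf|exact: cvg_cst]. Qed.

Lemma continuous_Pbar_formula f g : continuous f -> continuous g ->
  continuous (fun s => f s - 2 * g s).
Proof.
move=> cf cg s; apply: cvgB; first exact: cf.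
by apply: cvgM; [exact: cvg_cst|exact: cg].
Qed.

Lemma continuous_Mbar_formula f g h k :
  continuous f -> continuous g -> continuous h ->
  continuous (fun s => f s - k + `|k + g s - h s| - `|g s - h s|).
Proof.
move=> cf cg ch s; apply: cvgB; last first.
  by apply: cvg_norm; apply: cvgB; [exact: cg|exact: ch].
apply: cvgD; first by apply: cvgB; [exact: cf|exact: cvg_cst].
apply: cvg_norm; apply: cvgB; last exact: ch.
by apply: cvgD; [exact: cvg_cst|exact: cg].
Qed.

Lemma continuous_row3 f g h :
  continuous f -> continuous g -> continuous h ->
  continuous (fun s => \row_(i < 3) [:: f s; g s; h s]`_i : 'rV[R]_3).
Proof.
move=> cf cg ch s; apply/cvg_mx_entourageP => A entA.
have cont k : continuous k -> \forall u \near s, (k s, k u) \in A.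
  move=> /(_ s)/cvg_app_entourageP/(_ A entA).
  by apply: filterS => u; rewrite inE.
apply: filterS (filterI (cont f cf) (filterI (cont g cg) (cont h ch))).
by move=> u [fu [gu hu]] i j; rewrite !mxE; case: j => -[|[|[|]]].
Qed.

End continuity_formulas.

Section path_transformations.
Variables (R : realType) (t : {posnum R}).
Implicit Types (phi : cpath t R) (s u : tset t) (x k : R).

(* For a continuous path these infima are attained, i.e. they are minima. *)
Definition past_min phi s : R := inf [set phi u | u in [set u | set_val u <= set_val s]].

Definition future_min phi s : R :=
  inf [set phi u | u in [set u | set_val s <= set_val u]].

Lemma cpath_lbound phi : exists m, forall s, m <= phi s.
Proof.
have cphi : {within `[0, t%:num], continuous (valL_ 0 phi)}.
  exact/subspace_valL_continuousP'/cts_fun.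
have [c _ hc] := EVT_min (ltW [gt0 of t%:num]) cphi.
exists (valL_ 0 phi c) => s.
have -> : phi s = valL_ 0 phi (set_val s).
  exact: (congr1 (@^~ s) (esym (valLK 0 (phi : _ -> _)))).
by apply: hc; exact: (set_valP s).
Qed.

Lemma continuous_inf_cpath phi (A : tset t -> set (tset t)) :
  (forall s, A s s) ->
  (forall s s' u, A s u -> ~ A s' u ->
    `|set_val u - set_val s| <= `|set_val s' - set_val s| /\
    `|set_val u - set_val s'| <= `|set_val s' - set_val s|) ->
  continuous (fun s => inf (phi @` A s)).
Proof.
move=> Arefl Abetw s0; have [m hm] := cpath_lbound phi.
have lbA s : has_inf (phi @` A s).
  by split; [exists (phi s), s|exists m => _ [u _ <-]].
apply/(@cvgrPdist_le _ _ (tset t) (nbhs s0) _) => e e0.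
have e2 : 0 < e / 2 by rewrite divr_gt0.
have := @cts_fun _ _ phi s0 => /cvgrPdist_lt/(_ (e / 2) e2).
move=> /nbhs_ballP[d /= d0 hd].
have hd' u : `|set_val s0 - set_val u| < d -> `|phi s0 - phi u| < e / 2.
  by move=> h; exact: (hd u).
apply/nbhs_ballP; exists d => //= s hs.
have {}hs : `|set_val s0 - set_val s| < d by exact: hs.
have key s1 s2 : `|set_val s0 - set_val s1| < d ->
    (forall u, A s2 u -> ~ A s1 u -> `|set_val s0 - set_val u| < d) ->
    inf (phi @` A s1) - e <= inf (phi @` A s2).
  move=> h1 h2; apply: lb_le_inf; first by case: (lbA s2).
  move=> _ [u A2u <-]; have [A1u|nA1u] := pselect (A s1 u).
    apply: (@le_trans _ _ (inf (phi @` A s1))); first by rewrite lerBlDr lerDl ltW.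
    by apply: ge_inf; [case: (lbA s1)|exists u].
  have := hd' _ (h2 _ A2u nA1u); have := hd' _ h1.
  have : inf (phi @` A s1) <= phi s1.
    by apply: ge_inf; [case: (lbA s1)|exists s1].
  rewrite !ltr_norml => i1 /andP[i2 _] /andP[_ i3].
  by rewrite lerBlDr (le_trans i1)//; move: i2 i3; lra.
rewrite ler_norml; apply/andP; split.
  rewrite lerBrDl -lerBrDr opprK.
  rewrite -lerBlDr.
  apply: key => // u A1 A2.
  have [h1 h2] := Abetw _ _ _ A1 A2.
  by rewrite distrC (le_lt_trans h1)// distrC.
rewrite lerBlDr -lerBlDl.
apply: key => [|u A1 A2]; first by rewrite subrr normr0.
have [h1 h2] := Abetw _ _ _ A1 A2.
by rewrite distrC (le_lt_trans h2).
Qed.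

Lemma continuous_past_min phi : continuous (past_min phi).
Proof.
apply: continuous_inf_cpath => [s|s s' u] /=; first exact: lexx.
move=> us /negP; rewrite -ltNge => s'u.
have s's := lt_le_trans s'u us.
rewrite (distrC (set_val u)) (distrC (set_val s')).
by rewrite !ger0_norm ?subr_ge0// ?(ltW s's) ?(ltW s'u)//; split; lra.
Qed.

Lemma continuous_future_min phi : continuous (future_min phi).
Proof.
apply: continuous_inf_cpath => [s|s s' u] /=; first exact: lexx.
move=> su /negP; rewrite -ltNge => us'.
have ss' := le_lt_trans su us'.
rewrite (distrC _ (set_val s')).
by rewrite !ger0_norm ?subr_ge0// ?(ltW ss') ?(ltW us')//; split; lra.
Qed.

Lemma continuous_shift_cpath phi k : continuous (fun s => phi s + k).
Proof. exact/continuous_addc/cts_fun. Qed.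

Definition shift_cpath phi k : cpath t R := mk_cpath (@continuous_shift_cpath phi k).

Definition Pbar_fun phi s : R := phi s - 2 * past_min phi s.

Lemma continuous_Pbar phi : continuous (Pbar_fun phi).
Proof.
by apply: continuous_Pbar_formula; [exact: cts_fun|exact: continuous_past_min].
Qed.

Definition Pbar phi : cpath t R := mk_cpath (@continuous_Pbar phi).

Definition Mbar_fun x phi s : R :=
  phi s - (phi (timeT t) - x) / 2
  + `|(phi (timeT t) - x) / 2 + past_min phi s - future_min phi s|
  - `|past_min phi s - future_min phi s|.

Lemma continuous_Mbar x phi : continuous (Mbar_fun x phi).
Proof.
have := @continuous_Mbar_formula _ _ _ _ _ ((phi (timeT t) - x) / 2)
  (@cts_fun _ _ phi) (@continuous_past_min phi) (@continuous_future_min phi).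
exact.
Qed.

Definition Mbar x phi : cpath t R := mk_cpath (@continuous_Mbar x phi).

Definition join3_fun (f g h : cpath t R) s : 'rV[R]_3 :=
  \row_(i < 3) [:: f s; g s; h s]`_i.

Lemma continuous_join3 (f g h : cpath t R) : continuous (join3_fun f g h).
Proof. by apply: continuous_row3; exact: cts_fun. Qed.

Definition join3 (f g h : cpath t R) : cpath t 'rV[R]_3 :=
  mk_cpath (@continuous_join3 f g h).

End path_transformations.

Section bessel_bridge.
Variables (R : realType) (t : {posnum R}).

(* Transition density of the three-dimensional Bessel process with respect to
   the speed measure y ^ 2 dy. *)
Definition bes3_q (r x y : R) : R :=
  (x * y * Num.sqrt (2 * pi * r))^-1 *
  (expR (- ((x - y) ^+ 2 / (2 * r))) - expR (- ((x + y) ^+ 2 / (2 * r)))).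

(* With s = (s_1, ..., s_n) and x = (x_1, ..., x_n), the product runs over the
   n + 1 consecutive pairs of the times 0, s_1, ..., s_n, t and of the
   positions a, x_1, ..., x_n, b. *)
Definition bes3_bridge_density (a b : R) (n : nat) (s x : n.-tuple R) : R :=
  let times := 0 :: rcons s t%:num in
  let places := a :: rcons x b in
  (\prod_(i < n.+1)
      bes3_q (times`_i.+1 - times`_i) places`_i places`_i.+1)
  / bes3_q t%:num a b * \prod_(i < n) (tnth x i) ^+ 2.

(* Integral of a nonnegative function over R ^ n against n-dimensional Lebesgue
   measure, as an iterated integral (Tonelli). *)
Fixpoint tuple_integral (n : nat) :
    (n.-tuple (measurableTypeR R) -> \bar R) -> \bar R :=
  match n return (n.-tuple (measurableTypeR R) -> \bar R) -> \bar R with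
  | 0 => fun f => f [tuple]
  | n'.+1 => fun f => (\int[@lebesgue_measure R]_x
      tuple_integral (fun v : n'.-tuple (measurableTypeR R) =>
        f [tuple of x :: v]))%E
  end.

(* P is the law of a three-dimensional Bessel bridge from a to b over [0, t]. *)
Definition bes3_bridge_law (a b : R) (P : probability (cpath t R) R) :
    Prop :=
  {ae P, forall phi : cpath t R,
    [/\ phi (time0 t) = a, phi (timeT t) = b & forall s, 0 <= phi s]} /\
  forall (n : nat) (s : n.-tuple (tset t)),
    path <%R 0 (rcons [seq set_val u | u <- s] t%:num) ->
    forall A : set (n.-tuple (measurableTypeR R)), measurable A ->
      P [set phi : cpath t R |
          A [tuple (phi (tnth s i) : measurableTypeR R) | i < n]] =
      tuple_integral (fun x =>
        (\1_(A `&` [set y | forall i, 0 < tnth y i]) x *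
         bes3_bridge_density a b [tuple set_val (tnth s i) | i < n] x)%:E).

End bessel_bridge.

(* E[X | A], the conditional expectation given an event A with P A > 0. When
   P A = 0 the value is 0, because x / 0 = x * +oo and 0 * +oo = 0 in \bar R. *)
Definition cond_expectation (d : measure_display) (T : measurableType d)
    (R : realType) (P : probability T R) (A : set T) (X : T -> \bar R) : \bar R :=
  ((\int[P]_(w in A) X w) / P A)%E.

(* Main.v *)
(* Write Z = rho - 2 min rho + rho_0 for the Pitman transform of a bridge rho from
   a to b. Pathwise, Mbar_x phi (s) = Z_s - 2 min (min_{u >= s} Z_u, (Z_t - x) / 2)
   with Z = Pbar phi, and Mbar_x phi = phi when phi_t = x. Hence both triples in
   the theorem are the same function of Z, and it is enough to compare the law of
   Z for the bridge from a to b with its law for the bridge from c to a + b - c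
   on the event that the minimum is at most min a b.

   The bridge is a Brownian bridge conditioned to stay positive, so the joint law
   of the path and of its running minimum at finitely many times is an iterated
   integral of the Brownian (position, minimum) densities. As in Pitman's
   theorem, given Z up to time s, with Z_s = w, the position at s is uniform on
   (-w, w) up to the shift by a: integrating out the running minimum intertwines
   these densities with the kernel of Brownian motion killed at 0. For the part of
   the law on which the final minimum lies between 0 and min a b, what is left is
   a chain of killed kernels from the entrance law at 0, with Z_t restricted to
   the interval between |a - b| and a + b. It depends on a + b and |a - b| only;
   for the bridge from c to a + b - c, it is the bound min a b on the minimum that
   makes |a - b| the lower end. *)

(* The bridge is given only by its finite-dimensional laws, while the running minimum depends on the
   whole path. No Brownian motion is constructed and no strong Markov property is used: the minimum
   is tested on dyadic grids, where the law is a chain of killed kernels, and the grid is removed by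
   a squeeze. If the levels are raised by d > 0, the grid conditions for all meshes imply the true
   event; if they are lowered by e > 0, ignoring the path between grid points costs a factor 1 -
   exp(-2 e^2 / step) for each of 2^N steps, and the product of these factors tends to 1.

   The Doob transform that turns Brownian motion killed at 0 into the Bessel process cancels along a
   path except at its two ends. All laws are therefore multiplied by [killed t 0 a b] and kept
   unnormalised. The ratio of the constants of the two bridges is the probability of the
   conditioning event; it is identified by taking the whole path space as test set and is never
   computed. *)
Require Import Defs.
From HB Require Import structures.
From mathcomp Require Import all_boot all_order all_algebra.
From mathcomp Require Import all_classical all_reals all_analysis.
From mathcomp Require Import measurable_realfun.
From mathcomp Require Import ring lra.

Set Implicit Arguments.
Unset Strict Implicit.
Unset Printing Implicit Defensive.

Import Order.TTheory GRing.Theory Num.Theory.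
Import numFieldNormedType.Exports.

Local Open Scope classical_set_scope.
Local Open Scope ring_scope.

(** * Gaussian and killed kernels *)

(* HB infers the measure structure of [pushforward m f] only up to an existential
   variable for the measurability of [f]. *)
Definition image_measure d d' (T1 : measurableType d) (T2 : measurableType d')
    (R : realType) (m : {measure set T1 -> \bar R}) (f : T1 -> T2)
    (mf : measurable_fun setT f) : {measure set T2 -> \bar R}.
Proof. by refine (pushforward m f : {measure set T2 -> \bar R}). Defined.

Section affine_substitution.
Variable R : realType.
Local Notation mu := (@lebesgue_measure R).

Lemma measurable_affine (k c : R) :
  measurable_fun setT (fun x : R => k * x + c).
Proof.
by apply: measurable_funD; [apply: measurable_funM|].
Qed.

(** Lebesgue measure is determined by its values on intervals open on the left and closed on the
    right, so the rescaled image measure has to be checked only there; for k < 0 the preimages are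
    closed on the left instead, with the same length. *)
Lemma lebesgue_measure_affine (k c : R) (A : set (measurableTypeR R)) :
  k != 0 -> measurable A ->
  mu A = (`|k|%:E * mu ((fun x => (k * x + c)%R : measurableTypeR R) @^-1` A))%E.
Proof.
move=> k0 mA.
pose phi : measurableTypeR R -> measurableTypeR R := fun x => (k * x + c)%R.
have mphi : measurable_fun setT phi := measurable_affine k c.
pose nu : {measure set (measurableTypeR R) -> \bar R} :=
  mscale (NngNum (normr_ge0 k)) (image_measure mu mphi).
transitivity (nu A); last by [].
apply: lebesgue_measure_unique => //= _ [[a b]] _ <-.
rewrite /nu /= /mscale /= /pushforward /=.
have nk0 : 0 < `|k| by rewrite normr_gt0.
case: (ltrgt0P k) => [kp|kn|kz]; last by rewrite kz eqxx in k0.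
- have h1 (y x : R) : (y < k * x + c) = ((y - c) / k < x).
    by rewrite ltr_pdivrMr// mulrC ltrBlDr.
  have h2 (y x : R) : (k * x + c <= y) = (x <= (y - c) / k).
    by rewrite ler_pdivlMr// mulrC lerBrDr.
  rewrite (_ : _ @^-1` _ = `](a - c) / k, (b - c) / k]%classic); last first.
    by apply/seteqP; split=> x /=; rewrite !in_itv/= -h1 -h2.
  rewrite !lebesgue_measure_itv/= !lte_fin ltr_pM2r ?invr_gt0// ltrD2r.
  case: ifP => _; last by rewrite mule0.
  by rewrite -EFinM; congr EFin; field; exact: lt0r_neq0.
- have h1 (y x : R) : (y < k * x + c) = (x < (y - c) / k).
    by rewrite ltr_ndivlMr// mulrC ltrBlDr.
  have h2 (y x : R) : (k * x + c <= y) = ((y - c) / k <= x).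
    by rewrite ler_ndivrMr// mulrC lerBrDr.
  rewrite (_ : _ @^-1` _ = `[(b - c) / k, (a - c) / k[%classic); last first.
    by apply/seteqP; split=> x /=; rewrite !in_itv/= -h1 -h2 andbC.
  rewrite !lebesgue_measure_itv/= !lte_fin ltr_nM2r ?invr_lt0// ltrD2r.
  case: ifP => _; last by rewrite mule0.
  by rewrite -EFinM; congr EFin; field; exact: ltr0_neq0.
Qed.

Lemma ge0_integral_affine (k c : R) (f : measurableTypeR R -> \bar R) :
  k != 0 -> measurable_fun setT f -> (forall x, 0 <= f x)%E ->
  (\int[mu]_x f x = `|k|%:E * \int[mu]_x f (k * x + c)%R)%E.
Proof.
move=> k0 mf f0.
pose phi : measurableTypeR R -> measurableTypeR R := fun x => (k * x + c)%R.
have mphi : measurable_fun setT phi := measurable_affine k c.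
have := @ge0_integral_pushforward _ _ _ _ R phi mphi mu setT f measurableT.
rewrite preimage_setT => /(_ mf (fun x _ => f0 x)) /= <-.
rewrite -(@ge0_integral_mscale _ _ _ (image_measure mu mphi) setT measurableT
  (NngNum (normr_ge0 k)) f)//.
by apply: eq_measure_integral => A mA _; exact: lebesgue_measure_affine.
Qed.

Lemma ge0_integral_reflect (c : R) (f : measurableTypeR R -> \bar R) :
  measurable_fun setT f -> (forall x, 0 <= f x)%E ->
  (\int[mu]_x f x = \int[mu]_x f (c - x)%R)%E.
Proof.
move=> mf f0.
rewrite (@ge0_integral_affine (-1) c)// ?oppr_eq0 ?oner_eq0//.
rewrite normrN1 mul1e; apply: eq_integral => x _; congr f.
by rewrite mulN1r addrC.
Qed.

End affine_substitution.

Section gaussian_kernels.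
Variable R : realType.
Implicit Types r l x y z u : R.
Local Notation mR := (measurableTypeR R).
Local Notation mu := (@lebesgue_measure R).

Definition gauss r x : R :=
  (Num.sqrt (2 * pi * r))^-1 * expR (- (x ^+ 2 / (2 * r))).

(** Minus the space derivative of [gauss r]; for x > 0 it is also the density in r of the hitting
    time of level x by Brownian motion. *)
Definition flux r x : R := x / r * gauss r x.

(* The heat kernel killed below level l: the reflection principle gives
   gauss r (x - y) - gauss r (x + y - 2 l) for x, y > l, and the formula below
   extends this by 0, continuously in l, to all x, y. *)
Definition killed r l x y : R :=
  gauss r (x - y) - gauss r (`|x - y| + 2 * Num.max 0 (Num.min x y - l)).

Lemma sqrt2pir_gt0 r : 0 < r -> 0 < Num.sqrt (2 * pi * r).
Proof. by move=> r0; rewrite sqrtr_gt0 !mulr_gt0// pi_gt0. Qed.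

Lemma gauss_gt0 r x : 0 < r -> 0 < gauss r x.
Proof. by move=> r0; rewrite mulr_gt0 ?expR_gt0// invr_gt0 sqrt2pir_gt0. Qed.

(** The square root of a nonpositive number and the inverse of 0 are both 0. This lets positivity
    and measurability of the kernels be stated for every r. *)
Lemma gauss_junk r : r <= 0 -> gauss r = cst 0.
Proof.
move=> r0; apply/funext => x; rewrite /gauss ler0_sqrtr ?invr0 ?mul0r//.
by rewrite mulr_ge0_le0// mulr_ge0 ?pi_ge0.
Qed.

Lemma gauss_ge0 r x : 0 <= gauss r x.
Proof. by rewrite mulr_ge0 ?expR_ge0// invr_ge0 sqrtr_ge0. Qed.

Lemma gauss_le r x : 0 < r -> gauss r x <= (Num.sqrt (2 * pi * r))^-1.
Proof.
move=> r0; rewrite ler_piMr ?invr_ge0 ?sqrtr_ge0// -expR0 ler_expR.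
by rewrite oppr_le0 divr_ge0 ?sqr_ge0// mulr_ge0// ltW.
Qed.

Lemma ler_gauss r x y : 0 < r -> `|x| <= `|y| -> gauss r y <= gauss r x.
Proof.
move=> r0 xy; rewrite ler_pM2l ?invr_gt0 ?sqrt2pir_gt0// ler_expR lerN2.
rewrite ler_pM2r ?invr_gt0 ?mulr_gt0//.
by rewrite -(real_normK (num_real x)) -(real_normK (num_real y)) lerXn2r ?nnegrE.
Qed.

Lemma gauss_norm r x : gauss r `|x| = gauss r x.
Proof. by rewrite /gauss real_normK ?num_real. Qed.

Lemma gaussN r x : gauss r (- x) = gauss r x.
Proof. by rewrite /gauss sqrrN. Qed.

Lemma is_derive_gauss r x : 0 < r -> is_derive x 1 (gauss r) (- flux r x).
Proof.
move=> r0; rewrite /gauss.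
apply: is_derive_eq; rewrite /flux /gauss /GRing.scale /=; field.
by rewrite !gt_eqF// ?sqrt2pir_gt0.
Qed.

Lemma continuous_gauss r : 0 < r -> continuous (gauss r).
Proof.
move=> r0 x; apply: differentiable_continuous.
by apply/derivable1_diffP; case: (is_derive_gauss x r0).
Qed.

Lemma measurable_gauss r : measurable_fun setT (gauss r).
Proof.
have [/gauss_junk ->|r0] := leP r 0; first exact: measurable_cst.
by apply: continuous_measurable_fun; exact: continuous_gauss.
Qed.

Lemma measurable_flux1 r : measurable_fun setT (flux r).
Proof.
by apply: measurable_funM; [exact: measurable_funM|exact: measurable_gauss].
Qed.

Lemma continuous_flux r : 0 < r -> continuous (flux r).
Proof.
move=> r0 x; apply: cvgM; last exact: continuous_gauss.
by apply: cvgM; [exact: cvg_id|exact: cvg_cst].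
Qed.

Lemma flux_ge0 r x : 0 <= x -> 0 <= flux r x.
Proof.
move=> x0; have [/gauss_junk r0|r0] := leP r 0; first by rewrite /flux r0 mulr0.
by rewrite mulr_ge0 ?gauss_ge0// divr_ge0// ltW.
Qed.

Lemma killedE r l x y : l <= x -> l <= y ->
  killed r l x y = gauss r (x - y) - gauss r (x + y - 2 * l).
Proof.
move=> lx ly; rewrite /killed; congr (_ - gauss r _).
case: (leP x y) => [xy|/ltW xy].
  rewrite ler0_norm ?subr_le0//.
  have -> : Num.max 0 (x - l) = x - l by apply/max_idPr; lra.
  by ring.
rewrite ger0_norm ?subr_ge0//.
have -> : Num.max 0 (y - l) = y - l by apply/max_idPr; lra.
by ring.
Qed.

Lemma killed_out r l x y : (x <= l) || (y <= l) -> killed r l x y = 0.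
Proof.
move=> xyl; rewrite /killed (_ : Num.max 0 _ = 0).
  by rewrite mulr0 addr0 gauss_norm subrr.
by apply/max_idPl; rewrite subr_le0 ge_min.
Qed.

Lemma ler_killed r l l' x y : 0 < r -> l <= l' ->
  killed r l' x y <= killed r l x y.
Proof.
move=> r0 ll'; rewrite lerD2l lerN2; apply: ler_gauss => //.
have h m : 0 <= `|x - y| + 2 * Num.max 0 m.
  by rewrite addr_ge0// mulr_ge0// le_max lexx.
rewrite (ger0_norm (h (_ - l))) (ger0_norm (h (_ - l'))).
rewrite lerD2l ler_pM2l// ge_max le_max lexx/= le_max.
by rewrite lerD2l lerN2 ll' orbT.
Qed.

Lemma killed_ge0 r l x y : 0 <= killed r l x y.
Proof.
have [/gauss_junk r0|r0] := leP r 0; first by rewrite /killed r0 subrr.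
rewrite subr_ge0; apply: ler_gauss => //.
have h (m : R) : 0 <= 2 * Num.max 0 m by rewrite mulr_ge0// le_max lexx.
by rewrite (ger0_norm (addr_ge0 _ (h _)))// lerDl.
Qed.

Lemma killed_le_gauss r l x y : 0 < r -> killed r l x y <= gauss r (x - y).
Proof. by move=> r0; rewrite gerBl ltW// gauss_gt0. Qed.

Lemma killed_le r l x y : 0 < r -> killed r l x y <= (Num.sqrt (2 * pi * r))^-1.
Proof. by move=> r0; rewrite (le_trans (killed_le_gauss _ _ _ r0)) ?gauss_le. Qed.

Lemma killed_gt0 r l x y : 0 < r -> l < x -> l < y -> 0 < killed r l x y.
Proof.
move=> r0 lx ly; rewrite killedE ?ltW// subr_gt0.
rewrite ltr_pM2l ?invr_gt0 ?sqrt2pir_gt0// ltr_expR ltrN2.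
rewrite ltr_pM2r ?invr_gt0 ?mulr_gt0//.
(* (x + y - 2 l)^2 - (x - y)^2 = 4 (x - l) (y - l). *)
have : 0 < (x - l) * (y - l) by rewrite mulr_gt0 ?subr_gt0.
by nra.
Qed.

Lemma bes3_qE r x y : 0 < r -> 0 < x -> 0 < y ->
  bes3_q r x y = killed r 0 x y / (x * y).
Proof.
move=> r0 x0 y0; rewrite killedE ?ltW// mulr0 subr0 /bes3_q /gauss.
by field; rewrite !gt_eqF// ?sqrt2pir_gt0.
Qed.

(* For x, y > l the two exponents differ by 2 (x - l + e) (y - l + e) / r. *)
Lemma gauss_le_killed r l e x y : 0 < r -> 0 <= e -> l < x -> l < y ->
  (1 - expR (- (2 * e ^+ 2 / r))) * gauss r (x - y) <= killed r (l - e) x y.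
Proof.
move=> r0 e0 lx ly; rewrite killedE; [|lra..].
rewrite mulrBl mul1r lerD2l lerN2 /gauss mulrCA.
rewrite ler_pM2l ?invr_gt0 ?sqrt2pir_gt0// -expRD ler_expR -opprD lerN2.
rewrite -(ler_pM2r (_ : 0 < 2 * r)) ?mulr_gt0// mulrDl.
rewrite !divfK ?gt_eqF ?mulr_gt0//.
rewrite (_ : 2 * e ^+ 2 / r * _ = 4 * e ^+ 2); last by field; exact: lt0r_neq0.
have : 0 <= (x - l) * (y - l) by rewrite mulr_ge0// subr_ge0 ltW.
have : 0 <= (x - l) * e by rewrite mulr_ge0// subr_ge0 ltW.
have : 0 <= (y - l) * e by rewrite mulr_ge0// subr_ge0 ltW.
by nra.
Qed.

Lemma measurable_killed d (T : measurableType d) r (l x y : T -> R) :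
  measurable_fun setT l -> measurable_fun setT x -> measurable_fun setT y ->
  measurable_fun setT (fun w => killed r (l w) (x w) (y w)).
Proof.
move=> ml mx my; apply: measurable_funB.
  by apply: measurableT_comp; [exact: measurable_gauss|exact: measurable_funB].
apply: measurableT_comp; first exact: measurable_gauss.
apply: measurable_funD.
  by apply: measurableT_comp => //; exact: measurable_funB.
apply: measurable_funM => //; apply: measurable_maxr => //.
by apply: measurable_funB => //; exact: measurable_minr.
Qed.

(** Completing the square in y leaves a constant times the normal density of mean (r' x + r z) / (r
    + r') and variance r r' / (r + r'), whose integral is 1. *)
Lemma gauss_convolution r r' x z : 0 < r -> 0 < r' ->
  (\int[mu]_y (gauss r (x - y) * gauss r' (y - z))%:E =
   (gauss (r + r') (x - z))%:E)%E.
Proof.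
move=> r0 r'0; have rr' : 0 < r + r' by rewrite addr_gt0.
pose s := Num.sqrt (r * r' / (r + r')).
have s2 : s ^+ 2 = r * r' / (r + r').
  by rewrite sqr_sqrtr// ltW// divr_gt0// mulr_gt0.
have s0 : 0 < s by rewrite sqrtr_gt0 divr_gt0// mulr_gt0.
pose m := (r' * x + r * z) / (r + r').
have -> : (fun y => (gauss r (x - y) * gauss r' (y - z))%:E) =
    (fun y => (gauss (r + r') (x - z))%:E * (normal_pdf m s y)%:E)%E.
  apply/funext => y; rewrite -EFinM; congr EFin.
  rewrite normal_pdfE ?gt_eqF// /normal_peak /normal_fun /gauss.
  rewrite mulrACA [RHS]mulrACA -!expRD -!invfM; congr (_ ^-1 * expR _).
    rewrite s2 -!sqrtrM ?mulr_ge0 ?pi_ge0 ?ltW//; congr Num.sqrt.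
    by field; exact: lt0r_neq0.
  rewrite s2 /m; field.
  by rewrite !gt_eqF.
rewrite ge0_integralZl//.
- by rewrite integral_normal_pdf// mule1.
- by apply/measurable_EFinP; exact: measurable_normal_pdf.
- by move=> y _; rewrite lee_fin normal_pdf_ge0.
- by rewrite lee_fin ltW// gauss_gt0.
Qed.

End gaussian_kernels.

Lemma ge0_integralDT (R : realType) d (T : measurableType d) (m : {measure set T -> \bar R})
    (f g : T -> \bar R) : measurable_fun setT f -> measurable_fun setT g ->
  (forall x, 0 <= f x)%E -> (forall x, 0 <= g x)%E ->
  (\int[m]_x (f x + g x) = \int[m]_x f x + \int[m]_x g x)%E.
Proof. by move=> mf mg f0 g0; rewrite ge0_integralD. Qed.

Section killed_composition.
Variable R : realType.
Implicit Types r l x y z u : R.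
Local Notation mR := (measurableTypeR R).
Local Notation mu := (@lebesgue_measure R).

(* The unrestricted product of the two reflected kernels is symmetric about l,
   and its integral is a sum of four Gaussian convolutions. *)
Lemma killed_composition r r' l x z : 0 < r -> 0 < r' ->
  (\int[mu]_y (killed r l x y * killed r' l y z)%:E =
   (killed (r + r') l x z)%:E)%E.
Proof.
move=> r0 r'0.
have [xzl|] := boolP ((x <= l) || (z <= l)).
  rewrite (killed_out _ xzl) integral0_eq// => y _; congr EFin.
  case/orP: xzl => h.
    by rewrite (@killed_out _ _ _ x y) ?h// mul0r.
  by rewrite (@killed_out _ _ _ y z) ?h ?orbT// mulr0.
rewrite negb_or -!ltNge => /andP[lx lz].
pose f y := killed r l x y * killed r' l y z.
pose A1 y := gauss r (x - y) * gauss r' (y - z).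
pose A2 y := gauss r (x - y) * gauss r' (y - (2 * l - z)).
pose A3 y := gauss r ((2 * l - x) - y) * gauss r' (y - z).
pose A4 y := gauss r ((2 * l - x) - y) * gauss r' (y - (2 * l - z)).
have f0 y : 0 <= f y by rewrite mulr_ge0// killed_ge0.
have g0 (s c w : R) : 0 < s -> 0 <= gauss s (c - w) by move=> s0; exact/ltW/gauss_gt0.
have mf : measurable_fun setT (fun y : mR => (f y)%:E).
  by apply/measurable_EFinP; apply: measurable_funM; exact: measurable_killed.
have mg (s c : R) : 0 < s -> measurable_fun setT (fun y : mR => gauss s (y - c)).
  by move=> s0; apply: (measurableT_comp (@measurable_gauss _ s));
    exact: measurable_funB.
have mg' (s c : R) : 0 < s -> measurable_fun setT (fun y : mR => gauss s (c - y)).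
  by move=> s0; apply: (measurableT_comp (@measurable_gauss _ s));
    exact: measurable_funB.
(* One of [f y] and [f (2 * l - y)] always vanishes. The identity is written without subtraction, so
   that it can be integrated term by term in the extended reals. *)
have key y : f y + f (2 * l - y) + (A2 y + A3 y) = A1 y + A4 y.
  rewrite /A1 /A2 /A3 /A4 -(gaussN _ (2 * l - x - y)).
  case: (leP y l) => yl.
    rewrite /f (@killed_out _ _ _ x y) ?yl ?orbT// mul0r add0r !killedE; [|lra..].
    rewrite (_ : x - (2 * l - y) = - (2 * l - x - y)); last by ring.
    rewrite (_ : x + (2 * l - y) - _ = x - y); last by ring.
    rewrite (_ : 2 * l - y - z = - (y - (2 * l - z))); last by ring.
    rewrite (_ : 2 * l - y + z - _ = - (y - z)); last by ring.
    by rewrite !(gaussN r'); ring.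
  rewrite /f (@killed_out _ _ _ x (2 * l - y)) ?mul0r ?addr0 ?killedE; [|lra..|].
    rewrite (_ : x + y - _ = - (2 * l - x - y)); last by ring.
    by rewrite (_ : y + z - _ = y - (2 * l - z)); [ring|ring].
  by apply/orP; right; lra.
have : (\int[mu]_y ((f y)%:E + (f (2 * l - y))%:E + ((A2 y)%:E + (A3 y)%:E)) =
        \int[mu]_y ((A1 y)%:E + (A4 y)%:E))%E.
  by apply: eq_integral => y _; rewrite -!EFinD key.
have mA (h1 h2 : mR -> R) : measurable_fun setT h1 -> measurable_fun setT h2 ->
    measurable_fun setT (fun y : mR => (h1 y * h2 y)%:E).
  by move=> ? ?; apply/measurable_EFinP; exact: measurable_funM.
have mf' : measurable_fun setT (fun y : mR => (f (2 * l - y))%:E).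
  apply/measurable_EFinP; apply: measurable_funM; apply: measurable_killed => //;
    exact: measurable_funB.
have m1 : measurable_fun setT (fun y : mR => (A1 y)%:E).
  by apply: mA; [exact: mg'|exact: mg].
have m2 : measurable_fun setT (fun y : mR => (A2 y)%:E).
  by apply: mA; [exact: mg'|exact: mg].
have m3 : measurable_fun setT (fun y : mR => (A3 y)%:E).
  by apply: mA; [exact: mg'|exact: mg].
have m4 : measurable_fun setT (fun y : mR => (A4 y)%:E).
  by apply: mA; [exact: mg'|exact: mg].
have p1 y : (0 <= (A1 y)%:E)%E by rewrite lee_fin mulr_ge0// g0.
have p2 y : (0 <= (A2 y)%:E)%E by rewrite lee_fin mulr_ge0// g0.
have p3 y : (0 <= (A3 y)%:E)%E by rewrite lee_fin mulr_ge0// g0.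
have p4 y : (0 <= (A4 y)%:E)%E by rewrite lee_fin mulr_ge0// g0.
have pf y : (0 <= (f y)%:E)%E by rewrite lee_fin.
rewrite (ge0_integralDT mu m1 m4)// (ge0_integralDT mu (emeasurable_funD mf mf')
  (emeasurable_funD m2 m3)); last 2 first.
- by move=> y; exact: adde_ge0.
- by move=> y; exact: adde_ge0.
rewrite (ge0_integralDT mu mf mf')// (ge0_integralDT mu m2 m3)//.
rewrite !gauss_convolution// -(@ge0_integral_reflect _ (2 * l) (EFin \o f))//.
rewrite killedE ?ltW//.
rewrite (_ : 2 * l - x - z = - (x + z - 2 * l)); last by ring.
rewrite (_ : x - (2 * l - z) = x + z - 2 * l); last by ring.
rewrite (_ : 2 * l - x - (2 * l - z) = - (x - z)); last by ring.
rewrite !gaussN; rewrite /f /=.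
(* Reflection has produced the same integral I twice: 2 I + 2 gauss (x + z - 2 l) = 2 gauss (x - z),
   which also excludes an infinite I. *)
case: (\int[mu]_y _)%E => [I||]//= [] H; congr EFin; lra.
Qed.

End killed_composition.

(* Joint density, in the pair (y, l), of the position at time r and of the
   minimum over [0, r] of a Brownian motion started at x. *)
Definition step_density (R : realType) (r x y l : R) : R :=
  (l < Num.min x y)%R%:R * (2 * flux r (x + y - 2 * l)).

Section measurability_toolbox.
Context d (T : measurableType d) (R : realType).
Local Notation mR := (measurableTypeR R).
Local Notation mu := (@lebesgue_measure R).

Lemma measurable_ltr_nat (f g : T -> R) :
  measurable_fun setT f -> measurable_fun setT g ->
  measurable_fun setT (fun w => (f w < g w)%R%:R : R).
Proof.
move=> mf mg; rewrite (_ : (fun _ => _) = \1_[set w | f w < g w]).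
  apply: measurable_indic; rewrite -[X in measurable X]setTI.
  exact: (measurable_fun_ltr mf mg measurableT (Y := [set true]) Logic.I).
by apply/funext => w; rewrite indicE; congr (nat_of_bool _)%:R; apply/idP/idP;
  rewrite inE.
Qed.

Lemma measurable_ler_nat (f g : T -> R) :
  measurable_fun setT f -> measurable_fun setT g ->
  measurable_fun setT (fun w => (f w <= g w)%R%:R : R).
Proof.
move=> mf mg; rewrite (_ : (fun _ => _) = \1_[set w | f w <= g w]).
  apply: measurable_indic; rewrite -[X in measurable X]setTI.
  exact: (measurable_fun_ler mf mg measurableT (Y := [set true]) Logic.I).
by apply/funext => w; rewrite indicE; congr (nat_of_bool _)%:R; apply/idP/idP;
  rewrite inE.
Qed.

Lemma measurable_integral (f : T -> mR -> \bar R) :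
  measurable_fun setT (fun p : T * mR => f p.1 p.2) ->
  (forall w y, 0 <= f w y)%E ->
  measurable_fun setT (fun w => \int[mu]_y f w y)%E.
Proof.
move=> mf f0.
exact: (@measurable_fun_fubini_tonelli_F _ _ _ _ _ mu _ mf
  (fun p => f0 p.1 p.2)).
Qed.

Lemma tonelli (f : mR -> mR -> \bar R) :
  measurable_fun setT (fun p : mR * mR => f p.1 p.2) ->
  (forall x y, 0 <= f x y)%E ->
  (\int[mu]_x \int[mu]_y f x y = \int[mu]_y \int[mu]_x f x y)%E.
Proof.
move=> mf f0.
exact: (@fubini_tonelli _ _ _ _ _ mu mu (fun p => f p.1 p.2) mf
  (fun p => f0 p.1 p.2)).
Qed.

Lemma ge0_integralZlT (m : {measure set T -> \bar R}) (f : T -> \bar R) k :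
  measurable_fun setT f -> (forall x, 0 <= f x)%E -> (0 <= k)%E ->
  (\int[m]_x (k * f x) = k * \int[m]_x f x)%E.
Proof. by move=> mf f0 k0; rewrite ge0_integralZl. Qed.

Lemma ge0_integralZrT (m : {measure set T -> \bar R}) (f : T -> \bar R) k :
  measurable_fun setT f -> (forall x, 0 <= f x)%E -> (0 <= k)%E ->
  (\int[m]_x (f x * k) = (\int[m]_x f x) * k)%E.
Proof. by move=> mf f0 k0; rewrite ge0_integralZr. Qed.

Lemma measurable_flux r (f : T -> R) : measurable_fun setT f ->
  measurable_fun setT (fun w => flux r (f w)).
Proof. by apply: measurableT_comp; exact: measurable_flux1. Qed.

Lemma measurable_gaussT r (f : T -> R) : measurable_fun setT f ->
  measurable_fun setT (fun w => gauss r (f w)).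
Proof. by apply: measurableT_comp; exact: measurable_gauss. Qed.

Lemma measurable_indicT d' (T' : measurableType d') (A : set T') (f : T -> T') :
  measurable A -> measurable_fun setT f ->
  measurable_fun setT (fun w => \1_A (f w) : R).
Proof.
by move=> mA mf; apply: (measurableT_comp (f := \1_A : T' -> R)).
Qed.

Lemma measurable_normT (f : T -> R) : measurable_fun setT f ->
  measurable_fun setT (fun w => `|f w|).
Proof. by apply: measurableT_comp; exact: normr_measurable. Qed.

Lemma measurable_oppT (f : T -> R) : measurable_fun setT f ->
  measurable_fun setT (fun w => - f w).
Proof. by apply: measurableT_comp; exact: oppr_measurable. Qed.

Lemma measurable_step_density r (x y l : T -> R) :
  measurable_fun setT x -> measurable_fun setT y ->
  measurable_fun setT l ->
  measurable_fun setT (fun w => step_density r (x w) (y w) (l w)).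
Proof.
move=> mx my ml; apply: measurable_funM.
  by apply: measurable_ltr_nat => //; exact: measurable_minr.
apply: measurable_funM => //; apply: measurable_flux => //.
by apply: measurable_funB; [exact: measurable_funD|exact: measurable_funM].
Qed.

End measurability_toolbox.

Ltac meas_step := lazymatch goal with
  | |- measurable_fun _ (fun w => EFin (@?f w)) => apply/measurable_EFinP
  | |- measurable_fun _ (fun w => (@?f w * @?g w)%E) => apply: emeasurable_funM
  | |- measurable_fun _ (fun w => (@?f w + @?g w)%E) => apply: emeasurable_funD
  | |- measurable_fun _ (fun w => (@?f w * @?g w)%R) => apply: measurable_funM
  | |- measurable_fun _ (fun w => (@?f w + @?g w)%R) => apply: measurable_funD
  | |- measurable_fun _ (fun w => (- @?f w)%R) => apply: measurable_oppT
  | |- measurable_fun _ (fun w => `|@?f w|%R) => apply: measurable_normT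
  | |- measurable_fun _ (fun w => Num.min (@?f w) (@?g w)) => apply: measurable_minr
  | |- measurable_fun _ (fun w => Num.max (@?f w) (@?g w)) => apply: measurable_maxr
  | |- measurable_fun _ (fun w => (nat_of_bool (@?f w < @?g w)%R)%:R) =>
      apply: measurable_ltr_nat
  | |- measurable_fun _ (fun w => (nat_of_bool (@?f w <= @?g w)%R)%:R) =>
      apply: measurable_ler_nat
  | |- measurable_fun _ (fun w => killed _ _ _ _) => apply: measurable_killed
  | |- measurable_fun _ (fun w => step_density _ _ _ _) =>
      apply: measurable_step_density
  | |- measurable_fun _ (fun w => flux _ _) => apply: measurable_flux
  | |- measurable_fun _ (fun w => \1__ _) => apply: measurable_indicT
  | |- measurable_fun _ (fun w => gauss _ _) => apply: measurable_gaussT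
  | |- measurable_fun _ _ =>
     first [ exact: measurable_cst | exact: measurable_id | assumption
           | exact: measurable_fst | exact: measurable_snd
           | apply: measurable_funD; [exact: measurable_cst|exact: measurable_id]
           | apply: measurable_minr; [exact: measurable_cst|exact: measurable_id]
           | apply: measurable_step_density;
               [exact: measurable_cst|exact: measurable_cst|exact: measurable_id]
           | apply: measurable_killed;
               [exact: measurable_cst|exact: measurable_cst|exact: measurable_id]
           | apply: measurableT_comp; [exact: measurable_fst|]
           | apply: measurableT_comp; [exact: measurable_snd|]
           | apply: measurableT_comp; [eassumption|] ]
  | |- _ => done
  end.
Ltac meas := repeat meas_step.

Section flux_integrals.
Variable R : realType.
Implicit Types r l x y z u : R.
Local Notation mR := (measurableTypeR R).
Local Notation mu := (@lebesgue_measure R).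

Lemma eq_integralR (f g : R -> \bar R) : f =1 g ->
  (\int[mu]_x f x = \int[mu]_x g x)%E.
Proof. by move=> fg; apply: eq_integral => x _; exact: fg. Qed.

Lemma integral_itv_indic (i : interval R) (f : R -> R) :
  (\int[mu]_w ((w \in i)%:R * f w)%:E = \int[mu]_(w in [set` i]) (f w)%:E)%E.
Proof.
rewrite [RHS]integral_mkcond; apply: eq_integral => w _ /=.
have -> : (w \in i) = (w \in [set` i]) by rewrite mem_setE.
by rewrite patchE; case: ifP => _; rewrite ?mul1r ?mul0r.
Qed.

(** The antiderivative is -(c / k) gauss r (k w + s). The booleans cover open and closed ends alike,
    since endpoints are null sets. *)
Lemma integral_flux (r c k s u v : R) (b0 b1 : bool) : 0 < r -> k != 0 -> u <= v ->
  (\int[mu]_w ((w \in Interval (BSide b0 u) (BSide b1 v))%:R *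
    (c * flux r (k * w + s)))%:E =
   (c / k * (gauss r (k * u + s) - gauss r (k * v + s)))%:E)%E.
Proof.
move=> r0 k0; rewrite integral_itv_indic le_eqVlt => /predU1P[<-|uv].
  rewrite subrr mulr0 (integral_Sset1 u)// => w /=; rewrite in_itv/=.
  by case: b0 b1 => -[] /=; case: ltrgtP.
pose f w := c * flux r (k * w + s).
pose F (w : R) : R := - (c / k) * gauss r (k * w + s).
have cf : continuous f.
  move=> w; apply: cvgM; first exact: cvg_cst.
  apply: (@continuous_comp _ _ _ (fun w => k * w + s)); last exact: continuous_flux.
  by apply: cvgD; [apply: cvgM; [exact: cvg_cst|exact: cvg_id]|exact: cvg_cst].
have dF (w : R) : is_derive w (1 : R) F (f w).
  have dg := is_derive_gauss (k * w + s) r0.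
  have da : is_derive w (1 : R) (fun w : R => k * w + s) k.
    by apply: is_derive_eq; rewrite /GRing.scale /=; ring.
  have := @is_derive1_comp _ (gauss r) (fun w : R => k * w + s) w _ _ dg da.
  by move=> H; apply: is_derive_eq; rewrite /f /GRing.scale /=; field.
have cF : continuous F.
  move=> w; apply: differentiable_continuous.
  by apply/derivable1_diffP; case: (dF w).
have mf : measurable_fun setT (EFin \o f).
  by apply/measurable_EFinP; exact: continuous_measurable_fun.
rewrite (@integral_itv_bndoo _ _ _ (EFin \o f)); last exact: measurable_funTS.
rewrite -(@integral_itv_bndoo _ _ _ (EFin \o f) true false);
  last exact: measurable_funTS.
rewrite (@continuous_FTC2 _ f F)//.
- by rewrite /F -EFinB; congr EFin; ring.
- exact: continuous_subspaceT.
- split => [w _||]; first by case: (dF w).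
  + exact/cvg_at_right_filter/cF.
  + exact/cvg_at_left_filter/cF.
- by move=> w _; rewrite derive1E; case: (dF w).
Qed.

Lemma step_density_ge0 r x y l : 0 <= step_density r x y l.
Proof.
rewrite /step_density lt_min; case: ltP => lx; rewrite ?mul0r//=.
case: ltP => ly; rewrite ?mul0r//= mul1r mulr_ge0// flux_ge0//; lra.
Qed.

(** This justifies the name of [step_density]: the paths whose minimum exceeds [l0] are those that
    survive killing at [l0]. In l the density is the derivative of a Gaussian. *)
Lemma integral_step_density r x y l0 : 0 < r ->
  (\int[mu]_l (step_density r x y l * (l0 < l)%R%:R)%:E =
   (killed r l0 x y)%:E)%E.
Proof.
move=> r0; have [xyl|] := boolP ((x <= l0) || (y <= l0)).
  rewrite killed_out// integral0_eq// => l _; congr EFin.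
  rewrite /step_density lt_min; case: (ltP l0 l) => l0l; last by rewrite mulr0.
  case/orP: xyl => h; first by rewrite (lt_gtF (le_lt_trans h l0l)) !mul0r.
  by rewrite (lt_gtF (le_lt_trans h l0l)) andbF !mul0r.
rewrite negb_or -!ltNge => /andP[lx ly]; rewrite killedE ?ltW//.
have lm : l0 <= Num.min x y by rewrite le_min !ltW.
have n0 : (-2 : R) != 0 by rewrite oppr_eq0 pnatr_eq0.
have := @integral_flux r 2 (-2) (x + y) _ _ false true r0 n0 lm.
transitivity (\int[mu]_l ((l \in `]l0, (Num.min x y)[)%:R *
    (2 * flux r (- 2 * l + (x + y))))%:E)%E.
  apply: eq_integralR => l; congr EFin; rewrite /step_density in_itv/=.
  rewrite mulrAC -natrM mulnb andbC; congr (_%:R * (2 * flux r _)); ring.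
rewrite integral_flux//; congr EFin.
rewrite (_ : 2 / -2 = -1); last by field.
rewrite mulN1r opprB; congr (_ - gauss r _); last by ring.
(* At the upper end l = min x y, the argument x + y - 2 l is |x - y|. *)
case: (leP x y) => _; last by congr gauss; ring.
by rewrite -(gaussN r (x - y)); congr gauss; ring.
Qed.

End flux_integrals.

(** * Intertwining of the (position, minimum) densities with the killed kernel *)

Section intertwining.
Variable R : realType.
Implicit Types r l x y z w : R.
Local Notation mR := (measurableTypeR R).
Local Notation mu := (@lebesgue_measure R).

(** Either the step stays above [m], which has the killed kernel as its weight and leaves the
    minimum equal to [m], or the new minimum is l <= m. *)
Lemma integral_step_density_min r x y m (g : mR -> \bar R) : 0 < r ->
  measurable_fun setT g -> (forall l, 0 <= g l)%E ->
  (\int[mu]_l ((step_density r x y l)%:E * g (Num.min m l)) =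
   (killed r m x y)%:E * g m +
   \int[mu]_l ((step_density r x y l * (l <= m)%R%:R)%:E * g l))%E.
Proof.
move=> r0 mg g0.
rewrite -(integral_step_density x y m r0) -ge0_integralZrT//; first last.
- by move=> l; rewrite lee_fin mulr_ge0// step_density_ge0.
- by meas.
rewrite -ge0_integralDT//; first last.
- by move=> l; rewrite mule_ge0// lee_fin mulr_ge0// step_density_ge0.
- by move=> l; rewrite mule_ge0// lee_fin mulr_ge0// step_density_ge0.
- by meas.
- by meas.
apply: eq_integralR => l.
case: ltP => ml; first by rewrite mulr1 mulr0 mul0e adde0.
by rewrite mulr0 mulr1 mul0e add0e.
Qed.

(** The two halves of [intertwining_step] at a fixed w. An earlier minimum forces x = y + z - w. If
    that point lies in (-z, z), the maximum is y + z and the two occurrences of gauss (y + z)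
    cancel; otherwise the maximum is w - z and the first term is absent. *)
Lemma intertwining_coefficient r y z w : 0 < r -> 0 < z ->
  (`|y + z - w| < z)%R%:R * killed r ((y - w) / 2) (y + z - w) y +
  (`|y| < w)%R%:R * (gauss r (Num.max (w - z) (y + z)) - gauss r (z + w)) =
  (`|y| < w)%R%:R * killed r 0 z w.
Proof.
move=> r0 z0.
case: (ltP `|y| w) => [|yw]; rewrite ?mul0r ?addr0 ?mul1r; last first.
  have [h|] := ltP `|_| z; last by rewrite mul0r.
  rewrite killed_out ?mulr0//; apply/orP; right.
  by move: yw h; rewrite ltr_norml ler_normr => /orP[] ? /andP[] ? ?; lra.
rewrite ltr_norml => /andP[yw wy].
rewrite (@killedE _ r 0); [|lra..]; rewrite mulr0 subr0.
have [h|] := ltP `|_| z.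
  move: h; rewrite ltr_norml => /andP[h _].
  rewrite mul1r killedE; [|lra..].
  rewrite (_ : y + z - w - y = z - w); last by ring.
  rewrite (_ : y + z - w + y - _ = y + z); last by field.
  have -> : Num.max (w - z) (y + z) = y + z by apply/max_idPr; lra.
  by rewrite subrKA.
rewrite ler_normr => h.
have -> : Num.max (w - z) (y + z) = w - z.
  by apply/max_idPl; case/orP: h => h; lra.
by rewrite mul0r add0r -(gaussN _ (w - z)) opprB.
Qed.

(** With the new minimum fixed at (y - w) / 2, the start x runs from max (- z) (y - w + z) to z, and
    the flux is taken at x + w. *)
Lemma integral_step_density_start r y z w : 0 < r -> 0 < z ->
  (\int[mu]_x ((`|x| < z)%R%:R * (step_density r x y ((y - w) / 2) *
     ((y - w) / 2 <= (x - z) / 2)%R%:R))%:E =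
   ((`|y| < w)%R%:R *
     (2 * (gauss r (Num.max (w - z) (y + z)) - gauss r (z + w))))%:E)%E.
Proof.
move=> r0 z0; have [yw|yw] := ltP `|y| w; last first.
  rewrite mul0r; transitivity (\int[mu]_x (0 : \bar R))%E; last first.
    exact: integral0.
  apply: eq_integralR => x; congr EFin; rewrite /step_density lt_min.
  have [xz|_] := ltP `|x| z; last by rewrite mul0r.
  have [h|_] := leP ((y - w) / 2) ((x - z) / 2); last by rewrite !mulr0.
  move: yw xz; rewrite ler_normr ltr_norml => /orP[] h' /andP[h1 h2].
    by exfalso; lra.
  have -> : ((y - w) / 2 < y) = false by apply/negbTE; rewrite -leNgt; lra.
  by rewrite andbF !mul0r mulr0.
move: yw; rewrite ltr_norml => /andP[yw wy].
have uz : Num.max (- z) (y - w + z) <= z by rewrite ge_max; apply/andP; split; lra.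
(* [b] tells which lower bound is the larger one; y - w + z is an included end, - z an excluded
   one. *)
have E b : (- z < y - w + z) = b -> forall x : R,
  (`|x| < z)%R%:R * (step_density r x y ((y - w) / 2) *
     ((y - w) / 2 <= (x - z) / 2)%R%:R) =
  (x \in Interval (BSide b (Num.max (- z) (y - w + z))) (BSide true z))%:R *
  (2 * flux r (1 * x + w)).
  move=> bE x; rewrite /step_density in_itv/=.
  rewrite (_ : x + y - _ = 1 * x + w); last by field.
  have P (A B C : bool) (F : R) :
      A%:R * (B%:R * F * C%:R) = (A && (B && C))%:R * F.
    by case: A; case: B; case: C; rewrite ?mul0r ?mul1r ?mulr0 ?mulr1.
  rewrite P; congr ((nat_of_bool _)%:R * _).
  rewrite ltr_norml lt_min.
  have -> : ((y - w) / 2 < y) by lra.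
  have -> : ((y - w) / 2 <= (x - z) / 2) = (y - w + z <= x).
    by apply/idP/idP => h; lra.
  move: bE; case: b => bE /=.
    have -> : Num.max (- z) (y - w + z) = y - w + z by apply/max_idPr/ltW.
    have [h|h] := leP (y - w + z) x; last by rewrite !andbF.
    have -> : (y - w) / 2 < x by lra.
    by rewrite andbT/= (lt_le_trans bE h) andbT.
  move/negbT: bE; rewrite -leNgt => bE.
  have -> : Num.max (- z) (y - w + z) = - z by apply/max_idPl.
  have [h|h] := ltP (- z) x => //=.
  have -> : (y - w + z <= x) by exact/(le_trans bE)/ltW.
  have -> : (y - w) / 2 < x by lra.
  by rewrite /= andbT.
under eq_integral do rewrite (E _ erefl).
rewrite integral_flux ?oner_eq0//; congr EFin.
rewrite !mul1r divr1 (_ : Num.max _ _ + w = Num.max (w - z) (y + z))//.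
by rewrite addr_maxl; congr Num.max; ring.
Qed.

(* Splitting according to whether the minimum over the step is attained before
   or after the step begins, both halves become integrals over w = y - 2 min. *)
Lemma intertwining_step r y z (g : mR -> \bar R) : 0 < r -> 0 < z ->
  measurable_fun setT g -> (forall l, 0 <= g l)%E ->
  (\int[mu]_x ((`|x| < z)%R%:R%:E *
     \int[mu]_l ((step_density r x y l)%:E * g (Num.min ((x - z) / 2) l)%R)) =
   \int[mu]_w (((`|y| < w)%R%:R * killed r 0 z w)%:E * g ((y - w) / 2)%R))%E.
Proof.
move=> r0 z0 mg g0.
pose A x := ((`|x| < z)%R%:R%:E * ((killed r ((x - z) / 2) x y)%:E * g ((x - z) / 2)%R))%E.
pose B (x l : R) := (((`|x| < z)%R%:R * (step_density r x y l * (l <= (x - z) / 2)%R%:R))%:E)%E.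
have B0 x l : (0 <= B x l)%E.
  by rewrite lee_fin mulr_ge0// mulr_ge0// step_density_ge0.
have mB : measurable_fun setT (fun p : mR * mR => B p.1 p.2).
  by rewrite /B; meas.
have mA : measurable_fun setT A.
  by rewrite /A; meas.
have A0 x : (0 <= A x)%E.
  by rewrite /A !mule_ge0 ?lee_fin ?killed_ge0.
have mBg : measurable_fun setT (fun p : mR * mR => B p.1 p.2 * g p.2)%E.
  by apply: emeasurable_funM => //; apply: (measurableT_comp mg).
have Bg0 x l : (0 <= B x l * g l)%E by rewrite mule_ge0.
transitivity (\int[mu]_x (A x + \int[mu]_l (B x l * g l)))%E.
  apply: eq_integralR => x.
  rewrite integral_step_density_min//.
  rewrite ge0_muleDr//; first last.
  - by apply: integral_ge0 => l _; rewrite mule_ge0// lee_fin mulr_ge0// step_density_ge0.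
  - by rewrite mule_ge0// lee_fin killed_ge0.
  congr (_ + _)%E; rewrite -ge0_integralZlT//.
  - by apply: eq_integralR => l; rewrite muleA -EFinM.
  - by meas.
  - by move=> l; rewrite mule_ge0// lee_fin mulr_ge0// step_density_ge0.
rewrite ge0_integralDT//; first last.
- by move=> x; apply: integral_ge0.
- exact: measurable_integral.
(* Minimum attained before the step: w = y + z - x turns (x - z) / 2 into (y - w) / 2. *)
rewrite (ge0_integral_reflect (y + z) mA)//.
rewrite (tonelli mBg)//.
have mBl : measurable_fun setT (fun l => \int[mu]_x B x l)%E.
  apply: (@measurable_integral _ _ _ (fun l x => B x l)) => //.
  by rewrite /B; meas.
have Bl0 l : (0 <= \int[mu]_x B x l)%E by exact: integral_ge0.
have -> : (\int[mu]_l \int[mu]_x (B x l * g l) =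
           \int[mu]_l ((\int[mu]_x B x l) * g l))%E.
  apply: eq_integralR => l; rewrite ge0_integralZrT//.
  by rewrite /B; meas.
have mWg : measurable_fun setT (fun l : mR => (\int[mu]_x B x l) * g l)%E.
  exact: emeasurable_funM.
(* Minimum attained during the step: w = y - 2 l, whose Jacobian 1/2 cancels the factor 2 of
   [step_density]. *)
rewrite (@ge0_integral_affine _ (- 2^-1) (y / 2)
  (fun l => (\int[mu]_x B x l) * g l)%E); first last.
- by move=> l; rewrite mule_ge0.
- exact: mWg.
- by rewrite oppr_eq0 invr_eq0 pnatr_eq0.
rewrite normrN gtr0_norm ?invr_gt0//.
have maff : measurable_fun setT (fun w : mR => - 2^-1 * w + y / 2 : mR).
  exact: measurable_affine.
rewrite -ge0_integralZlT//; first last.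
- by move=> l; rewrite mule_ge0.
- exact: (measurableT_comp mWg maff).
rewrite -ge0_integralDT//; first last.
- by move=> l; rewrite !mule_ge0// lee_fin.
- apply: emeasurable_funM => //.
  exact: (measurableT_comp mWg maff).
- by apply: (measurableT_comp mA); meas.
apply: eq_integralR => w.
have -> : - 2^-1 * w + y / 2 = (y - w) / 2 by ring.
rewrite /B integral_step_density_start// /A.
rewrite (_ : (y + z - w - z) / 2 = (y - w) / 2); last by congr (_ / _); ring.
have d0 : 0 <= (`|y| < w)%R%:R *
    (gauss r (Num.max (w - z) (y + z)) - gauss r (z + w)).
  have [|_] := ltP `|y| w; last by rewrite mul0r.
  rewrite ltr_norml => /andP[yw wy]; rewrite mul1r subr_ge0 ler_gauss//.
  rewrite !ger0_norm//; [rewrite ge_max; apply/andP; split|rewrite addr_ge0|]; try lra.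
  by rewrite le_max; have [] := leP z w => ?; apply/orP; [left|right]; lra.
rewrite -intertwining_coefficient// !muleA -!EFinM EFinD ge0_muleDl ?lee_fin//.
  congr (_ + _ * _)%E; congr EFin; field.
- by [].
- by rewrite mulr_ge0// killed_ge0.
Qed.

End intertwining.

(** * Finite-dimensional laws of the bridge *)

Section iterated_chain.
Variable R : realType.
Local Notation mR := (measurableTypeR R).
Local Notation mu := (@lebesgue_measure R).
Implicit Types (L : seq (R * set mR)) (g : R -> mR -> \bar R) (s x : R).

Fixpoint hits L (f : R -> R) : Prop :=
  if L is (s, A) :: L' then A (f s) /\ hits L' f else True.

Fixpoint all_measurable L : Prop :=
  if L is (_, A) :: L' then measurable A /\ all_measurable L' else True.

(** The weights of Brownian motion killed at 0, to which those of the Bessel bridge reduce. [g]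
    receives the last time and position, so that chains can be concatenated. *)
Fixpoint chain L g s x : \bar R :=
  if L is (s', A) :: L' then
    (\int[mu]_y ((killed (s' - s) 0 x y * \1_A y)%:E * chain L' g s' y))%E
  else g s x.

Lemma chain_ge0 L g s x : (forall s x, 0 <= g s x)%E -> (0 <= chain L g s x)%E.
Proof.
move=> g0; elim: L s x => [|[s' A] L IH] s x //=.
apply: integral_ge0 => y _; apply: mule_ge0; last exact: IH.
by rewrite lee_fin mulr_ge0// killed_ge0.
Qed.

Lemma measurable_chain L g s : all_measurable L ->
  (forall s x, 0 <= g s x)%E -> (forall s, measurable_fun setT (g s)) ->
  measurable_fun setT (chain L g s).
Proof.
move=> + g0 mg; elim: L s => [s _|[s' A] L IH s [mA mL]]; first exact: mg.
apply: (@measurable_integral _ _ _ (fun x y =>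
  (killed (s' - s) 0 x y * \1_A y)%:E * chain L g s' y)%E) => [|x y]; last first.
  by rewrite mule_ge0 ?chain_ge0// lee_fin mulr_ge0// killed_ge0.
apply: emeasurable_funM; last exact: (measurableT_comp (IH s' mL)).
apply/measurable_EFinP; apply: measurable_funM; first exact: measurable_killed.
exact: measurable_indicT.
Qed.

Lemma chain_cat L1 L2 g s x :
  chain (L1 ++ L2) g s x = chain L1 (fun s' x' => chain L2 g s' x') s x.
Proof.
elim: L1 s x => [|[s' A] L IH] s x //=.
by apply: eq_integralR => y; rewrite IH.
Qed.

Fixpoint path_density (t b : R) L s x (v : seq R) : R :=
  match L, v with
  | [::], _ => killed (t - s) 0 x b
  | (s', A) :: L', y :: v' =>
      killed (s' - s) 0 x y * \1_A y * path_density t b L' s' y v'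
  | _ :: _, [::] => 0
  end.

Definition bridge_end (t b s x : R) : \bar R := (killed (t - s) 0 x b)%:E.

Lemma bridge_end_ge0 (t b s x : R) : (0 <= bridge_end t b s x)%E.
Proof. by rewrite lee_fin killed_ge0. Qed.

Lemma measurable_bridge_end (t b s : R) : measurable_fun setT (bridge_end t b s).
Proof. by apply/measurable_EFinP; exact: measurable_killed. Qed.

(** [k] collects the factors of the outer variables, so that the induction passes under the iterated
    integral. *)
Lemma tuple_integral_path_density (t b : R) L s x k : 0 <= k ->
  all_measurable L ->
  tuple_integral (fun v : (size L).-tuple mR =>
     (k * path_density t b L s x v)%:E) =
  (k%:E * chain L (bridge_end t b) s x)%E.
Proof.
elim: L s x k => [|[s' A] L IH] s x k k0 /=; first by rewrite EFinM.
move=> [mA mL].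
have c0 y : 0 <= killed (s' - s) 0 x y * \1_A y by rewrite mulr_ge0// killed_ge0.
have ch0 y : (0 <= chain L (bridge_end t b) s' y)%E.
  by apply: chain_ge0; exact: bridge_end_ge0.
rewrite -ge0_integralZlT//; first last.
- by move=> y; rewrite mule_ge0// lee_fin.
- apply: emeasurable_funM.
    apply/measurable_EFinP; apply: measurable_funM; first exact: measurable_killed.
    exact: measurable_indic.
  apply: measurable_chain => //; [exact: bridge_end_ge0|].
  exact: measurable_bridge_end.
apply: eq_integralR => y; rewrite muleA -EFinM -IH//; last by rewrite mulr_ge0.
by congr tuple_integral; apply/funext => v; rewrite mulrA.
Qed.

Fixpoint positive_hits L (v : seq R) : bool :=
  match L, v with
  | (_, A) :: L', y :: v' => [&& 0 < y, y \in A & positive_hits L' v']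
  | _, _ => true
  end.

(* The factors 1 / (x y) of the Bessel densities telescope against the squares
   of the speed measure. *)
Lemma path_densityE (t b : R) L s x v : 0 < x -> 0 < b -> size v = size L ->
  path <%R s (rcons (map fst L) t) ->
  (positive_hits L v)%:R *
    (\prod_(i < (size L).+1)
      bes3_q ((rcons (map fst L) t)`_i - (s :: rcons (map fst L) t)`_i)
        (x :: rcons v b)`_i (rcons v b)`_i *
     \prod_(i < size L) v`_i ^+ 2) =
  path_density t b L s x v / (x * b).
Proof.
elim: L s x v => [|[s' A] L IH] s x [|y v]//= x0 b0.
  move=> _ /andP[st _].
  by rewrite !big_ord_recl !big_ord0 /= !mulr1 mul1r bes3_qE// subr_gt0.
move=> [vL] /andP[ss' L'].
have [y0|y0] := leP y 0; first by rewrite killed_out ?y0 ?orbT// !mul0r.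
have [yA|yA] := boolP (y \in A); last first.
  by rewrite indicE (negbTE yA) mulr0 !mul0r.
have := IH s' y v y0 b0 vL L'.
rewrite [in X in _ -> X]big_ord_recl [X in _ -> _ * (_ * X) = _]big_ord_recl /=.
rewrite indicE yA mulr1 bes3_qE ?subr_gt0// => IH'.
transitivity (killed (s' - s) 0 x y / (x * y) * y ^+ 2 *
  (path_density t b L s' y v / (y * b))).
  by rewrite -IH'; ring.
by field; rewrite !gt_eqF.
Qed.

End iterated_chain.

Lemma clip_subproof (R : realType) (t : {posnum R}) (s : R) :
  Num.max 0 (Num.min s t%:num) \in `[0, t%:num]%classic.
Proof. by rewrite inE /= in_itv /= le_max lexx /= ge_max ge_min lexx orbT andbT. Qed.

(** Projection of the line onto [0, t]: paths extend to all real times, and lists of times can be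
    plain reals. *)
Definition clip (R : realType) (t : {posnum R}) (s : R) : tset t :=
  exist _ (Num.max 0 (Num.min s t%:num)) (clip_subproof t s).

Section bridge_fdd.
Variables (R : realType) (t : {posnum R}).
Local Notation mR := (measurableTypeR R).
Local Notation mu := (@lebesgue_measure R).

Lemma clipE s : 0 <= s <= t%:num -> set_val (clip t s) = s.
Proof.
move=> /andP[s0 st]; change (Num.max 0 (Num.min s t%:num) = s).
rewrite (_ : Num.min s _ = s); last exact/min_idPl.
exact/max_idPr.
Qed.

Lemma clip_val (s : tset t) : clip t (set_val s) = s.
Proof. by apply: val_inj => /=; apply: clipE; have := set_valP s; rewrite /= in_itv. Qed.

Definition on_line (phi : cpath t R) (s : R) : R := phi (clip t s).

Lemma measurable_forall_tnth n (As : 'I_n -> set mR) :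
  (forall i, measurable (As i)) ->
  measurable [set v : n.-tuple mR | forall i, As i (tnth v i)].
Proof.
move=> mA; rewrite (_ : [set _ | _] =
    \bigcap_(i in [set: 'I_n]) ((fun v : n.-tuple mR => tnth v i) @^-1` As i)).
  apply: fin_bigcap_measurable => // i _; rewrite -[X in measurable X]setTI.
  exact: measurable_tnth.
by apply/seteqP; split => v /= h i; [move=> _|]; exact: h.
Qed.

Lemma hits_nth (L : seq (R * set mR)) (f : R -> R) :
  hits L f <-> forall i : 'I_(size L),
    (nth (0, setT) L i).2 (f (nth (0, setT) L i).1).
Proof.
elim: L => [|[s A] L IH] /=; first by split => // _ [].
split => [[As /IH h] [[|i] iL]//|h]; first exact: (h (Ordinal (iL : (i < size L)%N))).
split; first exact: (h ord0).
by apply/IH => i; exact: (h (lift ord0 i)).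
Qed.

Lemma positive_hits_nth (L : seq (R * set mR)) (v : seq R) : size v = size L ->
  positive_hits L v <-> forall i : 'I_(size L),
    (nth (0, setT) L i).2 v`_i /\ 0 < v`_i.
Proof.
elim: L v => [|[s A] L IH] [|y v]//=; first by split => // _ [].
move=> [/IH {}IH]; split => [/and3P[y0 /set_mem yA /IH h] [[|i] iL]//|h].
  exact: (h (Ordinal (iL : (i < size L)%N))).
have [yA y0] := h ord0; apply/and3P; split => //; first exact: mem_set.
by apply/IH => i; exact: (h (lift ord0 i)).
Qed.

(** The factor [killed t 0 a b] clears the denominator q_t(a, b): their quotient a b is exactly what
    telescoping leaves over at the two ends. *)
Lemma bridge_fdd (a b : R) (P : probability (cpath t R) R) L :
  bes3_bridge_law a b P -> 0 < a -> 0 < b ->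
  path <%R 0 (rcons (map fst L) t%:num) -> all_measurable L ->
  (P [set phi | hits L (on_line phi)] * (killed t%:num 0 a b)%:E =
   chain L (bridge_end t%:num b) 0 a)%E.
Proof.
move=> [_ lawP] a0 b0 Lt mL.
have K0 : 0 < killed t%:num 0 a b by rewrite killed_gt0.
pose n := size L.
have sz : size [seq clip t p.1 | p <- L] == n by rewrite size_map.
pose s : n.-tuple (tset t) := Tuple sz.
have Lle p : p \in map fst L -> 0 <= p <= t%:num.
  have : pairwise <%R (0 :: rcons (map fst L) t%:num).
    by rewrite -(sorted_pairwise lt_trans).
  rewrite /= -cats1 all_cat pairwise_cat => /andP[/andP[/allP h1 _] /andP[h2 _]] pL.
  rewrite (ltW (h1 _ pL)) ltW//.
  by move/allP: h2 => /(_ _ pL)/allP; apply; rewrite inE.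
have sE : [seq set_val u | u <- s] = map fst L.
  rewrite /= -map_comp (_ : _ \o _ = (set_val \o clip t) \o fst)// map_comp.
  by apply: map_id_in => p pL; exact: clipE (Lle _ pL).
pose As i := (nth (0, setT) L i).2.
pose A := [set v : n.-tuple mR | forall i : 'I_n, As i (tnth v i)].
have mAs (i : 'I_n) : measurable (As i).
  rewrite /As; move: (nat_of_ord i) => {}i; clear -mL.
  elim: L mL i => [_ i|[u B] L IH [mB mL] [|i]] //.
    by rewrite nth_nil; exact: measurableT.
  exact: IH.
have sL i : (i < n)%N -> nth (time0 t) s i = clip t (nth (0, setT) L i).1.
  by move=> iL; rewrite (nth_map (0, setT)).
have := lawP n s; rewrite sE => /(_ Lt A (measurable_forall_tnth mAs)).
have -> : [set phi : cpath t R | A [tuple (phi (tnth s i) : mR) | i < n]] =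
    [set phi | hits L (on_line phi)].
  apply/seteqP; split => phi /=.
    move=> h; apply/hits_nth => i; have := h i.
    by rewrite tnth_mktuple (tnth_nth (time0 t)) sL.
  move=> /hits_nth h i; have := h i.
  by rewrite tnth_mktuple (tnth_nth (time0 t)) sL.
move=> ->.
have -> : (fun v : n.-tuple mR => (\1_(A `&` [set y | forall i, 0 < tnth y i]) v *
    bes3_bridge_density t a b [tuple set_val (tnth s i) | i < n] v)%:E) =
  (fun v : n.-tuple mR =>
    ((killed t%:num 0 a b)^-1 * path_density t%:num b L 0 a v)%:E).
  apply/funext => v; congr EFin.
  have sv : size v = size L by rewrite size_tuple.
  have := path_densityE a0 b0 sv Lt.
  have -> : positive_hits L v =
      (v \in A `&` [set y | forall i, 0 < tnth y i]).
    apply/idP/idP.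
      move=> /(positive_hits_nth sv) h; apply/mem_set; split => i /=.
        by have [] := h i; rewrite /As (tnth_nth 0).
      by have [] := h i; rewrite (tnth_nth 0).
    move=> /set_mem [h1 h2]; apply/(positive_hits_nth sv) => i.
    by have := h1 i; have := h2 i; rewrite /As !(tnth_nth 0).
  rewrite -indicE /bes3_bridge_density.
  have -> : val [tuple set_val (tnth s i) | i < n] = map fst L.
    rewrite -sE; apply: (@eq_from_nth _ 0); first by rewrite size_tuple size_map size_tuple.
    move=> i; rewrite size_tuple => iL.
    rewrite (nth_map (time0 t)) ?size_tuple// -(tnth_nth 0 _ (Ordinal iL)).
    by rewrite tnth_mktuple (tnth_nth (time0 t)).
  move=> H; rewrite bes3_qE// -[LHS]mulr1.
  under [\prod_(i < n) _]eq_bigr do rewrite (tnth_nth 0).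
  transitivity ((a * b) / killed t%:num 0 a b * (path_density t%:num b L 0 a v / (a * b))).
    by rewrite -H invf_div /=; ring.
  by field; rewrite !gt_eqF.
rewrite tuple_integral_path_density ?invr_ge0 ?ltW//.
by rewrite muleAC -EFinM mulVf ?gt_eqF// mul1e.
Qed.

End bridge_fdd.

(** * The bridge and its minima over time segments *)

Section sandwich.
Variable R : realType.
Local Notation mR := (measurableTypeR R).
Local Notation mu := (@lebesgue_measure R).
Implicit Types (L : seq (R * set mR)) (g : R -> mR -> \bar R) (s x e l h : R).
Implicit Type N : nat.

Lemma killed_semigroup r r' l x (f : mR -> \bar R) : 0 < r -> 0 < r' ->
  measurable_fun setT f -> (forall y, 0 <= f y)%E ->
  (\int[mu]_y ((killed r l x y)%:E * \int[mu]_w ((killed r' l y w)%:E * f w)) =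
   \int[mu]_w ((killed (r + r') l x w)%:E * f w))%E.
Proof.
move=> r0 r'0 mf f0.
transitivity (\int[mu]_y \int[mu]_w
    ((killed r l x y * killed r' l y w)%:E * f w))%E.
  apply: eq_integralR => y; rewrite -ge0_integralZlT//.
  - by apply: eq_integralR => w; rewrite muleA EFinM.
  - by meas.
  - by move=> w; rewrite mule_ge0// lee_fin killed_ge0.
  - by rewrite lee_fin killed_ge0.
rewrite (@tonelli _ (fun y w => (killed r l x y * killed r' l y w)%:E * f w)%E).
- apply: eq_integralR => w; rewrite ge0_integralZrT// ?killed_composition//.
  + by meas.
  + by move=> y; rewrite lee_fin mulr_ge0 ?killed_ge0.
- by meas.
- by move=> y w; rewrite mule_ge0// lee_fin mulr_ge0 ?killed_ge0.
Qed.

Lemma ge0_le_integralT (f g : mR -> \bar R) :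
  measurable_fun setT f -> measurable_fun setT g -> (forall y, 0 <= f y)%E ->
  (forall y, f y <= g y)%E -> (\int[mu]_y f y <= \int[mu]_y g y)%E.
Proof. by move=> mf mg f0 fg; apply: ge0_le_integral. Qed.

Definition mid s s' := (s + s') / 2.

(** Level [l] is imposed at the 2^N dyadic times of (s, s']. Bisection makes the grids nested and
    lets each refinement be absorbed by one use of the semigroup property. *)
Fixpoint grid N s s' (A : set mR) l : seq (R * set mR) :=
  if N is N'.+1 then grid N' s (mid s s') setT l ++ grid N' (mid s s') s' A l
  else [:: (s', A `&` [set y | l < y])].

(** The final time is left out, because the bridge is pinned there and the finite-dimensional laws
    do not cover it. *)
Fixpoint grid_end N s s' l : seq (R * set mR) :=
  if N is N'.+1 then grid N' s (mid s s') setT l ++ grid_end N' (mid s s') s' l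
  else [::].

Lemma measurable_gtr l : measurable [set y : mR | l < y].
Proof.
rewrite (_ : [set _ | _] = `]l, +oo[%classic); first exact: measurable_itv.
by apply/seteqP; split => y /=; rewrite in_itv/= andbT.
Qed.

Lemma all_measurable_cat L1 L2 :
  all_measurable (L1 ++ L2) <-> all_measurable L1 /\ all_measurable L2.
Proof.
elim: L1 => [|[s A] L1 IH] /=; first by split => // -[].
by rewrite IH; tauto.
Qed.

Lemma all_measurable_grid N s s' A l : measurable A ->
  all_measurable (grid N s s' A l).
Proof.
elim: N s s' A => [|N IH] s s' A mA /=.
  by split => //; apply: measurableI => //; exact: measurable_gtr.
by apply/all_measurable_cat; split; exact: IH.
Qed.

Lemma all_measurable_grid_end N s s' l : all_measurable (grid_end N s s' l).
Proof.
elim: N s => [|N IH] s //=; apply/all_measurable_cat; split => //.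
exact: all_measurable_grid.
Qed.

(* The constant of [gauss_le_killed] for the mesh h / 2 ^ N, once per step. *)
Definition mesh_cst e N h : R :=
  (1 - expR (- (2 * e ^+ 2 / (h / 2 ^+ N)))) ^+ (2 ^ N).

Lemma mesh_cst_ge0 e N h : 0 < h -> 0 <= mesh_cst e N h.
Proof.
move=> h0; rewrite exprn_ge0// subr_ge0 -[leRHS]expR0 ler_expR oppr_le0.
have hN : 0 <= h / 2 ^+ N by rewrite divr_ge0 ?exprn_ge0// ltW.
by rewrite divr_ge0// mulr_ge0// sqr_ge0.
Qed.

Lemma mesh_cstS e N h : mesh_cst e N.+1 h = mesh_cst e N (h / 2) ^+ 2.
Proof.
rewrite /mesh_cst -exprM expnSr; congr ((1 - expR (- (_ / _))) ^+ _).
by rewrite exprS; field; rewrite expf_neq0.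
Qed.

Lemma mid_lt s s' : s < s' -> s < mid s s' /\ mid s s' < s'.
Proof. by move=> ss'; rewrite /mid; split; lra. Qed.

Lemma midBl s s' : mid s s' - s = (s' - s) / 2.
Proof. by rewrite /mid; field. Qed.

Lemma midBr s s' : s' - mid s s' = (s' - s) / 2.
Proof. by rewrite /mid; field. Qed.

(** Staying above [l] throughout is more than exceeding it at the grid times; for the kernels this
    is monotonicity in the level on each small step, then composition. *)
Lemma grid_lower N s s' A l x g : s < s' -> 0 <= l -> measurable A ->
  (forall s x, 0 <= g s x)%E -> (forall s, measurable_fun setT (g s)) ->
  (\int[mu]_y ((killed (s' - s) l x y)%:E * ((\1_A y)%:E * g s' y)) <=
   chain (grid N s s' A l) g s x)%E.
Proof.
move=> + l0; elim: N s s' A x g => [|N IH] s s' A x g ss' mA g0 mg /=.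
  have mA' : measurable (A `&` [set y : mR | l < y]).
    by apply: measurableI => //; exact: measurable_gtr.
  have mgs := mg s'.
  apply: ge0_le_integralT; [by meas|by meas| |] => y.
    by rewrite !mule_ge0 ?lee_fin ?killed_ge0.
  rewrite muleA lee_pmul//; rewrite ?lee_fin ?mulr_ge0 ?killed_ge0//.
  rewrite !indicE in_setI; have [ly|yl] := ltP l y; last first.
    by rewrite killed_out ?yl ?orbT// mul0r mulr_ge0 ?killed_ge0.
  have -> : (y \in [set y : mR | l < y]) by rewrite inE.
  by rewrite andbT ler_wpM2r// ler_killed// subr_gt0.
have [sm ms'] := mid_lt ss'; have h0 : 0 < (s' - s) / 2 by rewrite divr_gt0// subr_gt0.
rewrite chain_cat.
set G := fun s' x' => _.
have G0 u y : (0 <= G u y)%E by exact: chain_ge0.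
have mG u : measurable_fun setT (G u).
  by apply: measurable_chain => //; exact: all_measurable_grid.
apply: le_trans (IH _ _ setT x G sm measurableT G0 mG).
have mgs := mg s'.
rewrite midBl.
have hh : s' - s = (s' - s) / 2 + (s' - s) / 2 by field.
move: h0 hh; set h := (s' - s) / 2 => h0 hh; rewrite hh.
rewrite -killed_semigroup//; first last.
- by move=> y; rewrite mule_ge0// lee_fin.
- by meas.
have mI : measurable_fun setT (fun y => \int[mu]_w
    ((killed h l y w)%:E * ((\1_A w)%:E * g s' w)))%E.
  apply: (@measurable_integral _ _ _ (fun y w =>
    (killed h l y w)%:E * ((\1_A w)%:E * g s' w))%E); first by meas.
  by move=> y w; rewrite !mule_ge0 ?lee_fin ?killed_ge0.
have I0 y : (0 <= \int[mu]_w
    ((killed h l y w)%:E * ((\1_A w)%:E * g s' w)))%E.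
  by apply: integral_ge0 => w _; rewrite !mule_ge0 ?lee_fin ?killed_ge0.
have mGm := mG (mid s s').
apply: ge0_le_integralT; [by meas|by meas| |] => y.
  by rewrite mule_ge0// lee_fin killed_ge0.
rewrite indicT mul1e; apply: lee_wpmul2l; first by rewrite lee_fin killed_ge0.
by have := IH _ s' A y g ms' mA g0 mg; rewrite midBr.
Qed.

(** Between two nearby grid times at which it is above [l], the path rarely falls below [l - e]:
    [gauss_le_killed] costs one factor per step. The indicator of l < y on the right-hand side of
    the first half gives the second half its hypothesis l < x. *)
Lemma grid_upper N s s' A l e x g : s < s' -> 0 <= l -> 0 <= e -> l < x ->
  measurable A ->
  (forall s x, 0 <= g s x)%E -> (forall s, measurable_fun setT (g s)) ->
  ((mesh_cst e N (s' - s))%:E * chain (grid N s s' A l) g s x <=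
   \int[mu]_y ((killed (s' - s) (l - e) x y)%:E *
     ((\1_(A `&` [set y | (l < y)%R]) y)%:E * g s' y)))%E.
Proof.
move=> + l0 e0; elim: N s s' A x g => [|N IH] s s' A x g ss' lx mA g0 mg /=.
  have mA' : measurable (A `&` [set y : mR | l < y]).
    by apply: measurableI => //; exact: measurable_gtr.
  have mgs := mg s'; have h0 : 0 < s' - s by rewrite subr_gt0.
  rewrite -ge0_integralZlT; first last.
  - by rewrite lee_fin mesh_cst_ge0.
  - by move=> y; rewrite mule_ge0// lee_fin mulr_ge0// killed_ge0.
  - by meas.
  have c0 := mesh_cst_ge0 e 0 h0.
  apply: ge0_le_integralT; [by meas|by meas| |] => y.
    by rewrite !mule_ge0 ?lee_fin// mulr_ge0// killed_ge0.
  rewrite !muleA lee_pmul//; rewrite -?EFinM ?lee_fin ?mulr_ge0 ?killed_ge0//.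
  rewrite mulrA; have [[_ ly]|nA] := pselect ((A `&` [set y : mR | l < y]) y); last first.
    by rewrite indicE memNset// !mulr0.
  rewrite ler_wpM2r// (le_trans _ (gauss_le_killed h0 e0 lx ly))//.
  rewrite /mesh_cst expr0 divr1 expn0 expr1 ler_wpM2l//.
    by have := c0; rewrite /mesh_cst expr0 divr1 expn0 expr1.
  exact: killed_le_gauss.
have [sm ms'] := mid_lt ss'; have h0 : 0 < (s' - s) / 2 by rewrite divr_gt0// subr_gt0.
have mA' : measurable (A `&` [set y : mR | l < y]).
  by apply: measurableI => //; exact: measurable_gtr.
rewrite chain_cat mesh_cstS expr2 EFinM -muleA.
set G := fun s' x' => _.
have G0 u y : (0 <= G u y)%E by exact: chain_ge0.
have mG u : measurable_fun setT (G u).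
  by apply: measurable_chain => //; exact: all_measurable_grid.
have := IH _ _ setT x G sm lx measurableT G0 mG.
rewrite midBl => /(lee_wpmul2l (_ : 0 <= (mesh_cst e N ((s' - s) / 2))%:E)%E) H.
apply: le_trans (H _) _; first by rewrite lee_fin mesh_cst_ge0.
have mgs := mg s'; have mGm := mG (mid s s').
have mT : measurable (setT `&` [set y : mR | l < y]).
  by apply: measurableI => //; exact: measurable_gtr.
have hh : s' - s = (s' - s) / 2 + (s' - s) / 2 by field.
move: h0 hh; set h := (s' - s) / 2 => h0 hh; rewrite hh.
rewrite -killed_semigroup//; first last.
- by move=> y; rewrite mule_ge0// lee_fin.
- by meas.
have mI : measurable_fun setT (fun y => \int[mu]_w
    ((killed h (l - e) y w)%:E *
     ((\1_(A `&` [set y | l < y]) w)%:E * g s' w)))%E.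
  apply: (@measurable_integral _ _ _ (fun y w =>
    (killed h (l - e) y w)%:E *
     ((\1_(A `&` [set y | l < y]) w)%:E * g s' w))%E); first by meas.
  by move=> y w; rewrite !mule_ge0 ?lee_fin ?killed_ge0.
have I0 y : (0 <= \int[mu]_w
    ((killed h (l - e) y w)%:E *
     ((\1_(A `&` [set y | l < y]) w)%:E * g s' w)))%E.
  by apply: integral_ge0 => w _; rewrite !mule_ge0 ?lee_fin ?killed_ge0.
rewrite -ge0_integralZlT; first last.
- by rewrite lee_fin mesh_cst_ge0.
- by move=> y; rewrite !mule_ge0 ?lee_fin ?killed_ge0.
- by meas.
have c0 := mesh_cst_ge0 e N h0.
apply: ge0_le_integralT; [by meas|by meas| |] => y.
  by rewrite !mule_ge0 ?lee_fin ?killed_ge0.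
rewrite setTI muleCA; apply: lee_wpmul2l; first by rewrite lee_fin killed_ge0.
have [ly|yl] := ltP l y; last first.
  rewrite indicE memNset; last by move=> /=; apply/negP; rewrite -leNgt.
  by rewrite mul0e mule0.
rewrite indicE mem_set// mul1e.
by have := IH _ s' A y g ms' ly mA g0 mg; rewrite midBr.
Qed.

Lemma grid_end_lower N s s' l x b : s < s' -> 0 <= l ->
  ((killed (s' - s) l x b)%:E <=
   chain (grid_end N s s' l) (bridge_end s' b) s x)%E.
Proof.
move=> + l0; elim: N s x => [|N IH] s x ss' /=.
  by rewrite lee_fin ler_killed// subr_gt0.
have [sm ms'] := mid_lt ss'; have h0 : 0 < (s' - s) / 2 by rewrite divr_gt0// subr_gt0.
rewrite chain_cat.
set G := fun s' x' => _.
have G0 u y : (0 <= G u y)%E by apply: chain_ge0; exact: bridge_end_ge0.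
have mG u : measurable_fun setT (G u).
  apply: measurable_chain => //; first exact: all_measurable_grid_end.
    exact: bridge_end_ge0.
  exact: measurable_bridge_end.
apply: le_trans (grid_lower N x sm l0 measurableT G0 mG).
rewrite midBl.
have hh : s' - s = (s' - s) / 2 + (s' - s) / 2 by field.
move: h0 hh; set h := (s' - s) / 2 => h0 hh; rewrite hh.
rewrite -killed_composition//.
have mGm := mG (mid s s').
apply: ge0_le_integralT; [by meas|by meas| |] => y.
  by rewrite lee_fin mulr_ge0// killed_ge0.
rewrite indicT mul1e EFinM; apply: lee_wpmul2l; first by rewrite lee_fin killed_ge0.
by have := IH _ y ms'; rewrite midBr.
Qed.

Lemma grid_end_upper N s s' l e x b : s < s' -> 0 <= l -> 0 <= e ->
  l < x -> l < b ->
  ((mesh_cst e N (s' - s))%:E *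
    chain (grid_end N s s' l) (bridge_end s' b) s x <=
   (killed (s' - s) (l - e) x b)%:E)%E.
Proof.
move=> + l0 e0 + lb; elim: N s x => [|N IH] s x ss' lx /=.
  have h0 : 0 < s' - s by rewrite subr_gt0.
  rewrite -EFinM lee_fin (le_trans _ (gauss_le_killed h0 e0 lx lb))//.
  rewrite /mesh_cst expr0 divr1 expn0 expr1 ler_wpM2l ?killed_le_gauss//.
  by have := mesh_cst_ge0 e 0 h0; rewrite /mesh_cst expr0 divr1 expn0 expr1.
have [sm ms'] := mid_lt ss'; have h0 : 0 < (s' - s) / 2 by rewrite divr_gt0// subr_gt0.
rewrite chain_cat mesh_cstS expr2 EFinM -muleA.
set G := fun s' x' => _.
have G0 u y : (0 <= G u y)%E by apply: chain_ge0; exact: bridge_end_ge0.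
have mG u : measurable_fun setT (G u).
  apply: measurable_chain => //; first exact: all_measurable_grid_end.
    exact: bridge_end_ge0.
  exact: measurable_bridge_end.
have := grid_upper N sm l0 e0 lx measurableT G0 mG.
rewrite midBl => /(lee_wpmul2l (_ : 0 <= (mesh_cst e N ((s' - s) / 2))%:E)%E) H.
apply: le_trans (H _) _; first by rewrite lee_fin mesh_cst_ge0.
have mGm := mG (mid s s').
have mT : measurable (setT `&` [set y : mR | l < y]).
  by apply: measurableI => //; exact: measurable_gtr.
have hh : s' - s = (s' - s) / 2 + (s' - s) / 2 by field.
move: h0 hh; set h := (s' - s) / 2 => h0 hh; rewrite hh.
rewrite -killed_composition// -ge0_integralZlT; first last.
- by rewrite lee_fin mesh_cst_ge0.
- by move=> y; rewrite !mule_ge0 ?lee_fin ?killed_ge0.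
- by meas.
have c0 := mesh_cst_ge0 e N h0.
apply: ge0_le_integralT; [by meas|by meas| |] => y.
  by rewrite !mule_ge0 ?lee_fin ?killed_ge0.
rewrite setTI muleCA EFinM; apply: lee_wpmul2l; first by rewrite lee_fin killed_ge0.
have [ly|yl] := ltP l y; last first.
  rewrite indicE memNset; last by move=> /=; apply/negP; rewrite -leNgt.
  by rewrite mul0e mule0 lee_fin killed_ge0.
rewrite indicE mem_set// mul1e.
by have := IH _ y ms' ly; rewrite midBr.
Qed.

End sandwich.

Section mesh_limit.
Variable R : realType.
Implicit Types (e h : R) (N : nat).

Lemma bernoulli_inequality (u : R) n : 0 <= u <= 1 -> 1 - n%:R * u <= (1 - u) ^+ n.
Proof.
move=> /andP[u0 u1]; elim: n => [|n IH]; first by rewrite mul0r subr0 expr0.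
rewrite exprS.
have [h|h] := leP (1 - n%:R * u) 0.
  apply: (@le_trans _ _ 0); last by rewrite mulr_ge0 ?exprn_ge0 ?subr_ge0.
  by rewrite -natr1 mulrDl mul1r; lra.
apply: (@le_trans _ _ ((1 - u) * (1 - n%:R * u))).
  have : 0 <= n%:R * u * u by rewrite !mulr_ge0.
  by rewrite -natr1; nra.
by apply: ler_wpM2l => //; rewrite subr_ge0.
Qed.

Lemma expRN_le_sqr (v : R) : 0 < v -> expR (- v) <= 4 / v ^+ 2.
Proof.
move=> v0; rewrite expRN -[4 / _]invrK invf_div lef_pV2 ?posrE ?expR_gt0 ?divr_gt0 ?exprn_gt0//.
have -> : v = v / 2 + v / 2 by field.
rewrite expRD -expr2.
have h : 0 <= v / 2 by rewrite divr_ge0// ltW.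
have := expR_ge1Dx (v / 2).
have -> : (v / 2 + v / 2) ^+ 2 / 4 = (v / 2) ^+ 2 by field.
by move=> H; rewrite lerXn2r ?nnegrE ?expR_ge0// (le_trans _ H)// lerDr.
Qed.

Lemma mesh_cst_le1 e N h : 0 < h -> mesh_cst e N h <= 1.
Proof.
move=> h0; rewrite exprn_ile1// ?lerBlDr ?lerDl ?expR_ge0// subr_ge0.
rewrite -[leRHS]expR0 ler_expR oppr_le0.
have hN : 0 <= h / 2 ^+ N by rewrite divr_ge0 ?exprn_ge0// ltW.
by rewrite divr_ge0// mulr_ge0// sqr_ge0.
Qed.

(** By Bernoulli the loss is at most 2^N exp(- k 2^N) with k = 2 e^2 / h; the quadratic bound on the
    exponential makes it O(2^-N). *)
Lemma cvg_mesh_cst e h : 0 < e -> 0 < h -> mesh_cst e N h @[N --> \oo] --> (1 : R).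
Proof.
move=> e0 h0; pose k := 2 * e ^+ 2 / h.
have k0 : 0 < k by rewrite divr_gt0// mulr_gt0// exprn_gt0.
apply: (@squeeze_cvgr _ _ _ _ (fun N => 1 - geometric (4 / k ^+ 2) (2^-1) N) (cst 1)).
- apply: nearW => N; rewrite mesh_cst_le1// andbT.
  have vE : 2 * e ^+ 2 / (h / 2 ^+ N) = k * 2 ^+ N.
    by rewrite /k; field; rewrite ?expf_neq0 ?gt_eqF.
  rewrite /mesh_cst vE; apply: le_trans (bernoulli_inequality _ _); last first.
    rewrite expR_ge0 -[leRHS]expR0 ler_expR oppr_le0.
    by rewrite mulr_ge0 ?exprn_ge0// ltW.
  rewrite lerD2l lerN2 /geometric /= natrX.
  have v0 : 0 < k * 2 ^+ N by rewrite mulr_gt0// exprn_gt0.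
  apply: (le_trans (ler_wpM2l _ (expRN_le_sqr v0))); first by rewrite exprn_ge0.
  rewrite le_eqVlt; apply/orP; left; apply/eqP.
  by rewrite exprVn; field; rewrite ?expf_neq0 ?gt_eqF.
- rewrite -[X in _ --> X]subr0; apply: cvgB; first exact: cvg_cst.
  by apply: cvg_geometric; rewrite ger0_norm ?invr_ge0// invf_lt1// ltr1n.
- exact: cvg_cst.
Qed.

End mesh_limit.

Section segments.
Variable R : realType.
Local Notation mR := (measurableTypeR R).
Local Notation mu := (@lebesgue_measure R).
Variables (T b le : R).
Implicit Types (SL : seq (R * set mR * R)) (s x d e : R) (N : nat).

(** A lower bound on the running minimum at some time binds the path at all earlier times, so the
    level on a segment is the maximum over it and all later ones. *)
Fixpoint required SL : R :=
  if SL is (_, _, l) :: SL' then Num.max l (required SL') else le.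

(** [d] moves all levels at once: it is positive for the lower bound of the squeeze, negative for
    the upper bound, and 0 in the limit. *)
Fixpoint killed_chain d SL s x : \bar R :=
  if SL is (s', A, _) :: SL' then
    (\int[mu]_y ((killed (s' - s) (required SL + d) x y)%:E *
      ((\1_A y)%:E * killed_chain d SL' s' y)))%E
  else (killed (T - s) (le + d) x b)%:E.

Fixpoint segment_grid N d s SL : seq (R * set mR) :=
  if SL is (s', A, _) :: SL' then
    grid N s s' A (required SL + d) ++ segment_grid N d s' SL'
  else grid_end N s T (le + d).

Fixpoint measurable_segments SL : Prop :=
  if SL is (_, A, _) :: SL' then measurable A /\ measurable_segments SL' else True.

Definition times SL : seq R := [seq p.1.1 | p <- SL].

Fixpoint segment_cst e N s SL : R :=
  if SL is (s', _, _) :: SL' then mesh_cst e N (s' - s) * segment_cst e N s' SL'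
  else mesh_cst e N (T - s).

Lemma required_ge SL : le <= required SL.
Proof. by elim: SL => [|[[s A] l] SL IH] //=; rewrite le_max IH orbT. Qed.

Lemma killed_chain_ge0 d SL s x : (0 <= killed_chain d SL s x)%E.
Proof.
elim: SL s x => [|[[s' A] l] SL IH] s x /=; first by rewrite lee_fin killed_ge0.
by apply: integral_ge0 => y _; rewrite !mule_ge0 ?lee_fin ?killed_ge0.
Qed.

Lemma measurable_killed_chain d SL s : measurable_segments SL ->
  measurable_fun setT (killed_chain d SL s).
Proof.
elim: SL s => [|[[s' A] l] SL IH] s /=.
  by move=> _; apply/measurable_EFinP; exact: measurable_killed.
move=> [mA mS]; have H := IH s' mS.
apply: (@measurable_integral _ _ _ (fun x y =>
    (killed (s' - s) (Num.max l (required SL) + d) x y)%:E *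
      ((\1_A y)%:E * killed_chain d SL s' y))%E); first by meas.
by move=> x y; rewrite !mule_ge0 ?lee_fin ?killed_ge0 ?killed_chain_ge0.
Qed.

Lemma all_measurable_segment_grid N d s SL : measurable_segments SL ->
  all_measurable (segment_grid N d s SL).
Proof.
elim: SL s => [|[[s' A] l] SL IH] s /=; first by move=> _; exact: all_measurable_grid_end.
move=> [mA mS]; apply/all_measurable_cat; split; last exact: IH.
exact: all_measurable_grid.
Qed.

Hypothesis le0 : 0 <= le.

Lemma killed_chain_lower N d SL s x : 0 <= d -> measurable_segments SL ->
  path <%R s (rcons (times SL) T) ->
  (killed_chain d SL s x <=
   chain (segment_grid N d s SL) (bridge_end T b) s x)%E.
Proof.
move=> d0; elim: SL s x => [|[[s' A] l] SL IH] s x.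
  by move=> _ /= /andP[sT _]; apply: grid_end_lower => //; rewrite addr_ge0.
move=> [mA mS] /andP[ss' L'].
have r0 : 0 <= required ((s', A, l) :: SL) + d.
  by rewrite addr_ge0// (le_trans le0)// required_ge.
rewrite [segment_grid _ _ _ _]/= -/(required (_ :: _)) chain_cat.
set G := fun s' x' => _.
have G0 u y : (0 <= G u y)%E by apply: chain_ge0; exact: bridge_end_ge0.
have mG u : measurable_fun setT (G u).
  apply: measurable_chain => //; first exact: all_measurable_segment_grid.
    exact: bridge_end_ge0.
  exact: measurable_bridge_end.
apply: le_trans (grid_lower N x ss' r0 mA G0 mG).
rewrite [killed_chain _ _ _ _]/= -/(required (_ :: _)).
have mGm := mG s'; have mk := measurable_killed_chain d s' mS.
apply: ge0_le_integralT; [by meas|by meas| |] => y.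
  by rewrite !mule_ge0 ?lee_fin ?killed_ge0 ?killed_chain_ge0.
do 2 (apply: lee_wpmul2l; first by rewrite lee_fin ?killed_ge0).
exact: IH.
Qed.

Lemma segment_cst_ge0 e N SL s : path <%R s (rcons (times SL) T) ->
  0 <= segment_cst e N s SL.
Proof.
elim: SL s => [|[[s' A] l] SL IH] s /=.
  by move=> /andP[sT _]; rewrite mesh_cst_ge0// subr_gt0.
by move=> /andP[ss' L']; rewrite mulr_ge0 ?IH// mesh_cst_ge0// subr_gt0.
Qed.

Lemma killed_chain_upper N e SL s x : 0 <= e -> measurable_segments SL ->
  path <%R s (rcons (times SL) T) -> required SL < x -> le < b ->
  ((segment_cst e N s SL)%:E *
    chain (segment_grid N 0 s SL) (bridge_end T b) s x <=
   killed_chain (- e) SL s x)%E.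
Proof.
move=> e0 + + + lb; elim: SL s x => [|[[s' A] l] SL IH] s x.
  move=> _ /= /andP[sT _] lx; rewrite addr0.
  exact: grid_end_upper.
move=> [mA mS] /andP[ss' L'] lx.
have r0 : 0 <= required ((s', A, l) :: SL).
  by rewrite (le_trans le0)// required_ge.
rewrite [segment_grid _ _ _ _]/= -/(required ((s', A, l) :: SL)) addr0 chain_cat.
set G := fun s' x' => _.
have G0 u y : (0 <= G u y)%E by apply: chain_ge0; exact: bridge_end_ge0.
have mG u : measurable_fun setT (G u).
  apply: measurable_chain => //; first exact: all_measurable_segment_grid.
    exact: bridge_end_ge0.
  exact: measurable_bridge_end.
have := grid_upper N ss' r0 e0 lx mA G0 mG.
have c0 := segment_cst_ge0 e N L'.
rewrite [segment_cst _ _ _ _]/= mulrC EFinM -muleA.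
move=> /(lee_wpmul2l (_ : 0 <= (segment_cst e N s' SL)%:E)%E) H.
apply: le_trans (H _) _; first by rewrite lee_fin.
rewrite [killed_chain _ _ _ _]/= -/(required ((s', A, l) :: SL)).
have mGm := mG s'; have mk := measurable_killed_chain (- e) s' mS.
have mT : measurable (A `&` [set y : mR | required ((s', A, l) :: SL) < y]).
  by apply: measurableI => //; exact: measurable_gtr.
rewrite -ge0_integralZlT; first last.
- by rewrite lee_fin.
- by move=> y; rewrite !mule_ge0 ?lee_fin ?killed_ge0.
- by meas.
apply: ge0_le_integralT; [by meas|by meas| |] => y.
  by rewrite !mule_ge0 ?lee_fin ?killed_ge0.
rewrite muleCA; apply: lee_wpmul2l; first by rewrite lee_fin killed_ge0.
have [[Ay ly]|nA] := pselect ((A `&` [set y : mR | required ((s', A, l) :: SL) < y]) y); last first.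
  by rewrite indicE memNset// mul0e mule0 mule_ge0 ?killed_chain_ge0 ?lee_fin.
rewrite !indicE !mem_set// !mul1e.
by apply: IH => //; move: ly; rewrite /= gt_max => /andP[].
Qed.

Lemma cvg_segment_cst e SL s : 0 < e -> path <%R s (rcons (times SL) T) ->
  segment_cst e N s SL @[N --> \oo] --> (1 : R).
Proof.
move=> e0; elim: SL s => [|[[s' A] l] SL IH] s /=.
  by move=> /andP[sT _]; apply: cvg_mesh_cst => //; rewrite subr_gt0.
move=> /andP[ss' L']; rewrite -[X in _ --> X]mulr1.
by apply: cvgM; [apply: cvg_mesh_cst => //; rewrite subr_gt0|exact: IH].
Qed.

End segments.

Section killed_chain_continuity.
Variable R : realType.
Local Notation mR := (measurableTypeR R).
Local Notation mu := (@lebesgue_measure R).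
Variables (T b le : R).
Implicit Types (SL : seq (R * set mR * R)) (s x d e r l : R).

Lemma integral_gauss r x : 0 < r -> (\int[mu]_y (gauss r (x - y))%:E = 1)%E.
Proof.
move=> r0; have s0 : Num.sqrt r != 0 by rewrite gt_eqF// sqrtr_gt0.
rewrite -(@integral_normal_pdf _ x (Num.sqrt r)); apply: eq_integralR => y; congr EFin.
rewrite normal_pdfE// /normal_peak /normal_fun /gauss sqr_sqrtr ?ltW//.
congr (_^-1 * expR _).
  by congr Num.sqrt; ring.
by rewrite -(sqrrN (x - y)) opprB; field; rewrite gt_eqF.
Qed.

(** The bound is uniform in [d], as dominated convergence for d -> 0 requires: the last kernel is
    below its Gaussian peak, and all the others are below Gaussians of mass 1. *)
Lemma killed_chain_bounded SL s : path <%R s (rcons (times SL) T) ->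
  measurable_segments SL ->
  exists2 C : R, 0 <= C & forall d x, (killed_chain T b le d SL s x <= C%:E)%E.
Proof.
elim: SL s => [|[[s' A] l] SL IH] s /=.
  move=> /andP[sT _] _; exists (Num.sqrt (2 * pi * (T - s)))^-1.
    by rewrite invr_ge0 sqrtr_ge0.
  by move=> d x; rewrite lee_fin killed_le// subr_gt0.
move=> /andP[ss' L'] [mA mS]; have [C C0 hC] := IH _ L' mS; exists C => // d x.
have h0 : 0 < s' - s by rewrite subr_gt0.
have mk := measurable_killed_chain T b le d s' mS.
have -> : (C%:E = \int[mu]_y ((gauss (s' - s) (x - y))%:E * C%:E))%E.
  rewrite ge0_integralZrT// ?integral_gauss ?mul1e//; first by meas.
  by move=> y; rewrite lee_fin gauss_ge0.
apply: ge0_le_integralT; [by meas|by meas| |] => y.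
  by rewrite !mule_ge0 ?lee_fin ?killed_ge0 ?killed_chain_ge0.
apply: lee_pmul; rewrite ?lee_fin ?killed_ge0 ?killed_le_gauss//.
  by rewrite mule_ge0 ?lee_fin ?killed_chain_ge0.
by rewrite -[leRHS]mul1e; apply: lee_pmul; rewrite ?lee_fin ?killed_chain_ge0.
Qed.

Lemma cvg_killed r l x y (d_ : R^nat) : 0 < r -> d_ @ \oo --> (0 : R) ->
  killed r (l + d_ n) x y @[n --> \oo] --> killed r l x y.
Proof.
move=> r0 d0; apply: cvgB; first exact: cvg_cst.
apply: (cvg_comp (fun n => `|x - y| + 2 * Num.max 0 (Num.min x y - (l + d_ n)))
  (gauss r)); last exact: continuous_gauss.
apply: cvgD; first exact: cvg_cst.
have E (m : R) : 2 * Num.max 0 m = m + `|m|.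
  by case: (leP 0 m) => m0; [rewrite ger0_norm|rewrite ltr0_norm]; rewrite //; ring.
rewrite E; under eq_fun do rewrite E.
have h : Num.min x y - (l + d_ n) @[n --> \oo] --> Num.min x y - l.
  apply: cvgB; first exact: cvg_cst.
  by rewrite -[X in _ --> X]addr0; apply: cvgD => //; exact: cvg_cst.
by apply: cvgD => //; exact: cvg_norm.
Qed.

Lemma cvg_killed_chain SL s x (d_ : R^nat) : measurable_segments SL ->
  path <%R s (rcons (times SL) T) -> d_ @ \oo --> (0 : R) ->
  killed_chain T b le (d_ n) SL s x @[n --> \oo] --> killed_chain T b le 0 SL s x.
Proof.
move=> + + d0; elim: SL s x => [|[[s' A] l] SL IH] s x /=.
  move=> _ /andP[sT _]; apply/fine_cvgP; split; first exact: nearW.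
  by rewrite addr0; apply: cvg_killed; rewrite ?subr_gt0.
move=> [mA mS] /andP[ss' L']; have h0 : 0 < s' - s by rewrite subr_gt0.
have [C C0 hC] := killed_chain_bounded L' mS.
pose F d y : \bar R := ((killed (s' - s) (Num.max l (required le SL) + d) x y)%:E *
      ((\1_A y)%:E * killed_chain T b le d SL s' y))%E.
pose g y : \bar R := ((gauss (s' - s) (x - y))%:E * C%:E)%E.
have mF d : measurable_fun setT (F d).
  by have mk := measurable_killed_chain T b le d s' mS; rewrite /F; meas.
have F0 d y : (0 <= F d y)%E.
  by rewrite /F !mule_ge0 ?lee_fin ?killed_ge0 ?killed_chain_ge0.
have mg : measurable_fun setT g by rewrite /g; meas.
have g0 y : (0 <= g y)%E by rewrite mule_ge0 ?lee_fin ?gauss_ge0.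
have Fg d y : (F d y <= g y)%E.
  apply: lee_pmul; rewrite ?lee_fin ?killed_ge0 ?killed_le_gauss//.
    by rewrite mule_ge0 ?lee_fin ?killed_chain_ge0.
  by rewrite -[leRHS]mul1e; apply: lee_pmul; rewrite ?lee_fin ?killed_chain_ge0.
have [] := @dominated_convergence _ _ R mu setT measurableT (fun n => F (d_ n)) (F 0) g.
- by move=> n; exact: mF.
- exact: mF.
- apply: aeW => y _; rewrite /F addr0.
  have kf : killed_chain T b le 0 SL s' y \is a fin_num.
    by rewrite ge0_fin_numE ?killed_chain_ge0// (le_lt_trans (hC _ _)) ?ltry.
  apply: cvgeM; first by rewrite mule_def_fin// fin_numM.
    apply/fine_cvgP; split; first exact: nearW.
    exact: cvg_killed.
  by apply: cvgeZl => //; exact: IH.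
- apply/integrableP; split => //.
  under eq_integral do rewrite gee0_abs//.
  rewrite /g ge0_integralZrT// ?integral_gauss ?mul1e ?ltry//; first by meas.
  by move=> y; rewrite lee_fin gauss_ge0.
- by apply: aeW => y n _; rewrite gee0_abs.
- by move=> _ _; rewrite /F addr0.
Qed.

End killed_chain_continuity.

(** * The Borel sets of the path space *)

Section path_topology.
Variables (R : realType) (t : {posnum R}).
Implicit Types (phi psi : cpath t R).

Lemma cpath_nbhsP (V : puniformType) (phi : cpath t V) (U : set (cpath t V)) :
  nbhs phi U <-> exists2 E, entourage E &
    forall psi : cpath t V, (forall s, E (phi s, psi s)) -> U psi.
Proof.
split.
  case=> _ [[B oB <-] Bphi BU].
  have /uniform_nbhs[E [entE EB]] : nbhs (cpath_fun phi) B.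
    exact: open_nbhs_nbhs.
  by exists E => // psi h; apply/BU/EB => y _; exact: h.
case=> E entE EU.
have H : nbhs (cpath_fun phi)
    [set h : {uniform tset t -> V} | forall y, setT y -> E (phi y, h y)].
  by apply/uniform_nbhs; exists E; split.
have {}H : nbhs phi (@cpath_fun R t V @^-1`
    [set h : {uniform tset t -> V} | forall y, setT y -> E (phi y, h y)]).
  exact: (@initial_continuous _ _ (@cpath_fun R t V) phi _ H).
by apply: (filterS _ H) => psi h; apply: EU => s; exact: h.
Qed.

Lemma cpath_openP (U : set (cpath t R)) : open U <->
  forall phi, U phi -> exists2 e : R, 0 < e &
    forall psi, (forall s, `|phi s - psi s| < e) -> U psi.
Proof.
rewrite openE; split => h phi Uphi.
  have /cpath_nbhsP[E entE EU] := h _ Uphi.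
  have := entE; rewrite -entourage_ballE => -[e e0 eE].
  exists e => // psi hpsi; apply: EU => s; apply: (eE (phi s, psi s)) => /=.
  exact: hpsi.
have [e e0 eU] := h _ Uphi.
apply/cpath_nbhsP; exists [set xy : R * R | ball xy.1 e xy.2].
  exact: entourage_ball (PosNum e0).
by move=> psi hpsi; apply: eU => s; exact: hpsi.
Qed.

(** Preimages of open half-lines are open for the uniform distance; this serves both coordinates and
    running minima. *)
Lemma measurable_lipschitz (F : cpath t R -> R) :
  (forall phi psi (e : R), 0 < e -> (forall s, `|phi s - psi s| <= e) ->
     `|F phi - F psi| <= e) -> measurable_fun setT F.
Proof.
move=> lipF; apply: (measurability (@RGenOInfty.G R) (@RGenOInfty.measurableE R)).
move=> _ [_ [x ->] <-]; rewrite setTI; apply: sub_sigma_algebra.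
apply/cpath_openP => phi /=; rewrite in_itv/= andbT => xF.
exists ((F phi - x) / 2); first by rewrite divr_gt0 ?subr_gt0.
move=> psi h; rewrite in_itv/= andbT.
have /lipF : 0 < (F phi - x) / 2 by rewrite divr_gt0 ?subr_gt0.
move=> /(_ phi psi (fun s => ltW (h s))); rewrite ler_norml => /andP[_]; lra.
Qed.

Lemma measurable_on_line (s : R) : measurable_fun setT (fun phi : cpath t R => on_line phi s).
Proof. by apply: measurable_lipschitz => phi psi e _ h; exact: h. Qed.

Lemma past_min_le phi (s u : tset t) : set_val u <= set_val s ->
  past_min phi s <= phi u.
Proof.
move=> us; have [m hm] := cpath_lbound phi.
by apply: ge_inf; [exists m => _ [v _ <-]|exists u].
Qed.

Lemma past_min_ge phi (s : tset t) c :
  (forall u : tset t, set_val u <= set_val s -> c <= phi u) -> c <= past_min phi s.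
Proof.
by move=> h; apply: lb_le_inf; [exists (phi s), s => /=|move=> _ [u us <-]; exact: h].
Qed.

Lemma future_min_le phi (s u : tset t) : set_val s <= set_val u ->
  future_min phi s <= phi u.
Proof.
move=> us; have [m hm] := cpath_lbound phi.
by apply: ge_inf; [exists m => _ [v _ <-]|exists u].
Qed.

Lemma future_min_ge phi (s : tset t) c :
  (forall u : tset t, set_val s <= set_val u -> c <= phi u) -> c <= future_min phi s.
Proof.
by move=> h; apply: lb_le_inf; [exists (phi s), s => /=|move=> _ [u us <-]; exact: h].
Qed.

Lemma past_min_lipschitz phi psi (s : tset t) e :
  (forall s, `|phi s - psi s| <= e) -> `|past_min phi s - past_min psi s| <= e.
Proof.
move=> h; rewrite ler_distl; apply/andP; split.
  apply: past_min_ge => u us; have := past_min_le psi us; have := h u.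
  by rewrite ler_distl => /andP[]; lra.
rewrite -lerBlDr; apply: past_min_ge => u us; have := past_min_le phi us; have := h u.
by rewrite ler_distl => /andP[]; lra.
Qed.

Lemma future_min_lipschitz phi psi (s : tset t) e :
  (forall s, `|phi s - psi s| <= e) -> `|future_min phi s - future_min psi s| <= e.
Proof.
move=> h; rewrite ler_distl; apply/andP; split.
  apply: future_min_ge => u us; have := future_min_le psi us; have := h u.
  by rewrite ler_distl => /andP[]; lra.
rewrite -lerBlDr; apply: future_min_ge => u us; have := future_min_le phi us; have := h u.
by rewrite ler_distl => /andP[]; lra.
Qed.

Lemma measurable_past_min (s : tset t) :
  measurable_fun setT (fun phi : cpath t R => past_min phi s).
Proof. by apply: measurable_lipschitz => phi psi e _; exact: past_min_lipschitz. Qed.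

Lemma continuous_on_line phi : continuous (on_line phi).
Proof.
move=> s; apply/cvgrPdist_lt => e e0.
have := @cts_fun _ _ phi (clip t s) => /cvgrPdist_lt/(_ e e0).
move=> /nbhs_ballP[d /= d0 hd]; apply/nbhs_ballP; exists d => //= u su.
apply: (hd (clip t u)); apply: le_lt_trans su.
change (`|Num.max 0 (Num.min s t%:num) - Num.max 0 (Num.min u t%:num)| <= `|s - u|).
have T0 : 0 < t%:num by []. move: (t%:num) T0 => T T0.
rewrite ler_norml; have := ler_norm (s - u); have := ler_norm (u - s).
rewrite (distrC u).
have mT : Num.max 0 T = T by apply/max_idPr; exact: ltW.
by case: (leP s T) => sT; case: (leP u T) => uT; rewrite ?mT;
  case: (leP 0 s) => h1; case: (leP 0 u) => h2; move=> h3 h4;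
  apply/andP; split; lra.
Qed.

Lemma on_line_uniformly_continuous phi (e : R) : 0 < e ->
  exists2 d : R, 0 < d & forall r r', 0 <= r <= t%:num -> `|r - r'| < d ->
    `|on_line phi r - on_line phi r'| < e.
Proof.
move=> e0; pose P (d x : R) := forall y, `|x - y| < d -> `|on_line phi x - on_line phi y| < e.
have /compact_near_coveringP/(_ R (0^'+) P) := @segment_compact R 0 t%:num.
have /[swap]/[apply] : forall x, `[0, t%:num]%classic x ->
    \forall x' \near x & d \near 0^'+, P d x'.
  move=> x _; have e2 : 0 < e / 2 by rewrite divr_gt0.
  have := @continuous_on_line phi x => /cvgrPdist_lt/(_ _ e2)/nbhs_ballP[d /= d0 hd].
  have d2 : 0 < d / 2 by rewrite divr_gt0.
  exists (ball x (d / 2), [set d' | d' < d / 2]).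
    split; first exact: nbhsx_ballx.
    exact: nbhs_right_lt.
  move=> [x' d'] /= [xx' d'd] y x'y.
  have h1 : `|on_line phi x - on_line phi x'| < e / 2.
    by apply: hd; rewrite /ball /= (lt_trans xx')//; lra.
  have h2 : `|on_line phi x - on_line phi y| < e / 2.
    apply: hd; rewrite /ball /=; have := ler_distD x' x y.
    by move: xx' x'y; rewrite /ball /=; lra.
  have := ler_distD (on_line phi x) (on_line phi x') (on_line phi y).
  by rewrite (distrC _ (on_line phi x)); lra.
move=> h; have {h} : \forall d \near (0 : R)^'+, 0 < d /\ `[0, t%:num]%classic `<=` P d.
  by near=> d; split; near: d => //; exact: nbhs_right_gt.
move=> /filter_ex[d [d0 h]]; exists d => // r r' rt rr'.
by apply: h => //=; rewrite in_itv.
Unshelve. all: by end_near. Qed.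

End path_topology.

Section cylinder_sets.
Variables (R : realType) (t : {posnum R}).
Local Notation mR := (measurableTypeR R).
Implicit Types (phi psi : cpath t R) (Ts : seq R) (A : R -> set mR).

Definition cylinder Ts A : set (cpath t R) :=
  [set phi | forall s, s \in Ts -> A s (on_line phi s)].

(** Times lie strictly inside (0, t), as in the finite-dimensional laws; by continuity they still
    determine the path. *)
Definition cylinders : set (set (cpath t R)) :=
  [set B | exists Ts A, [/\ {in Ts, forall s, 0 < s < t%:num},
     (forall s, measurable (A s)) & B = cylinder Ts A]].

Lemma cylinders_setI : setI_closed cylinders.
Proof.
move=> _ _ [T1 [A1 [T1t mA1 ->]]] [T2 [A2 [T2t mA2 ->]]].
exists (T1 ++ T2), (fun s => (if s \in T1 then A1 s else setT) `&`
  (if s \in T2 then A2 s else setT)); split.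
- by move=> s; rewrite mem_cat => /orP[/T1t|/T2t].
- by move=> s; apply: measurableI; case: ifP => _ //; exact: measurableT.
- apply/seteqP; split => phi /=.
    by move=> [h1 h2] s _; split; case: ifP => // h; [exact: h1|exact: h2].
  by move=> h; split=> s sT; have := h s; rewrite mem_cat sT ?orbT => /(_ isT)[].
Qed.

Lemma measurable_cylinder Ts A : (forall s, measurable (A s)) ->
  measurable (cylinder Ts A).
Proof.
move=> mA; rewrite (_ : cylinder Ts A =
    \bigcap_(s in [set` Ts]) ((fun phi : cpath t R => on_line phi s : mR) @^-1` A s)).
  apply: fin_bigcap_measurable => // s _; rewrite -[X in measurable X]setTI.
  exact: (@measurable_on_line R t s measurableT (A s) (mA s)).
by apply/seteqP; split => phi h s; exact: h.
Qed.

(* The path is within ratr q of the step function with value d_i on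
   [i / n, (i + 1) / n), tested at rational times. *)
Definition cell (c : nat * seq rat * rat) : set (cpath t R) :=
  [set phi | forall r : rat, 0 < (ratr r : R) < t%:num ->
     `|on_line phi (ratr r) -
       ratr (nth 0 c.1.2 (Num.truncn (c.1.1%:R * ratr r : R)))| <= ratr c.2].

Lemma cell_cylinders c : <<s cylinders>> (cell c).
Proof.
pose G := g_sigma_algebraType cylinders.
pose Z r : set mR := [set y | `|y -
  ratr (nth 0 c.1.2 (Num.truncn (c.1.1%:R * ratr r : R)))| <= ratr c.2].
have mZ r : measurable (Z r).
  rewrite /Z -[X in measurable X]setTI.
  have mf : measurable_fun setT (fun y : mR => `|y -
     ratr (nth 0 c.1.2 (Num.truncn (c.1.1%:R * ratr r : R)))|).
    by meas.
  by have := mf measurableT `]-oo, (ratr c.2)]%classic (measurable_itv _);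
    congr measurable; apply/seteqP; split => y /=; rewrite in_itv.
rewrite (_ : cell c = ~` \bigcup_(r : rat)
  ~` (if 0 < (ratr r : R) < t%:num then cylinder [:: ratr r] (fun _ => Z r) else setT)).
  apply: (@measurableC _ G); apply: (@bigcupT_measurable_rat _ G) => r.
  apply: (@measurableC _ G); case: ifP => rt; last exact: (@measurableT _ G).
  apply: sub_sigma_algebra; exists [:: ratr r], (fun _ => Z r); split => //.
  by move=> s; rewrite inE => /eqP ->.
rewrite setC_bigcup; apply/seteqP; split => phi /=.
  move=> h r _; rewrite setCK; case: ifP => // rt s; rewrite inE => /eqP ->.
  exact: h.
move=> h r rt; have := h r Logic.I; rewrite setCK rt => /(_ (ratr r)).
by apply; rewrite inE.
Qed.

Lemma rat_dense_on_line phi psi (c : R) :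
  (forall r : rat, 0 < (ratr r : R) < t%:num ->
    `|on_line phi (ratr r) - on_line psi (ratr r)| <= c) ->
  forall s, `|phi s - psi s| <= c.
Proof.
move=> h s; rewrite leNgt; apply/negP => hs.
pose f u := `|on_line phi u - on_line psi u|.
have cf : continuous f.
  by move=> u; apply: cvg_norm; apply: cvgB; exact: continuous_on_line.
have fs : c < f (set_val s) by rewrite /f /on_line clip_val.
have : 0 <= set_val s <= t%:num by have := set_valP s; rewrite /= in_itv.
move: fs; move: (set_val s : R) => u fs /andP[s0 st].
have d0 : 0 < f (u) - c by rewrite subr_gt0.
have := cf (u) => /cvgrPdist_lt/(_ _ d0)/nbhs_ballP[d /= dp hd].
have T0 : 0 < t%:num by [].
have lt : Num.max 0 (u - d) < Num.min t%:num (u + d).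
  by rewrite gt_max !lt_min T0/=; apply/and3P; split; rewrite ?andbT; lra.
have [r] := rat_in_itvoo lt.
rewrite in_itv/= gt_max lt_min => /andP[/andP[r0 r1] /andP[r2 r3]].
have ur : ball u d (ratr r : R).
  by rewrite /ball /= ltr_norml; apply/andP; split; lra.
have := hd _ ur; have := h r; rewrite r0 r2 => /(_ isT); rewrite -/(f _) /=.
by rewrite ltr_norml => ? /andP[]; lra.
Qed.

(** Cells are countably many, and an open set is the union of the cells it contains: each path lies
    in a cell of arbitrarily small rational radius q, and two paths in one cell are within 2 q of
    each other. *)
Lemma measurable_cylinders : @measurable _ (cpath t R) = <<s cylinders>>.
Proof.
apply/seteqP; split; last first.
  apply: smallest_sub; first exact: sigma_algebra_measurable.
  by move=> _ [Ts [A [_ mA ->]]]; exact: measurable_cylinder.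
apply: smallest_sub; first exact: smallest_sigma_algebra.
move=> U oU; rewrite (_ : U = \bigcup_c [set phi | cell c `<=` U /\ cell c phi]).
  pose G := g_sigma_algebraType cylinders.
  apply: (@countable_bigcupT_measurable _ G) => // c.
  have [cU|cU] := pselect (cell c `<=` U).
    rewrite (_ : [set _ | _] = cell c); first exact: cell_cylinders.
    by apply/seteqP; split => phi //= -[].
  rewrite (_ : [set _ | _] = set0); first exact: (@measurable0 _ G).
  by apply/seteqP; split => phi //= -[].
apply/seteqP; split => phi; last by move=> [c _ [cU /cU]].
move=> Uphi; have [e e0 eU] := (cpath_openP U).1 oU _ Uphi.
(* e / 8 for the oscillation and e / 8 for the rational values add up to less than q, while 2 q <
   e. *)
have e8 : 0 < e / 8 by rewrite divr_gt0.
have [d d0 hd] := on_line_uniformly_continuous phi e8.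
have [q hq] : exists q : rat, e / 4 < ratr q < e / 2.
  have h : e / 4 < e / 2 by lra.
  by have [q] := rat_in_itvoo h; rewrite in_itv/=; exists q.
pose n := (Num.truncn d^-1).+1.
have n0 : 0 < n%:R :> R by rewrite ltr0n.
have nd : n%:R^-1 < d.
  by rewrite invf_plt ?posrE// /n truncnS_gt.
have /choice[D hD] : forall i : nat, exists p : rat,
    `|on_line phi (i%:R / n%:R) - ratr p| < e / 8.
  move=> i; have h : on_line phi (i%:R / n%:R) - e / 8 < on_line phi (i%:R / n%:R) + e / 8 by lra.
  have [p] := rat_in_itvoo h; rewrite in_itv/= => /andP[h1 h2]; exists p.
  by rewrite ltr_norml; apply/andP; split; lra.
(* For r < t the index, the integer part of n r, is at most that of n t; hence the length. *)
pose c := (n, mkseq D (Num.truncn (n%:R * t%:num)).+1, q).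
have cphi : cell c phi.
  move=> r /andP[r0 rt] /=; pose i := Num.truncn (n%:R * ratr r : R); rewrite -/i.
  have nr0 : 0 <= n%:R * ratr r :> R by rewrite mulr_ge0 ?ltW.
  have := truncn_itv nr0; rewrite -/i => /andP[i1 i2].
  have iN : (i < (Num.truncn (n%:R * t%:num)).+1)%N.
    have nt0 : 0 <= n%:R * t%:num :> R by rewrite mulr_ge0.
    rewrite ltnS (truncn_ge_nat i nt0) (le_trans i1)//.
    by rewrite ler_wpM2l// ltW.
  rewrite nth_mkseq//.
  have h1 : `|on_line phi (ratr r) - on_line phi (i%:R / n%:R)| < e / 8.
    apply: hd; first by rewrite !ltW.
    apply: le_lt_trans nd.
    have -> : ratr r = (n%:R * ratr r) / n%:R :> R by rewrite mulrAC divff ?mul1r ?gt_eqF.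
    rewrite -mulrBl normrM ger0_norm ?subr_ge0// (@ger0_norm _ (n%:R^-1)) ?invr_ge0 ?ler0n//.
    apply: ler_piMl; first by rewrite invr_ge0.
    by move: i2; rewrite -natr1; lra.
  have := ler_distD (on_line phi (i%:R / n%:R)) (on_line phi (ratr r)) (ratr (D i)).
  by move: h1 (hD i) hq => /= ? ? /andP[? ?]; lra.
exists c => //; split => // psi cpsi; apply: eU => s.
have /andP[_ q2] := hq.
apply: le_lt_trans (_ : 2 * ratr q < e); last by lra.
apply: (@rat_dense_on_line phi psi) => r rt.
have := cphi r rt; have := cpsi r rt => /=.
have := ler_distD (ratr (nth 0 (mkseq D (Num.truncn (n%:R * t%:num)).+1)
  (Num.truncn (n%:R * ratr r : R)))) (on_line phi (ratr r)) (on_line psi (ratr r)).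
by rewrite (distrC (ratr _) (on_line psi _)); lra.
Qed.

End cylinder_sets.

(** * From grid conditions to the running minimum *)

Section grid_hits.
Variable R : realType.
Local Notation mR := (measurableTypeR R).
Implicit Types (f : R -> R) (s u l : R) (N : nat).

Lemma hits_cat (L1 L2 : seq (R * set mR)) f :
  hits (L1 ++ L2) f <-> hits L1 f /\ hits L2 f.
Proof.
elim: L1 => [|[s A] L IH] /=; first by split => // -[].
by rewrite IH; tauto.
Qed.

Lemma hits_grid N s s' (A : set mR) l f : s < s' -> A (f s') ->
  (forall u, s <= u <= s' -> l < f u) -> hits (grid N s s' A l) f.
Proof.
elim: N s s' A => [|N IH] s s' A ss' As' h /=.
  by split => //; split => //=; apply: h; rewrite lexx ltW.
have [sm ms'] := mid_lt ss'; apply/hits_cat; split; apply: IH => // u /andP[su us'];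
  by apply: h; rewrite ?su ?us' ?(le_trans su) ?(le_trans us') ?(le_trans _ su) ?ltW.
Qed.

Lemma hits_grid_end N s s' l f : s < s' ->
  (forall u, s <= u <= s' -> l < f u) -> hits (grid_end N s s' l) f.
Proof.
elim: N s => [|N IH] s ss' h //=.
have [sm ms'] := mid_lt ss'; apply/hits_cat; split.
  by apply: hits_grid => // u /andP[su us']; apply: h; rewrite su (le_trans us')// ltW.
by apply: IH => // u /andP[su us']; apply: h; rewrite us' (le_trans _ su)// ltW.
Qed.

Lemma grid_nested N s s' (A : set mR) l f : hits (grid N.+1 s s' A l) f ->
  hits (grid N s s' A l) f.
Proof.
elim: N s s' A => [|N IH] s s' A; first by move=> /hits_cat[].
by move=> /hits_cat[h1 h2]; apply/hits_cat; split; exact: IH.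
Qed.

Lemma grid_end_nested N s s' l f : hits (grid_end N.+1 s s' l) f ->
  hits (grid_end N s s' l) f.
Proof.
elim: N s => [|N IH] s //; move=> /hits_cat[h1 h2]; apply/hits_cat.
by split; [exact: grid_nested|exact: IH].
Qed.

Lemma hits_grid_last N s s' (A : set mR) l f : hits (grid N s s' A l) f -> A (f s').
Proof.
elim: N s => [|N IH] s; first by move=> [[]].
by move=> /hits_cat[_ /IH].
Qed.

Lemma grid_dense N s s' (A : set mR) l f u : s < s' -> s <= u <= s' ->
  hits (grid N s s' A l) f ->
  exists2 v, `|v - u| <= (s' - s) / 2 ^+ N & l < f v.
Proof.
elim: N s s' A => [|N IH] s s' A ss' /andP[su us'].
  move=> [[_ ls'] _]; exists s' => //; rewrite expr0 divr1 ger0_norm ?subr_ge0//.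
  by rewrite lerD2l lerN2.
have [sm ms'] := mid_lt ss'; move=> /hits_cat[h1 h2].
have [um|mu] := leP u (mid s s').
  have [|v vu lv] := IH _ _ _ sm _ h1; first by rewrite su.
  by exists v => //; apply: (le_trans vu); rewrite midBl exprS invfM mulrA.
have [|v vu lv] := IH _ _ _ ms' _ h2; first by rewrite us' ltW.
by exists v => //; apply: (le_trans vu); rewrite midBr exprS invfM mulrA.
Qed.

(** Depth [N.+1] compensates for the missing final time: [grid_end 0] is empty, and near s' only
    grid times to the left are available. *)
Lemma grid_end_dense N s s' l f u : s < s' -> s <= u <= s' ->
  hits (grid_end N.+1 s s' l) f ->
  exists2 v, `|v - u| <= (s' - s) / 2 ^+ N & l < f v.
Proof.
elim: N s => [|N IH] s ss' /andP[su us'];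
  have [sm ms'] := mid_lt ss'; move=> /hits_cat[h1 h2].
  case: h1 => -[_ /= lm] _; exists (mid s s') => //.
  by rewrite expr0 divr1 ler_norml; apply/andP; split; lra.
have [um|mu] := leP u (mid s s').
  have [|v vu lv] := grid_dense (u := u) sm _ h1; first by rewrite su.
  exists v => //; apply: (le_trans vu); rewrite midBl ler_wpM2r//.
  by lra.
have [|v vu lv] := IH _ ms' _ h2; first by rewrite us' ltW.
by exists v => //; apply: (le_trans vu); rewrite midBr exprS invfM mulrA.
Qed.

(** Only the weak inequality survives the limit; this is why levels are raised by some d > 0 before
    the grid is refined. *)
Lemma dense_ge f u l (h : R) : continuous f ->
  (forall N, exists2 v, `|v - u| <= h / 2 ^+ N & l < f v) -> l <= f u.
Proof.
move=> cf H; rewrite leNgt; apply/negP => ful.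
have d0 : 0 < l - f u by rewrite subr_gt0.
have := cf u => /cvgrPdist_lt/(_ _ d0)/nbhs_ballP[d /= dp hd].
have : geometric h (2^-1) N @[N --> \oo] --> (0 : R).
  by apply: cvg_geometric; rewrite ger0_norm ?invr_ge0// invf_lt1// ltr1n.
move=> /cvgrPdist_lt/(_ _ dp)/filter_ex[N].
rewrite /geometric /= sub0r normrN => hN.
have [v vu lv] := H N.
have : ball u d v.
  rewrite /ball /= distrC; apply: le_lt_trans hN; apply: (le_trans vu).
  by rewrite -exprVn; exact: ler_norm.
by move=> /hd /=; rewrite ltr_norml => /andP[]; lra.
Qed.

End grid_hits.

Section segment_law.
Variables (R : realType) (t : {posnum R}) (a b le : R).
Local Notation mR := (measurableTypeR R).
Local Notation T := t%:num.
Variable P : probability (cpath t R) R.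
Hypotheses (a0 : 0 < a) (b0 : 0 < b) (le0 : 0 <= le).
Hypothesis lawP : bes3_bridge_law a b P.
Implicit Types (phi : cpath t R) (SL : seq (R * set mR * R)).

Definition running_min phi (s : R) : R := past_min phi (clip t s).

Fixpoint segment_event SL phi : Prop :=
  if SL is (s, A, l) :: SL' then
    [/\ A (on_line phi s), l < running_min phi s & segment_event SL' phi]
  else le < running_min phi T.

Lemma running_min_le phi s u : 0 <= u -> u <= s -> s <= T ->
  running_min phi s <= on_line phi u.
Proof.
move=> u0 us sT; apply: past_min_le.
by rewrite !clipE ?u0 ?(le_trans u0 us) ?(le_trans us).
Qed.

Lemma running_min_ge phi s c : 0 <= s <= T ->
  (forall u, 0 <= u <= s -> c <= on_line phi u) -> c <= running_min phi s.
Proof.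
move=> sT h; apply: past_min_ge => u; rewrite clipE// => us.
rewrite -(clip_val u); apply: h; rewrite us andbT.
by have := set_valP u; rewrite /= in_itv => /andP[].
Qed.

Lemma running_min_anti phi s s' : 0 <= s -> s <= s' -> s' <= T ->
  running_min phi s' <= running_min phi s.
Proof.
move=> s0 ss' sT; apply: running_min_ge; first by rewrite s0 (le_trans ss').
by move=> u /andP[u0 us]; apply: running_min_le; rewrite // (le_trans us).
Qed.

Lemma path_bounds SL s : path <%R s (rcons (times SL) T) ->
  s <= T /\ {in times SL, forall u, s <= u <= T}.
Proof.
elim: SL s => [|[[s' A] l] SL IH] s /=; first by move=> /andP[/ltW].
move=> /andP[ss' /IH[s'T h]]; split; first by rewrite (le_trans (ltW ss')).
move=> u; rewrite inE => /predU1P[->|/h/andP[s'u ->]].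
  by rewrite ltW.
by rewrite (le_trans (ltW ss')).
Qed.

Lemma segment_event_required SL s phi : 0 <= s -> path <%R s (rcons (times SL) T) ->
  segment_event SL phi -> required le SL < running_min phi s.
Proof.
elim: SL s => [|[[s' A] l] SL IH] s s0 /=.
  by move=> /andP[sT _] h; apply: (lt_le_trans h); apply: running_min_anti => //; exact: ltW.
move=> /andP[ss' L'] [_ h1 h2]; have [s'T _] := path_bounds L'.
have s'0 : 0 <= s' by rewrite (le_trans s0)// ltW.
apply: (@lt_le_trans _ _ (running_min phi s')).
  by rewrite gt_max h1 IH.
by apply: running_min_anti => //; exact: ltW.
Qed.

Lemma segment_event_hits N SL s phi : 0 <= s -> path <%R s (rcons (times SL) T) ->
  segment_event SL phi -> hits (segment_grid T le N 0 s SL) (on_line phi).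
Proof.
elim: SL s => [|[[s' A] l] SL IH] s s0.
  move=> /= /andP[sT _] h; rewrite addr0; apply: hits_grid_end => // u /andP[su uT].
  by apply: (lt_le_trans h); apply: running_min_le => //; exact: le_trans su.
move=> /= /andP[ss' L'] [h0 h1 h2]; have [s'T _] := path_bounds L'.
have s'0 : 0 <= s' by rewrite (le_trans s0)// ltW.
apply/hits_cat; split; last exact: IH.
rewrite addr0; apply: hits_grid => // u /andP[su us'].
apply: (@lt_le_trans _ _ (running_min phi s')).
  by rewrite gt_max h1 (segment_event_required s'0).
by apply: running_min_le => //; exact: le_trans su.
Qed.

(** The induction carries a bound on the path before [s], because running minima at later times look
    back to time 0. *)
Lemma hits_segment_event (d : R) SL s phi : 0 < d -> 0 <= s ->
  path <%R s (rcons (times SL) T) ->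
  (forall u, 0 <= u < s -> required le SL + d <= on_line phi u) ->
  (forall N, hits (segment_grid T le N d s SL) (on_line phi)) ->
  segment_event SL phi.
Proof.
move=> d0; have cf := @continuous_on_line _ _ phi.
elim: SL s => [|[[s' A] l] SL IH] s s0.
  move=> /= /andP[sT _] h H.
  apply: (@lt_le_trans _ _ (le + d)); first by rewrite ltrDl.
  apply: running_min_ge; first by rewrite lexx andbT.
  move=> u /andP[u0 uT]; have [us|su] := ltP u s; first by apply: h; rewrite u0.
  apply: (@dense_ge _ _ _ _ (T - s)) => // N.
  by apply: (grid_end_dense sT _ (H N.+1)); rewrite su.
move=> /= /andP[ss' L'] h H; have [s'T _] := path_bounds L'.
have s'0 : 0 <= s' by rewrite (le_trans s0)// ltW.
have H1 N := ((hits_cat _ _ _).1 (H N)).1.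
have H2 N := ((hits_cat _ _ _).1 (H N)).2.
have K u : 0 <= u <= s' -> Num.max l (required le SL) + d <= on_line phi u.
  move=> /andP[u0 us']; have [us|su] := ltP u s; first by apply: h; rewrite u0.
  apply: (@dense_ge _ _ _ _ (s' - s)) => // N.
  by apply: (grid_dense ss' _ (H1 N)); rewrite su.
split; first exact: hits_grid_last (H1 0%N).
  apply: (@lt_le_trans _ _ (l + d)); first by rewrite ltrDl.
  apply: running_min_ge; first by rewrite s'0.
  by move=> u /K; apply: le_trans; rewrite lerD2r le_max lexx.
apply: (IH s') => // u /andP[u0 us']; apply: le_trans (K u _); last by rewrite u0 ltW.
by rewrite lerD2r le_max lexx orbT.
Qed.

Lemma measurable_segment_event SL : measurable_segments SL ->
  measurable [set phi | segment_event SL phi].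
Proof.
have mM s l : measurable [set phi : cpath t R | l < running_min phi s].
  have := measurable_past_min (clip t s) measurableT (measurable_gtr l).
  by rewrite setTI.
elim: SL => [|[[s A] l] SL IH] /=; first by move=> _; exact: mM.
move=> [mA mS]; rewrite (_ : [set _ | _] =
  ((fun phi : cpath t R => on_line phi s : mR) @^-1` A) `&`
  ([set phi | l < running_min phi s] `&` [set phi | segment_event SL phi])).
  apply: measurableI; last by apply: measurableI => //; exact: IH.
  by have := @measurable_on_line R t s measurableT A mA; rewrite setTI.
by apply/seteqP; split => phi /= [] // ? [].
Qed.

Lemma path_grid N s s' (A : set mR) l : s < s' ->
  path <%R s (map fst (grid N s s' A l)) /\ last s (map fst (grid N s s' A l)) = s'.
Proof.
elim: N s s' A => [|N IH] s s' A ss' /=; first by rewrite ss'.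
have [sm ms'] := mid_lt ss'.
have [p1 l1] := IH _ _ setT sm; have [p2 l2] := IH _ _ A ms'.
by rewrite map_cat cat_path last_cat l1 p1 p2 l2.
Qed.

Lemma path_grid_end N s s' l : s < s' ->
  path <%R s (rcons (map fst (grid_end N s s' l : seq (R * set mR))) s').
Proof.
elim: N s => [|N IH] s ss' /=; first by rewrite ss'.
have [sm ms'] := mid_lt ss'.
have [p1 l1] := path_grid N setT l sm.
by rewrite map_cat rcons_cat cat_path l1 p1 IH.
Qed.

Lemma path_segment_grid N d SL s : path <%R s (rcons (times SL) T) ->
  path <%R s (rcons (map fst (segment_grid T le N d s SL)) T).
Proof.
elim: SL s => [|[[s' A] l] SL IH] s /=.
  by move=> /andP[sT _]; exact: path_grid_end.
move=> /andP[ss' L']; have [p1 l1] := path_grid N A (Num.max l (required le SL) + d) ss'.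
by rewrite map_cat rcons_cat cat_path l1 p1 IH.
Qed.

Lemma segment_grid_nested N d SL s (f : R -> R) :
  hits (segment_grid T le N.+1 d s SL) f -> hits (segment_grid T le N d s SL) f.
Proof.
elim: SL s => [|[[s' A] l] SL IH] s; first exact: grid_end_nested.
move=> /hits_cat[h1 h2]; apply/hits_cat; split; last exact: IH.
exact: grid_nested.
Qed.

Lemma measurable_hits (L : seq (R * set mR)) : all_measurable L ->
  measurable [set phi : cpath t R | hits L (on_line phi)].
Proof.
elim: L => [|[s A] L IH] /=; first by move=> _; exact: measurableT.
move=> [mA mL]; apply: measurableI; last exact: IH.
by have := @measurable_on_line R t s measurableT A mA; rewrite setTI.
Qed.

Local Notation K := (killed T 0 a b).

Lemma segment_grid_prob N d SL : path <%R 0 (rcons (times SL) T) ->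
  measurable_segments SL ->
  (P [set phi | hits (segment_grid T le N d 0 SL) (on_line phi)] * K%:E =
   chain (segment_grid T le N d 0 SL) (bridge_end T b) 0 a)%E.
Proof.
move=> L mS; apply: bridge_fdd => //; first exact: path_segment_grid.
exact: all_measurable_segment_grid.
Qed.

(** The nested grid events decrease to an intersection contained in the segment event, and each of
    them already has at least the weight of the raised chain. *)
Lemma segment_event_lower d SL : 0 < d -> path <%R 0 (rcons (times SL) T) ->
  measurable_segments SL ->
  (killed_chain T b le d SL 0 a <= P [set phi | segment_event SL phi] * K%:E)%E.
Proof.
move=> d0 L mS.
pose F N := [set phi : cpath t R | hits (segment_grid T le N d 0 SL) (on_line phi)].
have mF N : measurable (F N).
  by apply: measurable_hits; exact: all_measurable_segment_grid.
have mFi : measurable (\bigcap_N F N) by exact: bigcapT_measurable.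
have K0 : (0 <= K%:E)%E by rewrite lee_fin killed_ge0.
have le1 N : (killed_chain T b le d SL 0 a <= P (F N) * K%:E)%E.
  rewrite segment_grid_prob//; apply: killed_chain_lower => //; exact: ltW.
have cF : P (F N) @[N --> \oo] --> P (\bigcap_N F N).
  apply: nonincreasing_cvg_mu => //.
    by rewrite (le_lt_trans (probability_le1 _ _)) ?ltry.
  apply/nonincreasing_seqP => N; apply/subsetPset => phi.
  exact: segment_grid_nested.
have : (P (F N) * K%:E)%E @[N --> \oo] --> (P (\bigcap_N F N) * K%:E)%E.
  exact: cvgeZr.
move=> cK.
have le2 : (killed_chain T b le d SL 0 a <= P (\bigcap_N F N) * K%:E)%E.
  rewrite -(cvg_lim _ cK)//; apply: lime_ge; first by apply/cvg_ex; eexists; exact: cK.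
  by apply: nearW => N; exact: le1.
apply: (le_trans le2); apply: lee_wpmul2r => //.
apply: le_measure; rewrite ?inE//; first exact: measurable_segment_event.
move=> phi h; apply: (@hits_segment_event d SL 0) => //.
  by move=> u /andP[u0 u1]; have := le_lt_trans u0 u1; rewrite ltxx.
by move=> N; exact: h.
Qed.

Lemma segment_event_end SL phi : segment_event SL phi -> le < running_min phi T.
Proof. by elim: SL => [|[[s A] l] SL IH] //= [_ _ /IH]. Qed.

(** Settles the cases outside the strict inequalities of [killed_chain_upper]: almost surely the
    path takes the values a and b, so its minimum cannot exceed them. *)
Lemma segment_event_null SL : path <%R 0 (rcons (times SL) T) ->
  measurable_segments SL -> (a <= required le SL) || (b <= le) ->
  P [set phi | segment_event SL phi] = 0%E.
Proof.
move=> L mS abl; have [ae _] := lawP.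
apply/measure_negligible; first exact: measurable_segment_event.
have := ae; apply: negligibleS => phi /= ev [h0 hT _].
have aE : on_line phi 0 = a by rewrite -h0 -[in RHS](clip_val (time0 t)).
have bE : on_line phi T = b by rewrite -hT -[in RHS](clip_val (timeT t)).
case/orP: abl => h.
  have := segment_event_required (lexx 0) L ev.
  apply/negP; rewrite -leNgt (le_trans _ h)// -aE.
  by apply: running_min_le.
have := segment_event_end ev.
apply/negP; rewrite -leNgt (le_trans _ h)// -bE.
by apply: running_min_le.
Qed.

Lemma segment_event_upper e SL : 0 < e -> path <%R 0 (rcons (times SL) T) ->
  measurable_segments SL ->
  (P [set phi | segment_event SL phi] * K%:E <= killed_chain T b le (- e) SL 0 a)%E.
Proof.
move=> e0 L mS.
have [abl|] := boolP ((a <= required le SL) || (b <= le)).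
  by rewrite segment_event_null// mul0e killed_chain_ge0.
rewrite negb_or -!ltNge => /andP[la lb].
set p := (P _ * _)%E.
have p0 : (0 <= p)%E by rewrite mule_ge0 ?lee_fin ?killed_ge0.
have le1 N : ((segment_cst T e N 0 SL)%:E * p <= killed_chain T b le (- e) SL 0 a)%E.
  have H := killed_chain_upper le0 N (ltW e0) mS L la lb.
  apply: (le_trans _ H).
  apply: lee_wpmul2l; first by rewrite lee_fin segment_cst_ge0.
  rewrite -segment_grid_prob//; apply: lee_wpmul2r; first by rewrite lee_fin killed_ge0.
  apply: le_measure; rewrite ?inE//.
  - exact: measurable_segment_event.
  - by apply: measurable_hits; exact: all_measurable_segment_grid.
  - by move=> phi; exact: segment_event_hits.
have pf : p \is a fin_num by rewrite fin_numM// fin_num_measure//; exact: measurable_segment_event.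
have c : ((segment_cst T e N 0 SL)%:E * p)%E @[N --> \oo] --> (1%:E * p)%E.
  apply: cvgeZr => //; apply/fine_cvgP; split; first exact: nearW.
  exact: cvg_segment_cst.
rewrite -(mul1e p) -(cvg_lim _ c)//; apply: lime_le; first by apply/cvg_ex; eexists; exact: c.
by apply: nearW => N; exact: le1.
Qed.

(* P is squeezed between the values of the killed chain at levels raised and
   lowered by 1 / n, and the chain is continuous in the levels. *)
Theorem segment_event_law SL : path <%R 0 (rcons (times SL) T) ->
  measurable_segments SL ->
  (P [set phi | segment_event SL phi] * K%:E = killed_chain T b le 0 SL 0 a)%E.
Proof.
move=> L mS; apply/eqP; rewrite eq_le; apply/andP; split.
  have c : killed_chain T b le (- harmonic n) SL 0 a @[n --> \oo] -->
      killed_chain T b le 0 SL 0 a.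
    apply: (cvg_killed_chain (d_ := fun n => - harmonic n)) => //.
    by rewrite -oppr0; apply: cvgN; exact: cvg_harmonic.
  rewrite -(cvg_lim _ c)//; apply: lime_ge; first by apply/cvg_ex; eexists; exact: c.
  by apply: nearW => n; apply: segment_event_upper => //; exact: harmonic_gt0.
have c : killed_chain T b le (harmonic n) SL 0 a @[n --> \oo] -->
    killed_chain T b le 0 SL 0 a.
  by apply: (cvg_killed_chain (d_ := harmonic)) => //; exact: cvg_harmonic.
rewrite -(cvg_lim _ c)//; apply: lime_le; first by apply/cvg_ex; eexists; exact: c.
by apply: nearW => n; apply: segment_event_lower => //; exact: harmonic_gt0.
Qed.

End segment_law.

(** * Joint law of the path and of its running minimum *)

(** [k] may be infinite: it will be the value of a joint chain, known only to be nonnegative. *)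
Lemma nneseriesZr (R : realType) (u : nat -> \bar R) (k : \bar R) :
  (forall n, 0 <= u n)%E -> (0 <= k)%E ->
  ((\sum_(n <oo) u n) * k = \sum_(n <oo) (u n * k))%E.
Proof.
move=> u0; case: k => [k k0|_|//].
  by rewrite muleC -nneseriesZl//; apply: eq_eseriesr => n _; rewrite muleC.
have [z|] := pselect (forall n, u n = 0%E).
  by rewrite eseries0 ?mul0e ?eseries0// => n _ _; rewrite z// mul0e.
move=> /existsNP[n /eqP un0].
have un : (0 < u n)%E by rewrite lt0e un0 u0.
have le (v : nat -> \bar R) : (forall n, 0 <= v n)%E -> (v n <= \sum_(n <oo) v n)%E.
  move=> v0; apply: le_trans (@nneseries_lim_ge _ v xpredT 0 n.+1 _) => //.
  by rewrite big_mkord big_ord_recr /= leeDr// sume_ge0.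
have -> : (\sum_(n <oo) (u n * +oo) = +oo)%E.
  apply/eqP; rewrite -leye_eq; apply: le_trans (le (fun n => u n * +oo)%E _).
    by rewrite gt0_muley.
  by move=> m; rewrite mule_ge0.
by rewrite gt0_muley// (lt_le_trans un)// le.
Qed.

Section joint_chain.
Variable R : realType.
Local Notation mR := (measurableTypeR R).
Local Notation mu := (@lebesgue_measure R).
Implicit Types (r s x y l b T : R) (f g : mR * mR -> \bar R).

(* Expectation of f at (position, running minimum) after a time r, from position
   and running minimum p, for Brownian motion. *)
Definition joint_step r f (p : mR * mR) : \bar R :=
  (\int[mu]_y \int[mu]_l ((step_density r p.1 y l)%:E * f (y, Num.min p.2 l)))%E.

Lemma eq_joint_step r f g p : f =1 g -> joint_step r f p = joint_step r g p.
Proof. by move=> /funext ->. Qed.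

Lemma joint_step_ge0 r f p : (forall q, 0 <= f q)%E -> (0 <= joint_step r f p)%E.
Proof.
move=> f0; apply: integral_ge0 => y _; apply: integral_ge0 => l _.
by rewrite mule_ge0// lee_fin step_density_ge0.
Qed.

Lemma measurable_joint_step3 r f : measurable_fun setT f ->
  measurable_fun setT (fun w : mR * mR * mR * mR =>
    (step_density r w.1.1.1 w.1.2 w.2)%:E * f (w.1.2, Num.min w.1.1.2 w.2))%E.
Proof.
move=> mf; apply: emeasurable_funM.
  apply/measurable_EFinP; apply: measurable_step_density.
  - by do 2 apply: (measurableT_comp measurable_fst); exact: measurable_fst.
  - by apply: (measurableT_comp measurable_snd); exact: measurable_fst.
  - exact: measurable_snd.
apply: (measurableT_comp mf); apply: measurable_fun_pair.
  by apply: (measurableT_comp measurable_snd); exact: measurable_fst.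
apply: measurable_minr; last exact: measurable_snd.
apply: (measurableT_comp measurable_snd).
by apply: (measurableT_comp measurable_fst); exact: measurable_fst.
Qed.

Lemma measurable_joint_step2 r f : measurable_fun setT f -> (forall q, 0 <= f q)%E ->
  measurable_fun setT (fun w : mR * mR * mR =>
    \int[mu]_l ((step_density r w.1.1 w.2 l)%:E * f (w.2, Num.min w.1.2 l)))%E.
Proof.
move=> mf f0; apply: (@measurable_integral _ _ _ (fun (w : mR * mR * mR) l =>
  (step_density r w.1.1 w.2 l)%:E * f (w.2, Num.min w.1.2 l))%E).
  exact: measurable_joint_step3.
by move=> w l; rewrite mule_ge0// lee_fin step_density_ge0.
Qed.

Lemma measurable_joint_step r f : measurable_fun setT f -> (forall q, 0 <= f q)%E ->
  measurable_fun setT (joint_step r f).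
Proof.
move=> mf f0; apply: (@measurable_integral _ _ _ (fun (p : mR * mR) y =>
  \int[mu]_l ((step_density r p.1 y l)%:E * f (y, Num.min p.2 l)))%E).
  exact: measurable_joint_step2.
move=> p y; apply: integral_ge0 => l _.
by rewrite mule_ge0// lee_fin step_density_ge0.
Qed.

Lemma measurable_joint_step_slice r f p y : measurable_fun setT f ->
  measurable_fun setT (fun l : mR => (step_density r p.1 y l)%:E * f (y, Num.min p.2 l))%E.
Proof.
move=> mf; apply: emeasurable_funM; first by meas.
apply: (measurableT_comp mf); apply: measurable_fun_pair; first exact: measurable_cst.
by apply: measurable_minr; [exact: measurable_cst|exact: measurable_id].
Qed.

Lemma measurable_joint_step_inner r f p : measurable_fun setT f -> (forall q, 0 <= f q)%E ->
  measurable_fun setT (fun y : mR =>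
    \int[mu]_l ((step_density r p.1 y l)%:E * f (y, Num.min p.2 l)))%E.
Proof.
move=> mf f0; apply: (@measurable_integral _ _ _ (fun y l =>
  (step_density r p.1 y l)%:E * f (y, Num.min p.2 l))%E).
  apply: emeasurable_funM; first by meas.
  by apply: (measurableT_comp mf); apply: measurable_fun_pair; meas.
by move=> y l; rewrite mule_ge0// lee_fin step_density_ge0.
Qed.

Lemma joint_step_nneseries r (f_ : nat -> mR * mR -> \bar R) p :
  (forall n, measurable_fun setT (f_ n)) -> (forall n q, 0 <= f_ n q)%E ->
  (joint_step r (fun q => \sum_(n <oo) f_ n q) p = \sum_(n <oo) joint_step r (f_ n) p)%E.
Proof.
move=> mf f0; rewrite /joint_step.
have s0 n y l : (0 <= (step_density r p.1 y l)%:E * f_ n (y, Num.min p.2 l))%E.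
  by rewrite mule_ge0// lee_fin step_density_ge0.
rewrite -integral_nneseries//; first last.
- by move=> n y _; apply: integral_ge0.
- by move=> n; exact: measurable_joint_step_inner.
apply: eq_integralR => y; rewrite -integral_nneseries//; last first.
  by move=> n; exact: measurable_joint_step_slice.
by apply: eq_integralR => l; rewrite nneseriesZl.
Qed.

Lemma joint_stepD r f g p : measurable_fun setT f -> measurable_fun setT g ->
  (forall q, 0 <= f q)%E -> (forall q, 0 <= g q)%E ->
  (joint_step r (fun q => f q + g q) p = joint_step r f p + joint_step r g p)%E.
Proof.
move=> mf mg f0 g0; rewrite /joint_step.
have s0 (h : mR * mR -> \bar R) y l : (forall q, 0 <= h q)%E ->
    (0 <= (step_density r p.1 y l)%:E * h (y, Num.min p.2 l))%E.
  by move=> h0; rewrite mule_ge0// lee_fin step_density_ge0.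
rewrite -ge0_integralDT; first last.
- by move=> y; apply: integral_ge0 => l _; exact: s0.
- by move=> y; apply: integral_ge0 => l _; exact: s0.
- exact: measurable_joint_step_inner.
- exact: measurable_joint_step_inner.
apply: eq_integralR => y; rewrite -ge0_integralDT; first last.
- by move=> l; exact: s0.
- by move=> l; exact: s0.
- exact: measurable_joint_step_slice.
- exact: measurable_joint_step_slice.
by apply: eq_integralR => l; rewrite ge0_muleDr.
Qed.

Variables (T b : R).
Implicit Types (NL : seq (R * set (mR * mR))) (SL : seq (R * set mR * R)).
Implicit Type e : mR -> \bar R.

Definition joint_end e s (p : mR * mR) : \bar R :=
  (\int[mu]_l ((step_density (T - s) p.1 b l)%:E * e (Num.min p.2 l)))%E.

Fixpoint joint_chain e NL s (p : mR * mR) : \bar R :=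
  if NL is (s', B) :: NL' then
    joint_step (s' - s) (fun q => (\1_B q)%:E * joint_chain e NL' s' q)%E p
  else joint_end e s p.

Fixpoint measurable_steps NL : Prop :=
  if NL is (_, B) :: NL' then measurable B /\ measurable_steps NL' else True.

Lemma measurable_steps_cat NL (s' : R) (B : set (mR * mR)) (NL2 : seq (R * set (mR * mR))) :
  measurable_steps NL -> measurable B -> measurable_steps NL2 ->
  measurable_steps (NL ++ (s', B) :: NL2).
Proof. by elim: NL => [|[s1 B1] NL IH] //= [mB1 mNL] mB m2; split => //; exact: IH. Qed.

Lemma joint_end_ge0 e s p : (forall m, 0 <= e m)%E -> (0 <= joint_end e s p)%E.
Proof.
move=> e0; apply: integral_ge0 => l _.
by rewrite mule_ge0// lee_fin step_density_ge0.
Qed.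

Lemma joint_chain_ge0 e NL s p : (forall m, 0 <= e m)%E -> (0 <= joint_chain e NL s p)%E.
Proof.
move=> e0; elim: NL s p => [|[s' B] NL IH] s p /=; first exact: joint_end_ge0.
by apply: joint_step_ge0 => q; rewrite mule_ge0// lee_fin.
Qed.

Lemma measurable_joint_end e s : measurable_fun setT e -> (forall m, 0 <= e m)%E ->
  measurable_fun setT (joint_end e s).
Proof.
move=> me e0; apply: (@measurable_integral _ _ _ (fun (p : mR * mR) l =>
  (step_density (T - s) p.1 b l)%:E * e (Num.min p.2 l))%E).
  apply: emeasurable_funM.
    apply/measurable_EFinP; apply: measurable_step_density => //.
    by apply: (measurableT_comp measurable_fst); exact: measurable_fst.
  apply: (measurableT_comp me); apply: measurable_minr => //.
  by apply: (measurableT_comp measurable_snd); exact: measurable_fst.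
by move=> p l; rewrite mule_ge0// lee_fin step_density_ge0.
Qed.

Lemma measurable_joint_chain e NL s : measurable_fun setT e -> (forall m, 0 <= e m)%E ->
  measurable_steps NL -> measurable_fun setT (joint_chain e NL s).
Proof.
move=> me e0; elim: NL s => [|[s' B] NL IH] s /=; first by move=> _; exact: measurable_joint_end.
move=> [mB mNL]; apply: measurable_joint_step.
  apply: emeasurable_funM; last exact: IH.
  by apply/measurable_EFinP; exact: measurable_indic.
by move=> q; rewrite mule_ge0 ?lee_fin ?joint_chain_ge0.
Qed.

(** Countable additivity in the set of a single time slot, all other slots being fixed. *)
Lemma joint_chain_nneseries e (NL1 NL2 : seq (R * set (mR * mR))) s'
    (F : nat -> set (mR * mR)) s p :
  measurable_fun setT e -> (forall m, 0 <= e m)%E ->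
  measurable_steps NL1 -> measurable_steps NL2 ->
  (forall n, measurable (F n)) -> trivIset setT F ->
  (joint_chain e (NL1 ++ (s', \bigcup_n F n) :: NL2) s p =
   \sum_(n <oo) joint_chain e (NL1 ++ (s', F n) :: NL2) s p)%E.
Proof.
move=> me e0 + mNL2 mF tF; elim: NL1 s p => [|[s1 B] NL1 IH] s p /=.
  move=> _; rewrite -joint_step_nneseries; first last.
  - by move=> n q; rewrite mule_ge0 ?lee_fin ?joint_chain_ge0.
  - move=> n; apply: emeasurable_funM; last exact: measurable_joint_chain.
    by apply/measurable_EFinP; exact: measurable_indic.
  apply: eq_joint_step => q; rewrite indic_bigcup// nneseriesZr//.
  exact: joint_chain_ge0.
move=> [mB mNL1]; rewrite -joint_step_nneseries; first last.
- by move=> n q; rewrite mule_ge0 ?lee_fin ?joint_chain_ge0.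
- move=> n; apply: emeasurable_funM.
    by apply/measurable_EFinP; exact: measurable_indic.
  apply: measurable_joint_chain => //; exact: measurable_steps_cat.
apply: eq_joint_step => q; rewrite IH// nneseriesZl// => n _.
exact: joint_chain_ge0.
Qed.

Lemma joint_chainD e1 e2 NL s p : measurable_fun setT e1 -> measurable_fun setT e2 ->
  (forall m, 0 <= e1 m)%E -> (forall m, 0 <= e2 m)%E -> measurable_steps NL ->
  (joint_chain (fun m => e1 m + e2 m) NL s p =
   joint_chain e1 NL s p + joint_chain e2 NL s p)%E.
Proof.
move=> m1 m2 e10 e20; elim: NL s p => [|[s' B] NL IH] s p /=.
  move=> _; rewrite /joint_end -ge0_integralDT; first last.
  - by move=> l; rewrite mule_ge0// lee_fin step_density_ge0.
  - by move=> l; rewrite mule_ge0// lee_fin step_density_ge0.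
  - apply: emeasurable_funM; first by meas.
    apply: (measurableT_comp m2).
    by apply: measurable_minr; [exact: measurable_cst|exact: measurable_id].
  - apply: emeasurable_funM; first by meas.
    apply: (measurableT_comp m1).
    by apply: measurable_minr; [exact: measurable_cst|exact: measurable_id].
  by apply: eq_integralR => l; rewrite ge0_muleDr.
move=> [mB mNL]; rewrite -joint_stepD; first last.
- by move=> q; rewrite mule_ge0 ?lee_fin ?joint_chain_ge0.
- by move=> q; rewrite mule_ge0 ?lee_fin ?joint_chain_ge0.
- apply: emeasurable_funM; last exact: measurable_joint_chain.
  by apply/measurable_EFinP; exact: measurable_indic.
- apply: emeasurable_funM; last exact: measurable_joint_chain.
  by apply/measurable_EFinP; exact: measurable_indic.
by apply: eq_joint_step => q; rewrite IH// ge0_muleDr ?joint_chain_ge0.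
Qed.

End joint_chain.

Section rectangles.
Variable R : realType.
Local Notation mR := (measurableTypeR R).
Local Notation mu := (@lebesgue_measure R).
Variables (T b le : R).
Implicit Types (SL : seq (R * set mR * R)).

Definition rectangles SL : seq (R * set (mR * mR)) :=
  [seq (p.1.1, p.1.2 `*` [set l | p.2 < l]) | p <- SL].

Definition above (m : mR) : \bar R := ((le < m)%R%:R)%:E.

Lemma measurable_above : measurable_fun setT above.
Proof. by apply/measurable_EFinP; apply: measurable_ltr_nat. Qed.

Lemma above_ge0 m : (0 <= above m)%E. Proof. by rewrite lee_fin. Qed.

(** Since min m l > q means m > q and l > q, conditions on the minimum factor, and integrating over
    l turns each step into the kernel killed at the required level. *)
Lemma joint_chain_rectangles SL s x m : path <%R s (rcons (times SL) T) ->
  measurable_segments SL ->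
  (joint_chain T b above (rectangles SL) s (x, m) =
   ((required le SL < m)%R%:R)%:E * killed_chain T b le 0 SL s x)%E.
Proof.
elim: SL s x m => [|[[s' A] l0] SL IH] s x m /=.
  move=> /andP[sT _] _; rewrite /joint_end /= addr0.
  rewrite -integral_step_density ?subr_gt0// -ge0_integralZlT//; first last.
  - by move=> l; rewrite lee_fin mulr_ge0// step_density_ge0.
  - by meas.
  apply: eq_integralR => l; rewrite /above -!EFinM lt_min; congr EFin.
  by case: (le < m); case: (le < l); rewrite ?mulr0 ?mul0r ?mulr1 ?mul1r.
move=> /andP[ss' L'] [mA mS]; rewrite /joint_step /= addr0.
have mk := measurable_killed_chain T b le 0 s' mS.
set q := Num.max l0 _.
rewrite -ge0_integralZlT//; first last.
- by move=> y; rewrite !mule_ge0 ?lee_fin ?killed_ge0 ?killed_chain_ge0.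
- by meas.
apply: eq_integralR => y.
rewrite -integral_step_density ?subr_gt0// -ge0_integralZrT//; first last.
- by rewrite mule_ge0 ?lee_fin ?killed_chain_ge0.
- by move=> l; rewrite lee_fin mulr_ge0// step_density_ge0.
- by meas.
rewrite -ge0_integralZlT//; first last.
- move=> l; apply: mule_ge0; last by rewrite mule_ge0 ?lee_fin ?killed_chain_ge0.
  by rewrite lee_fin mulr_ge0// step_density_ge0.
- by meas.
apply: eq_integralR => l; rewrite IH// /q gt_max.
have -> : \1_(A `*` [set l1 | l0 < l1]) (y, Num.min m l) =
    \1_A y * (l0 < Num.min m l)%R%:R :> R.
  by rewrite !indicE -natrM mulnb; congr (nat_of_bool _)%:R; apply/idP/andP;
    rewrite !inE.
rewrite !lt_min gt_max.
case: (l0 < m); case: (l0 < l); case: (required le SL < m); case: (required le SL < l) => /=;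
  rewrite ?mulr0n ?mulr1n ?mulr0 ?mulr1 ?mul0e ?mule0 ?mul1e ?mule0//.
Qed.

End rectangles.

Section generation.
Variable R : realType.
Local Notation mR := (measurableTypeR R).

Definition vertical_rays : set (set (mR * mR)) :=
  [set B | exists A l, measurable A /\ B = A `*` [set m : mR | l < m]].

Lemma vertical_rays_setI : setI_closed vertical_rays.
Proof.
move=> _ _ [A1 [l1 [mA1 ->]]] [A2 [l2 [mA2 ->]]].
exists (A1 `&` A2), (Num.max l1 l2); split; first exact: measurableI.
rewrite -setXI; congr (_ `*` _); apply/seteqP; split => m /=.
  by move=> [? ?]; rewrite gt_max; apply/andP.
by rewrite gt_max => /andP.
Qed.

Lemma bigcup_rays : \bigcup_k [set m : mR | - k%:R < m] = setT.
Proof.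
apply/seteqP; split => // m _; exists (Num.truncn `|m|).+1 => //=.
rewrite ltrNl (le_lt_trans _ (truncnS_gt _))//.
by rewrite -normrN ler_norm.
Qed.

Lemma measurable_vertical_rays : @measurable _ (mR * mR)%type = <<s vertical_rays>>.
Proof.
apply/seteqP; split; last first.
  apply: smallest_sub; first exact: sigma_algebra_measurable.
  move=> _ [A [l [mA ->]]]; apply: measurableX => //; exact: measurable_gtr.
pose G := g_sigma_algebraType vertical_rays.
have mfst : measurable_fun setT (fst : G -> mR).
  move=> _ A mA; rewrite setTI.
  rewrite (_ : _ @^-1` _ = \bigcup_k (A `*` [set m : mR | - k%:R < m])).
    apply: bigcupT_measurable => k; apply: sub_sigma_algebra.
    by exists A, (- k%:R).
  by rewrite -setX_bigcupr bigcup_rays; apply/seteqP; split => -[x y] //= [].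
have msnd : measurable_fun setT (snd : G -> mR).
  apply: (measurability (@RGenOInfty.G R) (@RGenOInfty.measurableE R)).
  move=> _ [_ [x ->] <-]; rewrite setTI; apply: sub_sigma_algebra.
  exists setT, x; split => //; apply/seteqP; split => -[y z] /=.
    by rewrite in_itv/= andbT.
  by rewrite in_itv/= andbT => -[].
have mid : measurable_fun setT (fun p : G => (p.1, p.2) : mR * mR).
  exact: measurable_fun_pair.
move=> B mB; have := mid measurableT B mB; rewrite setTI.
by rewrite (_ : _ @^-1` _ = B)//; apply/seteqP; split => -[].
Qed.

End generation.

Section joint_law.
Variables (R : realType) (t : {posnum R}) (a b le : R).
Local Notation mR := (measurableTypeR R).
Local Notation T := t%:num.
Variable P : probability (cpath t R) R.
Hypotheses (a0 : 0 < a) (b0 : 0 < b) (le0 : 0 <= le).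
Hypothesis lawP : bes3_bridge_law a b P.
Implicit Types (phi : cpath t R) (NL : seq (R * set (mR * mR))).

Fixpoint joint_event NL phi : Prop :=
  if NL is (s, B) :: NL' then
    B (on_line phi s, running_min phi s) /\ joint_event NL' phi
  else le < running_min phi T.

Lemma joint_event_cat NL1 s B NL2 phi : joint_event (NL1 ++ (s, B) :: NL2) phi <->
  joint_event (NL1 ++ NL2) phi /\ B (on_line phi s, running_min phi s).
Proof.
elim: NL1 => [|[s1 B1] NL1 IH] /=; first by tauto.
by rewrite IH; tauto.
Qed.

Lemma measurable_state s : measurable_fun setT
  (fun phi : cpath t R => (on_line phi s, running_min phi s) : mR * mR).
Proof. by apply: measurable_fun_pair; [exact: measurable_on_line|exact: measurable_past_min]. Qed.

Lemma measurable_joint_event NL : measurable_steps NL ->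
  measurable [set phi | joint_event NL phi].
Proof.
elim: NL => [|[s B] NL IH] /=.
  move=> _; have := measurable_past_min (clip t T) measurableT (measurable_gtr le).
  by rewrite setTI.
move=> [mB mNL]; apply: measurableI; last exact: IH.
by have := measurable_state s measurableT mB; rewrite setTI.
Qed.

Lemma joint_event_rectangles (SL : seq (R * set mR * R)) phi :
  joint_event (rectangles SL) phi <-> segment_event le SL phi.
Proof.
elim: SL => [|[[s A] l] SL IH] //=.
by rewrite IH; split=> [[[]]|[]].
Qed.

Lemma killed_chain_low (SL : seq (R * set mR * R)) s x : x <= required le SL ->
  killed_chain T b le 0 SL s x = 0%E.
Proof.
case: SL => [|[[s' A] l] SL] /=; rewrite addr0 => xl; first by rewrite killed_out ?xl.
by apply: integral0_eq => y _; rewrite killed_out ?xl// mul0e.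
Qed.

Lemma joint_step_eq0 r (f : mR * mR -> \bar R) p : (forall q, f q = 0%E) ->
  joint_step r f p = 0%E.
Proof.
move=> f0; apply: integral0_eq => y _; apply: integral0_eq => l _.
by rewrite f0 mule0.
Qed.

Lemma joint_chain_set0 e (NL1 NL2 : seq (R * set (mR * mR))) s' s p :
  joint_chain T b e (NL1 ++ (s', set0) :: NL2) s p = 0%E.
Proof.
elim: NL1 s p => [|[s1 B1] NL1 IH] s p /=; apply: joint_step_eq0 => q.
  by rewrite indic0 mul0e.
by rewrite IH mule0.
Qed.

Definition joint_chain_slot NL1 NL2 (s' : R) (B : set (mR * mR)) : \bar R :=
  joint_chain T b (above le) (NL1 ++ (s', B) :: NL2) 0 (a, a).

Lemma joint_chain_slot_sigma_additive NL1 NL2 s' :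
  measurable_steps NL1 -> measurable_steps NL2 ->
  semi_sigma_additive (joint_chain_slot NL1 NL2 s').
Proof.
move=> m1 m2 F mF tF mUF; rewrite /joint_chain_slot.
rewrite joint_chain_nneseries//; first last.
- exact: above_ge0.
- exact: measurable_above.
apply/cvg_closeP; split; last by rewrite closeE.
by apply: is_cvg_nneseries => n _ _; apply: joint_chain_ge0; exact: above_ge0.
Qed.

(** Rectangles are replaced by Borel sets one slot at a time. In the set of one slot, both sides are
    measures; on rectangles they agree by the induction hypothesis, with that slot moved to the end
    of [SL]. *)
Lemma joint_event_law_mixed NL (SL : seq (R * set mR * R)) :
  path <%R 0 (rcons (times SL ++ map fst NL) T) ->
  measurable_segments SL -> measurable_steps NL ->
  (P [set phi | joint_event (rectangles SL ++ NL) phi] * (killed T 0 a b)%:E =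
   joint_chain T b (above le) (rectangles SL ++ NL) 0 (a, a))%E.
Proof.
elim: NL SL => [|[s B] NL IH] SL.
  rewrite !cats0 => L mS _; rewrite joint_chain_rectangles//.
  transitivity (killed_chain T b le 0 SL 0 a).
    rewrite -(segment_event_law a0 b0 le0 lawP)//; congr (P _ * _)%E.
    by apply/seteqP; split => phi /joint_event_rectangles.
  by case: ltP => [_|la]; [rewrite mul1e|rewrite killed_chain_low// mule0].
move=> L mS [mB mNL].
have mR1 : measurable_steps (rectangles SL).
  elim: SL mS {L} => [|[[s1 A] l] SL IHS] //= [mA mS]; split; last exact: IHS.
  by apply: measurableX => //; exact: measurable_gtr.
have mRNL : measurable_steps (rectangles SL ++ NL).
  by elim: (rectangles SL) mR1 => [|[s1 B1] L1 IHL] //= [mB1 mL1]; split => //; exact: IHL.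
pose E := [set phi | joint_event (rectangles SL ++ NL) phi].
have mE : measurable E by exact: measurable_joint_event.
have K0 : 0 <= killed T 0 a b by exact: killed_ge0.
pose M1 : {measure set (mR * mR) -> \bar R} :=
  mscale (NngNum K0) (image_measure (mrestr P mE) (measurable_state s)).
pose m2 := joint_chain_slot (rectangles SL) NL s.
have m20 : m2 set0 = 0%E by exact: joint_chain_set0.
have m2ge0 C : (0 <= m2 C)%E by apply: joint_chain_ge0; exact: above_ge0.
have m2sa : semi_sigma_additive m2 by exact: joint_chain_slot_sigma_additive.
pose M2 : {measure set (mR * mR) -> \bar R} :=
  HB.pack m2 (isMeasure.Build _ _ _ m2 m20 m2ge0 m2sa).
have M1E C : M1 C =
    (P [set phi | joint_event (rectangles SL ++ (s, C) :: NL) phi] * (killed T 0 a b)%:E)%E.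
  rewrite /M1 /= /mscale /= muleC; congr (P _ * _)%E.
  apply/seteqP; split => phi /=; first by move=> [h1 h2]; apply/joint_event_cat.
  by move=> /joint_event_cat[h1 h2].
rewrite -M1E; change (M1 B = M2 B).
(* The plane itself is not in the generating class and is exhausted by the half-planes m > - k. *)
apply: (measure_unique (@vertical_rays R) (fun k => setT `*` [set m : mR | - k%:R < m])) => //.
- exact: measurable_vertical_rays.
- exact: vertical_rays_setI.
- by move=> k; exists setT, (- k%:R).
- by rewrite -setX_bigcupr bigcup_rays setXTT.
- move=> _ [A [l [mA ->]]]; rewrite M1E.
  have := IH (SL ++ [:: (s, A, l)]).
  rewrite /times /rectangles !map_cat /= -!catA /= => -> //.
  elim: SL mS {L mR1 mRNL E mE M1 M1E m2 m20 m2ge0 m2sa M2} => [|[[s1 A1] l1] SL IHS] //=.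
  by move=> [mA1 mS]; split => //; exact: IHS.
- move=> k; rewrite M1E muleC lte_mul_pinfty ?lee_fin//.
  rewrite (le_lt_trans (probability_le1 _ _)) ?ltry//.
  apply: measurable_joint_event; apply: measurable_steps_cat => //.
  by apply: measurableX => //; exact: measurable_gtr.
Qed.

Theorem joint_event_law NL : path <%R 0 (rcons (map fst NL) T) -> measurable_steps NL ->
  (P [set phi | joint_event NL phi] * (killed T 0 a b)%:E =
   joint_chain T b (above le) NL 0 (a, a))%E.
Proof. by move=> L mNL; exact: (@joint_event_law_mixed NL [::]). Qed.

End joint_law.

(** * The Pitman transform of the bridge *)

Section intertwined_chain.
Variable R : realType.
Local Notation mR := (measurableTypeR R).
Local Notation mu := (@lebesgue_measure R).
Implicit Types (r s x y z w l : R).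

Lemma ge0_integral_shift (c : R) (f : mR -> \bar R) :
  measurable_fun setT f -> (forall x, 0 <= f x)%E ->
  (\int[mu]_x f x = \int[mu]_x f (c + x)%R)%E.
Proof.
move=> mf f0; rewrite (@ge0_integral_affine _ 1 c)// ?oner_eq0//.
by rewrite normr1 mul1e; apply: eq_integralR => x; rewrite mul1r addrC.
Qed.

Lemma step_density_shift r (c x y l : R) :
  step_density r (c + x) (c + y) (c + l) = step_density r x y l.
Proof.
rewrite /step_density -addr_minr ltrD2l; congr (_ * (2 * flux r _)); ring.
Qed.

(* The entrance law from 0 of the kernels killed r 0. *)
Definition entrance r w : R := (0 < w)%R%:R * flux r w.

Lemma entrance_ge0 r w : 0 <= entrance r w.
Proof. by rewrite /entrance; case: ltP => w0; rewrite ?mul0r// mul1r flux_ge0// ltW. Qed.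

Lemma measurable_entrance r : measurable_fun setT (entrance r).
Proof. by apply: measurable_funM; [exact: measurable_ltr_nat|exact: measurable_flux]. Qed.

(** The limit z -> 0 of [intertwining_step] divided by 2 z: the uniform start on (-z, z) shrinks to
    the point 0, and killed r 0 z w / (2 z) tends to flux r w. It is proved directly by the
    substitution w = y - 2 l. *)
Lemma intertwining_start r y (g : mR -> \bar R) : 0 < r ->
  measurable_fun setT g -> (forall l, 0 <= g l)%E ->
  (\int[mu]_l ((step_density r 0 y l)%:E * g (Num.min 0 l)%R) =
   \int[mu]_w (((`|y| < w)%R%:R * entrance r w)%:E * g ((y - w) / 2)%R))%E.
Proof.
move=> r0 mg g0.
have mS : measurable_fun setT (fun l : mR => (step_density r 0 y l)%:E * g (Num.min 0 l)%R)%E.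
  apply: emeasurable_funM; first by meas.
  by apply: (measurableT_comp mg); apply: measurable_minr.
have S0 l : (0 <= (step_density r 0 y l)%:E * g (Num.min 0 l)%R)%E.
  by rewrite mule_ge0// lee_fin step_density_ge0.
have n0 : - 2^-1 != 0 :> R by rewrite oppr_eq0 invr_eq0 pnatr_eq0.
rewrite (ge0_integral_affine (y / 2) n0 mS S0).
rewrite normrN gtr0_norm ?invr_gt0// -ge0_integralZlT//; last first.
  exact: (measurableT_comp mS (measurable_affine (- 2^-1) (y / 2))).
apply: eq_integralR => w.
have -> : - 2^-1 * w + y / 2 = (y - w) / 2 by ring.
rewrite muleA -EFinM /step_density lt_min add0r ltr_norml.
have -> : ((y - w) / 2 < 0) = (y < w) by apply/idP/idP => ?; lra.
have -> : ((y - w) / 2 < y) = (- w < y) by apply/idP/idP => ?; lra.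
rewrite andbC; have [yw|_] := boolP ((- w < y) && (y < w)); last by rewrite !mul0r mulr0 !mul0e.
have /andP[yw1 yw2] := yw.
have -> : Num.min 0 ((y - w) / 2) = (y - w) / 2 by apply/min_idPr; lra.
rewrite /entrance; have -> : 0 < w by lra.
congr (_%:E * _)%E; rewrite (_ : y - 2 * ((y - w) / 2) = w); last by field.
by move=> /=; field.
Qed.

Variables (T a b : R).
Implicit Types (e : mR -> \bar R) (ZL : seq (R * set mR)) (kap : R -> R -> R).

Lemma joint_step_shift r (f : mR * mR -> \bar R) x m : measurable_fun setT f ->
  (forall q, 0 <= f q)%E ->
  (joint_step r f (a + x, a + m)%R =
   \int[mu]_y \int[mu]_l ((step_density r x y l)%:E * f (a + y, a + Num.min m l)%R))%E.
Proof.
move=> mf f0; rewrite /joint_step /=.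
have s0 y l : (0 <= (step_density r (a + x) y l)%:E * f (y, Num.min (a + m) l)%R)%E.
  by rewrite mule_ge0// lee_fin step_density_ge0.
rewrite (@ge0_integral_shift a); last 2 first.
- exact: (measurable_joint_step_inner r (a + x, a + m) mf f0).
- by move=> y; apply: integral_ge0.
apply: eq_integralR => y.
rewrite (@ge0_integral_shift a); last 2 first.
- exact: (measurable_joint_step_slice r (a + x, a + m) (a + y) mf).
- by move=> l.
by apply: eq_integralR => l; rewrite step_density_shift -addr_minr.
Qed.

(** The unnormalised conditional law given that Z is w: the position is a + x with x uniform on (-w,
    w), and position - 2 min + a = w then fixes the minimum. *)
Definition wedge w (J : mR * mR -> \bar R) : \bar R :=
  (\int[mu]_x (((`|x| < w)%R%:R)%:E * J (a + x, a + (x - w) / 2)%R))%E.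

Definition lift_steps ZL : seq (R * set (mR * mR)) :=
  [seq (p.1, [set q : mR * mR | p.2 (q.1 - 2 * q.2 + a)%R]) | p <- ZL].

Lemma measurable_wedge_integrand (J : mR * mR -> \bar R) : measurable_fun setT J ->
  measurable_fun setT (fun q : mR * mR =>
    ((`|q.2| < q.1)%R%:R)%:E * J (a + q.2, a + (q.2 - q.1) / 2)%R)%E.
Proof.
move=> mJ; apply: emeasurable_funM; first by meas.
by apply: (measurableT_comp mJ); apply: measurable_fun_pair; meas.
Qed.

(** In these coordinates Z is w itself, so the condition on Z leaves the integral over the
    position. *)
Lemma wedge_transport (kap : R -> R) (C : set mR) (J : mR * mR -> \bar R) :
  (forall w, 0 <= kap w) -> measurable_fun setT kap -> measurable C ->
  measurable_fun setT J -> (forall q, 0 <= J q)%E ->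
  (\int[mu]_y \int[mu]_w (((`|y| < w)%R%:R * kap w)%:E *
     ((\1_C (a + y - 2 * (a + (y - w) / 2) + a)%R)%:E * J (a + y, a + (y - w) / 2)%R)) =
   \int[mu]_w ((kap w)%:E * ((\1_C w)%:E * wedge w J)))%E.
Proof.
move=> k0 mk mC mJ J0.
have mW := measurable_wedge_integrand mJ.
pose F y w := (((`|y| < w)%R%:R * kap w)%:E *
     ((\1_C w)%:E * J (a + y, a + (y - w) / 2)%R))%E.
have F0 y w : (0 <= F y w)%E.
  by rewrite /F !mule_ge0 ?lee_fin ?mulr_ge0.
have mJ' : measurable_fun setT (fun q : mR * mR => J (a + q.1, a + (q.1 - q.2) / 2)%R).
  by apply: (measurableT_comp mJ); apply: measurable_fun_pair; meas.
have mF : measurable_fun setT (fun q : mR * mR => F q.1 q.2).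
  apply: emeasurable_funM.
    apply/measurable_EFinP; apply: measurable_funM; first by meas.
    exact: (measurableT_comp mk measurable_snd).
  by apply: emeasurable_funM => //; meas.
transitivity (\int[mu]_y \int[mu]_w F y w)%E.
  apply: eq_integralR => y; apply: eq_integralR => w; rewrite /F.
  by congr (_ * (EFin (\1_C _) * _))%E; field.
rewrite (tonelli mF)//; apply: eq_integralR => w.
rewrite /F /wedge.
have mw : measurable_fun setT (fun y : mR => J (a + y, a + (y - w) / 2)%R).
  by apply: (measurableT_comp mJ); apply: measurable_fun_pair; meas.
rewrite -ge0_integralZlT//; first last.
- by move=> x; rewrite mule_ge0 ?lee_fin.
- by meas.
rewrite -ge0_integralZlT//; first last.
- by rewrite lee_fin.
- by move=> x; rewrite !mule_ge0 ?lee_fin.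
- by meas.
apply: eq_integralR => y.
rewrite EFinM -muleA muleCA; congr (_ * _)%E; rewrite muleCA.
by [].
Qed.

(* The weight of the Pitman transform after time s: kap is the kernel of the
   first step, all the others are killed at 0. *)
Fixpoint bessel_chain (lo hi : R) ZL s kap : \bar R :=
  if ZL is (s', C) :: ZL' then
    (\int[mu]_w ((kap (s' - s) w)%:E * ((\1_C w)%:E *
      bessel_chain lo hi ZL' s' (fun r w' => killed r 0 w w'))))%E
  else (\int[mu]_w ((((lo < w) && (w < hi))%R%:R * kap (T - s) w)%:E))%E.

Variables lo hi : R.
Hypotheses (hiE : hi = a + b) (bound_lo : `|b - a| <= lo).

(** As Z_T = a + b - 2 m and hi = a + b, this is the condition lo <= Z_T < hi. *)
Definition between (m : mR) : \bar R := (((0 < m) && (m <= (hi - lo) / 2))%R%:R)%:E.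

Lemma between_ge0 m : (0 <= between m)%E. Proof. by rewrite lee_fin. Qed.

Lemma measurable_between : measurable_fun setT between.
Proof.
apply/measurable_EFinP; rewrite (_ : (fun _ => _) = (fun m : mR =>
  (0 < m)%R%:R * (m <= (hi - lo) / 2)%R%:R : R)); first by meas.
by apply/funext => m; rewrite -natrM mulnb.
Qed.

Lemma integral_between (kap : R -> R) : measurable_fun setT kap -> (forall w, 0 <= kap w) ->
  (\int[mu]_w (((`|b - a| < w)%R%:R * kap w)%:E * between (a + (b - a - w) / 2)%R) =
   \int[mu]_w ((((lo < w) && (w < hi))%R%:R * kap w)%:E))%E.
Proof.
move=> mk k0.
have E (w : R) : w != lo -> ((((`|b - a| < w)%R%:R * kap w)%:E * between (a + (b - a - w) / 2)%R) =
   (((lo < w) && (w < hi))%R%:R * kap w)%:E)%E.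
  move=> wlo; rewrite /between -EFinM; congr EFin.
  rewrite mulrAC -natrM mulnb; congr ((nat_of_bool _)%:R * _).
  rewrite hiE; have -> : (0 < a + (b - a - w) / 2) = (w < a + b) by apply/idP/idP => ?; lra.
  have -> : (a + (b - a - w) / 2 <= (a + b - lo) / 2) = (lo <= w).
    by apply/idP/idP => ?; lra.
  rewrite [in RHS]lt_neqAle eq_sym wlo /=.
  case: (leP lo w) => low; rewrite ?andbF// ?andbT.
  have -> : `|b - a| < w.
    by apply: (le_lt_trans bound_lo); rewrite lt_neqAle eq_sym wlo.
  by [].
apply: ae_eq_integral => //.
- apply: emeasurable_funM; first by meas.
  by apply: (measurableT_comp measurable_between); meas.
- apply/measurable_EFinP; rewrite (_ : (fun _ => _) = (fun w : mR =>
    (lo < w)%R%:R * (w < hi)%R%:R * kap w : R)); first by meas.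
  by apply/funext => w; rewrite -natrM mulnb.
(* The two integrands differ at most at w = lo, which [between] includes and [bessel_chain]
   excludes. *)
- exists [set lo]; split; [exact: measurable_set1|exact: lebesgue_measure_set1|].
  move=> w /= h; apply/eqP; apply: contra_notT h => wlo _; exact: E.
Qed.

Lemma measurable_lift_steps ZL : all_measurable ZL -> measurable_steps (lift_steps ZL).
Proof.
elim: ZL => [|[s C] ZL IH] //= [mC mZ]; split; last exact: IH.
have mz : measurable_fun setT (fun q : mR * mR => q.1 - 2 * q.2 + a : mR) by meas.
by have := mz measurableT C mC; rewrite setTI.
Qed.

(** Each step exchanges a wedge at z for a killed kernel from z to w followed by a wedge at w. At
    the final time the position is pinned at b, and only the integral over w remains. *)
Lemma wedge_joint_chain ZL s z : 0 < z -> all_measurable ZL ->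
  path <%R s (rcons (map fst ZL) T) ->
  wedge z (joint_chain T b between (lift_steps ZL) s) =
  bessel_chain lo hi ZL s (fun r w => killed r 0 z w).
Proof.
elim: ZL s z => [|[s' C] ZL IH] s z z0 /=.
  move=> _ /andP[sT _]; rewrite /wedge /joint_end /=.
  pose g l := between (a + l)%R.
  have mg : measurable_fun setT g.
    by apply: (measurableT_comp measurable_between); meas.
  have g0 l : (0 <= g l)%E by exact: between_ge0.
  have r0 : 0 < T - s by rewrite subr_gt0.
  rewrite -integral_between; last 2 first.
  - exact: measurable_killed.
  - by move=> w; exact: killed_ge0.
  rewrite -(intertwining_step (b - a) r0 z0 mg g0); apply: eq_integralR => x.
  congr (_ * _)%E; rewrite [LHS](@ge0_integral_shift a); last 2 first.
  - apply: emeasurable_funM; first by meas.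
    by apply: (measurableT_comp measurable_between); meas.
  - by move=> l; rewrite mule_ge0 ?between_ge0// lee_fin step_density_ge0.
  apply: eq_integralR => l; rewrite /g -addr_minr.
  rewrite -(step_density_shift (T - s) a x (b - a) l).
  by rewrite (_ : a + (b - a) = b) //; ring.
move=> [mC mZ] /andP[ss' L']; have r0 : 0 < s' - s by rewrite subr_gt0.
have mJ : measurable_fun setT (joint_chain T b between (lift_steps ZL) s').
  apply: measurable_joint_chain; [exact: measurable_between|exact: between_ge0|].
  exact: measurable_lift_steps.
have J0 q : (0 <= joint_chain T b between (lift_steps ZL) s' q)%E.
  by apply: joint_chain_ge0; exact: between_ge0.
rewrite /wedge /=; set J := joint_chain _ _ _ _ _ in mJ J0 *.
pose f (q : mR * mR) : \bar R := ((\1_[set q : mR * mR | C (q.1 - 2 * q.2 + a)%R] q)%:E * J q)%E.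
have mC' : measurable [set q : mR * mR | C (q.1 - 2 * q.2 + a)].
  by have [] := @measurable_lift_steps [:: (s', C)] (conj mC Logic.I).
have mf : measurable_fun setT f.
  by apply: emeasurable_funM => //; apply/measurable_EFinP; exact: measurable_indic.
have f0 q : (0 <= f q)%E by rewrite mule_ge0 ?lee_fin.
have mfa : measurable_fun setT (fun q : mR * mR => f (a + q.1, a + q.2)%R).
  by apply: (measurableT_comp mf); apply: measurable_fun_pair; meas.
pose G x y := (((`|x| < z)%R%:R)%:E * \int[mu]_l ((step_density (s' - s) x y l)%:E *
  f (a + y, a + Num.min ((x - z) / 2) l)%R))%E.
have I0 x y l : (0 <= (step_density (s' - s) x y l)%:E *
    f (a + y, a + Num.min ((x - z) / 2) l)%R)%E.
  by rewrite mule_ge0// lee_fin step_density_ge0.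
have mG : measurable_fun setT (fun q : mR * mR => G q.1 q.2).
  apply: emeasurable_funM; first by meas.
  apply: (@measurable_integral _ _ _ (fun (q : mR * mR) l => (step_density (s' - s) q.1 q.2 l)%:E *
    f (a + q.2, a + Num.min ((q.1 - z) / 2) l)%R)%E) => //.
  apply: emeasurable_funM; first by meas.
  by apply: (measurableT_comp mf); apply: measurable_fun_pair; meas.
have G0 x y : (0 <= G x y)%E.
  by rewrite mule_ge0 ?lee_fin//; exact: integral_ge0.
transitivity (\int[mu]_x \int[mu]_y G x y)%E.
  apply: eq_integralR => x; rewrite -/f joint_step_shift// /G -ge0_integralZlT//.
  - apply: (@measurable_integral _ _ _ (fun y l => (step_density (s' - s) x y l)%:E *
      f (a + y, a + Num.min ((x - z) / 2) l)%R)%E) => //.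
    apply: emeasurable_funM; first by meas.
    by apply: (measurableT_comp mf); apply: measurable_fun_pair; meas.
  - by move=> y; exact: integral_ge0.
rewrite (tonelli mG)//.
transitivity (\int[mu]_y \int[mu]_w (((`|y| < w)%R%:R * killed (s' - s) 0 z w)%:E *
     ((\1_C (a + y - 2 * (a + (y - w) / 2) + a)%R)%:E * J (a + y, a + (y - w) / 2)%R)))%E.
  apply: eq_integralR => y; rewrite /G.
  pose g l := f (a + y, a + l)%R.
  have mg : measurable_fun setT g.
    by apply: (measurableT_comp mf); apply: measurable_fun_pair; meas.
  rewrite (intertwining_step y r0 z0 mg (fun l => f0 _)); apply: eq_integralR => w.
  by rewrite /g /f.
rewrite wedge_transport//.
- apply: eq_integralR => w; have [w0|w0] := leP w 0.
    by rewrite killed_out ?w0 ?orbT// !mul0e.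
  by rewrite -IH.
- by move=> w; exact: killed_ge0.
- exact: measurable_killed.
Qed.

End intertwined_chain.

Section chain_start.
Variable R : realType.
Local Notation mR := (measurableTypeR R).
Local Notation mu := (@lebesgue_measure R).
Variables (T a b lo hi : R).
Hypotheses (hiE : hi = a + b) (bound_lo : `|b - a| <= lo).

Lemma joint_chain_start (ZL : seq (R * set mR)) : all_measurable ZL ->
  path <%R 0 (rcons (map fst ZL) T) ->
  joint_chain T b (between lo hi) (lift_steps a ZL) 0 (a, a) =
  bessel_chain T lo hi ZL 0 (@entrance R).
Proof.
have mb := measurable_between lo hi; have b0 := between_ge0 lo hi.
case: ZL => [|[s C] ZL] /=.
  move=> _ /andP[T0 _]; rewrite /joint_end /=.
  pose g l := between lo hi (a + l)%R.
  have mg : measurable_fun setT g by apply: (measurableT_comp mb); meas.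
  have g0 l : (0 <= g l)%E by exact: b0.
  have r0 : 0 < T - 0 by rewrite subr0.
  rewrite -(integral_between hiE bound_lo); last 2 first.
  - exact: measurable_entrance.
  - by move=> w; exact: entrance_ge0.
  rewrite -(intertwining_start (b - a) r0 mg g0).
  rewrite [LHS](@ge0_integral_shift _ a); last 2 first.
  - apply: emeasurable_funM; first by meas.
    by apply: (measurableT_comp mb); meas.
  - by move=> l; rewrite mule_ge0 ?b0// lee_fin step_density_ge0.
  apply: eq_integralR => l; rewrite /g.
  rewrite -(step_density_shift (T - 0) a 0 (b - a) l) addr0.
  rewrite (_ : a + (b - a) = b); last by ring.
  by rewrite addr_minr addr0.
move=> [mC mZ] /andP[s0 L']; have r0 : 0 < s - 0 by rewrite subr0.
have mJ : measurable_fun setT (joint_chain T b (between lo hi) (lift_steps a ZL) s).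
  by apply: measurable_joint_chain => //; exact: measurable_lift_steps.
have J0 q : (0 <= joint_chain T b (between lo hi) (lift_steps a ZL) s q)%E.
  exact: joint_chain_ge0.
set J := joint_chain _ _ _ _ _ in mJ J0 *.
pose f (q : mR * mR) : \bar R :=
  ((\1_[set q : mR * mR | C (q.1 - 2 * q.2 + a)%R] q)%:E * J q)%E.
have mC' : measurable [set q : mR * mR | C (q.1 - 2 * q.2 + a)].
  by have [] := @measurable_lift_steps _ a [:: (s, C)] (conj mC Logic.I).
have mf : measurable_fun setT f.
  by apply: emeasurable_funM => //; apply/measurable_EFinP; exact: measurable_indic.
have f0 q : (0 <= f q)%E by rewrite mule_ge0 ?lee_fin.
rewrite -/f -[X in joint_step _ _ (X, _)]addr0 -[X in joint_step _ _ (_, X)]addr0.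
rewrite joint_step_shift//.
transitivity (\int[mu]_y \int[mu]_w (((`|y| < w)%R%:R * entrance (s - 0) w)%:E *
     ((\1_C (a + y - 2 * (a + (y - w) / 2) + a)%R)%:E * J (a + y, a + (y - w) / 2)%R)))%E.
  apply: eq_integralR => y.
  pose g l := f (a + y, a + l)%R.
  have mg : measurable_fun setT g.
    by apply: (measurableT_comp mf); apply: measurable_fun_pair; meas.
  by rewrite (intertwining_start y r0 mg (fun l => f0 _)).
rewrite wedge_transport//.
- apply: eq_integralR => w; have [w0|w0] := leP w 0.
    by rewrite /entrance ltNge w0 !mul0r !mul0e.
  by rewrite (wedge_joint_chain hiE bound_lo).
- by move=> w; exact: entrance_ge0.
- exact: measurable_entrance.
Qed.

End chain_start.

Section pitman.
Variables (R : realType) (t : {posnum R}).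
Local Notation mR := (measurableTypeR R).
Local Notation T := t%:num.
Variables (a b lo hi : R) (P : probability (cpath t R) R).
Hypotheses (a0 : 0 < a) (b0 : 0 < b) (lawP : bes3_bridge_law a b P).
Hypotheses (hiE : hi = a + b) (bound_lo : `|b - a| <= lo) (lohi : lo <= hi).
Implicit Types (phi : cpath t R) (ZL : seq (R * set mR)).
Local Notation K := (killed T 0 a b).
Local Notation theta := ((hi - lo) / 2).

Definition pitman phi (s : R) : R := on_line phi s - 2 * running_min phi s + a.

Lemma joint_event_lift le ZL phi : joint_event le (lift_steps a ZL) phi <->
  hits ZL (pitman phi) /\ le < running_min phi T.
Proof.
elim: ZL => [|[s C] ZL IH] /=; first by split => // -[].
by rewrite IH; tauto.
Qed.

Lemma measurable_running_min_le x :
  measurable [set phi : cpath t R | running_min phi T <= x].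
Proof.
have := measurable_past_min (clip t T) measurableT (measurable_gtr x); rewrite setTI.
move=> /measurableC; congr measurable; apply/seteqP; split => phi /=.
  by move=> h; rewrite leNgt; apply/negP.
by rewrite leNgt => /negP.
Qed.

(** The definition of the bridge gives only nonnegative paths. Strict positivity follows from the
    joint law with no time slots, which gives the event min > 0 the weight [killed T 0 a b], that
    is, probability 1. *)
Lemma running_min_gt0 : P [set phi | running_min phi T <= 0] = 0%E.
Proof.
have K0 : 0 < K by exact: killed_gt0.
have := joint_event_law a0 b0 (lexx 0) lawP (NL := [::]).
rewrite /= gt0 => /(_ isT Logic.I).
have := @joint_chain_rectangles R T b 0 [::] 0 a a; rewrite /= gt0 => /(_ isT Logic.I).
rewrite a0 mul1e addr0 subr0 => ->.
have mE := measurable_running_min_le 0.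
rewrite (_ : [set phi | 0 < running_min phi T] =
  ~` [set phi : cpath t R | running_min phi T <= 0]); last first.
  by apply/seteqP; split => phi /=; rewrite ltNge => /negP.
rewrite probability_setC// -(fineK (fin_num_measure P _ mE)) -EFinB -EFinM.
move=> []; rewrite -[RHS]mul1r => /mulIf; rewrite gt_eqF// => /(_ isT) h.
by congr EFin; lra.
Qed.

(** The joint law is known for final minima above a level. The levels 0 and theta are compared, and
    the second equation is subtracted from the first, all probabilities being finite. *)
Lemma pitman_law ZL : all_measurable ZL -> path <%R 0 (rcons (map fst ZL) T) ->
  (P [set phi | hits ZL (pitman phi) /\ (running_min phi T <= theta)%R] * K%:E =
   bessel_chain T lo hi ZL 0 (@entrance R))%E.
Proof.
move=> mZ L; have theta0 : 0 <= theta by rewrite divr_ge0 ?subr_ge0.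
have L' : path <%R 0 (rcons (map fst (lift_steps a ZL)) T).
  by rewrite /lift_steps -map_comp.
have mlift := measurable_lift_steps a mZ.
have J0 := joint_event_law a0 b0 (lexx 0) lawP L' mlift.
have J1 := joint_event_law a0 b0 theta0 lawP L' mlift.
have m1 := @measurable_joint_event R t theta _ mlift.
rewrite -(joint_chain_start hiE bound_lo mZ L).
move: J0; rewrite (_ : above 0 = fun m => between lo hi m + above theta m)%E; last first.
  apply/funext => m; rewrite /above /between -EFinD; congr EFin.
  have [tm|mt] := ltP theta (m : R); have [m_gt0|m_le0] := ltP 0 (m : R);
    rewrite /= ?addr0 ?add0r//.
  by move: (lt_le_trans tm m_le0); rewrite ltNge theta0.
rewrite joint_chainD//; [|exact: measurable_between|exact: measurable_above
  |exact: between_ge0|exact: above_ge0].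
rewrite -J1 => {J1}.
pose E := [set phi : cpath t R | hits ZL (pitman phi) /\ running_min phi T <= theta].
pose E1 := [set phi : cpath t R | joint_event theta (lift_steps a ZL) phi].
pose N := [set phi : cpath t R | running_min phi T <= 0].
have mN : measurable N by exact: measurable_running_min_le.
have mE : measurable E.
  have -> : E = [set phi | hits ZL (pitman phi)] `&`
      [set phi : cpath t R | running_min phi T <= theta] by [].
  apply: measurableI; last exact: measurable_running_min_le.
  elim: ZL mZ {L L' mlift m1 E E1} => [|[s C] ZL IH] /= mZ; first exact: measurableT.
  case: mZ => mC mZ; apply: measurableI; last exact: IH.
  have [mC' _] := @measurable_lift_steps _ a [:: (s, C)] (conj mC Logic.I).
  by have := @measurable_state R t s measurableT _ mC'; rewrite setTI.
have PE : P E = P (E `\` N).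
  rewrite (measureDI P mE mN) (@subset_measure0 _ _ _ P (E `&` N) N) ?adde0//.
  - exact: measurableI.
  - exact: running_min_gt0.
rewrite (_ : [set phi | joint_event 0 (lift_steps a ZL) phi] = (E `\` N) `|` E1); last first.
  apply/seteqP; split => phi /=.
    move=> /joint_event_lift[h M0]; rewrite /N /E /E1 /=.
    have [Mt|Mt] := leP (running_min phi T) theta.
      by left; split=> //; apply/negP; rewrite -ltNge.
    by right; apply/joint_event_lift.
  move=> [[[h _] M0]|/joint_event_lift[h Mt]]; apply/joint_event_lift; split=> //.
    by rewrite ltNge; apply/negP.
  exact: le_lt_trans Mt.
rewrite measureU//; last 2 first.
- exact: measurableD.
- rewrite -subset0 => phi [[[_ h] _] /joint_event_lift[_]]; rewrite ltNge.
  by rewrite h.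
have mEN := measurableD mE mN.
have [x Ex] : exists x, P (E `\` N) = x%:E.
  by exists (fine (P (E `\` N))); rewrite fineK// fin_num_measure.
have [y Ey] : exists y, P E1 = y%:E by exists (fine (P E1)); rewrite fineK// fin_num_measure.
rewrite -/E -/E1 PE Ex Ey.
rewrite (_ : (P (E `\` N) + P E1)%R = (x + y)%:E); last by rewrite EFinD -Ex -Ey.
rewrite -!EFinM mulrDl EFinD.
by move=> /(congr1 (fun z => z - (y * K)%:E)%E); rewrite !addeK.
Qed.

End pitman.

Section pitman_path.
Variables (R : realType) (t : {posnum R}).
Local Notation mR := (measurableTypeR R).
Local Notation T := t%:num.
Implicit Types (phi : cpath t R).

Lemma measurable_pitman a :
  measurable_fun setT (fun phi : cpath t R => shift_cpath (Pbar phi) a).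
Proof.
apply: (measurability (@cylinders R t)); first exact: measurable_cylinders.
move=> _ [_ [Ts [A [_ mA ->]]] <-]; rewrite setTI.
rewrite (_ : _ @^-1` _ =
    \bigcap_(s in [set` Ts]) ((fun phi : cpath t R => pitman a phi s : mR) @^-1` A s)).
  apply: fin_bigcap_measurable => // s _.
  have mp : measurable_fun setT (fun phi : cpath t R => pitman a phi s : mR).
    apply: measurable_funD => //; apply: measurable_funB.
      exact: measurable_on_line.
    by apply: measurable_funM => //; exact: measurable_past_min.
  by have := mp measurableT _ (mA s); rewrite setTI.
by apply/seteqP; split => phi h s; exact: h.
Qed.

Lemma cylinder_hits (Ts : seq R) (A : R -> set mR) : {in Ts, forall s, 0 < s < T} ->
  (forall s, measurable (A s)) ->
  exists ZL, [/\ all_measurable ZL, path <%R 0 (rcons (map fst ZL) T) &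
    forall f, hits ZL f <-> forall s, s \in Ts -> A s (f s)].
Proof.
move=> TsT mA; pose U := sort <=%R (undup Ts).
have UT s : (s \in U) = (s \in Ts) by rewrite mem_sort mem_undup.
exists [seq (s, A s) | s <- U]; split.
- by elim: U {UT} => //= s U IH; split.
- rewrite -map_comp map_id rcons_path; apply/andP; split.
    rewrite path_sortedE; last exact: lt_trans.
    rewrite lt_sorted_uniq_le sort_uniq undup_uniq sort_le_sorted !andbT.
    by apply/allP => s; rewrite UT => /TsT/andP[].
  have := mem_last 0 U; rewrite inE => /orP[/eqP->|]; first by [].
  by rewrite UT => /TsT/andP[].
- move=> f; apply: (@iff_trans _ (forall s, s \in U -> A s (f s))); last first.
    by split=> h s sT; apply: h; rewrite ?UT// -UT.
  elim: U {UT} => [|s U IH] /=; first by split.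
  split=> [[As /IH h] u|h]; first by rewrite inE => /predU1P[->//|]; exact: h.
  by split; [apply: h; rewrite mem_head|apply/IH => u uU; apply: h; rewrite inE uU orbT].
Qed.

Definition pitman_measure (P : probability (cpath t R) R) a (theta K : R) (K0 : 0 <= K) :
    {measure set (cpath t R) -> \bar R} :=
  mscale (NngNum K0)
    (image_measure (mrestr P (@measurable_running_min_le R t theta)) (measurable_pitman a)).

Lemma pitman_measureE P (a theta K : R) (K0 : 0 <= K) B : @pitman_measure P a theta K K0 B =
  (P [set phi | B (shift_cpath (Pbar phi) a) /\ (running_min phi T <= theta)%R] * K%:E)%E.
Proof. by rewrite muleC. Qed.

(** On cylinders both measures equal the same [bessel_chain], whose only parameters besides the time
    horizon are [lo] and [hi]. *)
Theorem pitman_law_unique (a b a' b' lo hi : R) P P' :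
  0 < a -> 0 < b -> 0 < a' -> 0 < b' ->
  bes3_bridge_law a b P -> bes3_bridge_law a' b' P' ->
  hi = a + b -> hi = a' + b' -> `|b - a| <= lo -> `|b' - a'| <= lo -> lo <= hi ->
  forall (K0 : 0 <= killed T 0 a b) (K0' : 0 <= killed T 0 a' b') B, measurable B ->
  pitman_measure P a ((hi - lo) / 2) K0 B = pitman_measure P' a' ((hi - lo) / 2) K0' B.
Proof.
move=> a0 b0 a0' b0' lawP lawP' hE hE' lo1 lo2 lohi K0 K0' B mB.
apply: (measure_unique (@cylinders R t) (fun k => cylinder [::] (fun=> setT))) => //.
- exact: measurable_cylinders.
- exact: cylinders_setI.
- by move=> k; exists [::], (fun=> setT).
- by apply/seteqP; split => // phi _; exists 0%N.
- move=> _ [Ts [A [TsT mA ->]]].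
  have [ZL [mZ L hZ]] := cylinder_hits TsT mA.
  rewrite !pitman_measureE.
  rewrite (_ : [set phi | _] =
    [set phi | hits ZL (pitman a phi) /\ (running_min phi T <= (hi - lo) / 2)%R]); last first.
    by apply/seteqP; split=> phi /= [h1 h2]; split=> //; apply/hZ.
  rewrite (pitman_law a0 b0 lawP hE lo1 lohi)//.
  rewrite (_ : [set phi | _] =
    [set phi | hits ZL (pitman a' phi) /\ (running_min phi T <= (hi - lo) / 2)%R]); last first.
    by apply/seteqP; split=> phi /= [h1 h2]; split=> //; apply/hZ.
  by rewrite (pitman_law a0' b0' lawP' hE' lo2 lohi).
- move=> k; rewrite pitman_measureE muleC lte_mul_pinfty ?lee_fin//.
  rewrite (le_lt_trans (probability_le1 _ _)) ?ltry//.
  have := @measurable_running_min_le R t ((hi - lo) / 2); congr measurable.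
  by apply/seteqP; split => phi //= -[].
Qed.

End pitman_path.

(** * Recovering the path from its Pitman transform *)

Section recovery.
Variables (R : realType) (t : {posnum R}).
Implicit Types (phi psi z : cpath t R) (s u v w : tset t) (x k : R).

Lemma cpathP phi psi : (forall s, phi s = psi s) -> phi = psi.
Proof. by move=> h; apply/continuousEP. Qed.

Lemma past_min_shift phi k s : past_min (shift_cpath phi k) s = past_min phi s + k.
Proof.
apply/eqP; rewrite eq_le; apply/andP; split.
  rewrite -lerBlDr; apply: past_min_ge => u us; rewrite lerBlDr.
  exact: (past_min_le (shift_cpath phi k) us).
by apply: past_min_ge => u us; rewrite lerD2r; exact: past_min_le.
Qed.

Lemma Pbar_shift phi k : Pbar (shift_cpath phi k) = shift_cpath (Pbar phi) (- k).
Proof.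
apply: cpathP => s.
change (phi s + k - 2 * past_min (shift_cpath phi k) s = phi s - 2 * past_min phi s - k).
by rewrite past_min_shift; ring.
Qed.

Lemma past_min_attained phi v (e : R) : 0 < e ->
  exists2 w, set_val w <= set_val v & phi w < past_min phi v + e.
Proof.
move=> e0; apply: contrapT => h.
suff : past_min phi v + e <= past_min phi v by rewrite leNgt ltrDl e0.
apply: past_min_ge => w wv; rewrite leNgt; apply/negP => hw.
by apply: h; exists w.
Qed.

Lemma future_min_attained phi v (e : R) : 0 < e ->
  exists2 w, set_val v <= set_val w & phi w < future_min phi v + e.
Proof.
move=> e0; apply: contrapT => h.
suff : future_min phi v + e <= future_min phi v by rewrite leNgt ltrDl e0.
apply: future_min_ge => w wv; rewrite leNgt; apply/negP => hw.
by apply: h; exists w.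
Qed.

Lemma past_min_ivt phi s u (c : R) : set_val s <= set_val u ->
  past_min phi u <= c -> c <= past_min phi s ->
  exists2 v, set_val s <= set_val v & past_min phi v = c.
Proof.
move=> su uc cs.
pose m : cpath t R := mk_cpath (@continuous_past_min R t phi).
have mE r : on_line m (set_val r) = past_min phi r by rewrite /on_line clip_val.
have cm : {within `[set_val s, set_val u], continuous (on_line m)}.
  by apply: continuous_subspaceT => y; exact: continuous_on_line.
have [|r] := @IVT _ (on_line m) _ _ c su cm.
  by rewrite !mE ge_min uc orbT le_max cs.
rewrite in_itv/= => /andP[sr ru] mr; exists (clip t r) => //.
rewrite clipE// (le_trans _ sr)/= ?(le_trans ru)//.
  by have := set_valP u; rewrite /= in_itv => /andP[].
by have := set_valP s; rewrite /= in_itv => /andP[].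
Qed.

Lemma past_min_min phi s u : set_val s <= set_val u ->
  past_min phi s <= future_min phi s -> past_min phi u = past_min phi s.
Proof.
move=> su pf; apply/eqP; rewrite eq_le; apply/andP; split.
  by apply: past_min_ge => v vs; apply: past_min_le; exact: le_trans su.
apply: past_min_ge => v _; have [vs|sv] := leP (set_val v) (set_val s).
  exact: past_min_le.
by rewrite (le_trans pf)// future_min_le// ltW.
Qed.

Lemma past_min_timeT phi s :
  past_min phi (timeT t) = Num.min (past_min phi s) (future_min phi s).
Proof.
have sT u : set_val u <= set_val (timeT t).
  by have := set_valP u; rewrite /= in_itv => /andP[].
apply/eqP; rewrite eq_le le_min; apply/andP; split; first apply/andP; first split.
- by apply: past_min_ge => v _; exact: past_min_le.
- by apply: future_min_ge => v _; exact: past_min_le.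
- apply: past_min_ge => v _; rewrite ge_min.
  have [vs|/ltW sv] := leP (set_val v) (set_val s).
    by rewrite past_min_le.
  by rewrite future_min_le ?orbT.
Qed.

(* When the future minimum [f] is below the past minimum [p], just after the
   last time at which the running minimum equals [p] the path is close to its
   running minimum, so that [Pbar phi] is close to [- p] there. *)
Lemma future_min_Pbar phi s :
  future_min (Pbar phi) s =
  Num.max (past_min phi s) (future_min phi s) - 2 * past_min phi s.
Proof.
set p := past_min phi s; set f := future_min phi s.
have PE u : Pbar phi u = phi u - 2 * past_min phi u by [].
apply/eqP; rewrite eq_le; apply/andP; split; last first.
  apply: future_min_ge => u su; rewrite PE.
  have h1 : past_min phi u <= p.
    by apply: past_min_ge => v vs; apply: past_min_le; exact: le_trans su.
  have h2 : past_min phi u <= phi u by exact: past_min_le.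
  have h3 : f <= phi u by exact: future_min_le.
  by have [pf|fp] := leP p f; lra.
have [pf|fp] := leP p f.
  rewrite lerBrDr; apply: future_min_ge => u su; rewrite -lerBrDr.
  have := future_min_le (Pbar phi) su; rewrite PE.
  by rewrite (past_min_min su pf).
rewrite (_ : p - 2 * p = - p); last by ring.
set J := future_min _ _; rewrite leNgt; apply/negP => Jp.
have e0 : 0 < (J + p) / 2 by lra.
have pf0 : 0 < p - f by rewrite subr_gt0.
have [u su] := future_min_attained phi s pf0; rewrite -/f addrC subrK => uf.
have pu : past_min phi u <= phi u by exact: past_min_le.
(* Put e = (J + p) / 2. The running minimum passes through c, with p - e <= c < p, and some w has
   phi w < c + e while its running minimum is at least c. Then Pbar phi w < e - c <= 2 e - p = J, a
   contradiction; phi w < p ensures that w is not before s. *)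
pose c := Num.max (past_min phi u) (p - (J + p) / 2).
have cp : c < p by rewrite gt_max; apply/andP; split; lra.
have ce : p - (J + p) / 2 <= c by rewrite le_max lexx orbT.
have uc : past_min phi u <= c by rewrite le_max lexx.
have [v sv vc] := past_min_ivt su uc (ltW cp).
have d0 : 0 < Num.min ((J + p) / 2) (p - c) by rewrite lt_min e0 subr_gt0.
have [w wv] := past_min_attained phi v d0.
rewrite vc -ltrBlDl lt_min !ltrBlDl => /andP[w1 w2].
have sw : set_val s <= set_val w.
  rewrite leNgt; apply/negP => /ltW ws; have := past_min_le phi ws; rewrite -/p; lra.
have cw : c <= past_min phi w.
  rewrite -vc; apply: past_min_ge => r rw; apply: past_min_le; exact: le_trans wv.
have := future_min_le (Pbar phi) sw; rewrite -/J PE; lra.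
Qed.

Definition unpitman_fun x z s : R :=
  z s - 2 * Num.min (future_min z s) ((z (timeT t) - x) / 2).

Lemma continuous_unpitman x z : continuous (unpitman_fun x z).
Proof.
apply: continuous_Pbar_formula; first exact: cts_fun.
move=> s; apply: (@continuous_min _ _ (future_min z) (fun=> (z (timeT t) - x) / 2)).
  exact: continuous_future_min.
exact: cst_continuous.
Qed.

Definition unpitman x z : cpath t R := mk_cpath (@continuous_unpitman x z).

Lemma Mbar_unpitman x phi : Mbar x phi = unpitman x (Pbar phi).
Proof.
apply: cpathP => s.
change (Mbar_fun x phi s = Pbar_fun phi s -
  2 * Num.min (future_min (Pbar phi) s) ((Pbar_fun phi (timeT t) - x) / 2)).
rewrite future_min_Pbar /Mbar_fun /Pbar_fun (past_min_timeT phi s).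
move: (past_min phi s) (future_min phi s) (phi s) (phi (timeT t)) => p f y yT.
have [pf|fp] := leP p f.
  rewrite (@ler0_norm _ (p - f)) ?subr_le0//.
  by case: ger0P => h; case: leP => h'; lra.
rewrite (@ger0_norm _ (p - f)) ?subr_ge0 ?ltW//.
by case: ger0P => h; case: leP => h'; lra.
Qed.

Lemma Mbar_end phi : Mbar (phi (timeT t)) phi = phi.
Proof.
apply: cpathP => s; change (Mbar_fun (phi (timeT t)) phi s = phi s).
by rewrite /Mbar_fun subrr mul0r subr0 add0r addrK.
Qed.

End recovery.

(** * Lipschitz path transformations and measurability of the triples *)

Section lipschitz_paths.
Variables (R : realType) (t : {posnum R}).
Implicit Types (phi psi z : cpath t R) (G : cpath t R -> cpath t R).

Lemma cpath_mx_nbhs m n (phi : cpath t 'M[R]_(m, n)) (U : set (cpath t 'M[R]_(m, n))) :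
  nbhs phi U -> exists2 e : R, 0 < e &
    forall psi : cpath t 'M[R]_(m, n),
      (forall s i j, `|(phi s : 'M[R]_(m, n)) i j - (psi s : 'M[R]_(m, n)) i j| < e) -> U psi.
Proof.
move=> /cpath_nbhsP[E [A entA AE] EU].
have : \forall e \near (0 : R)^'+, 0 < e /\
    forall i j (x y : R), `|x - y| < e -> A i j (x, y).
  near=> e; split; first by near: e; exact: nbhs_right_gt.
  near: e; apply: filter_forall => i; apply: filter_forall => j.
  have := entA i j; rewrite -entourage_ballE => -[d d0 dA].
  near=> e => x y xy; apply: (dA (x, y)); apply: lt_le_trans xy _ => /=.
  near: e; exact: nbhs_right_le.
move=> /filter_ex[e [e0 eA]]; exists e => // psi h.
by apply: EU => s; apply: AE => /= i j; apply: eA; exact: h.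
Unshelve. all: by end_near. Qed.

(** Measurability into the paths with values in R^3 is derived from continuity, and one Lipschitz
    constant per component controls the triple. *)
Definition path_lipschitz G := exists2 k : R, 0 <= k & forall phi psi (e : R),
  (forall s, `|phi s - psi s| <= e) -> forall s, `|G phi s - G psi s| <= k * e.

Lemma measurable_join3 (d : measure_display) (T : measurableType d) G1 G2 G3
    (h : T -> cpath t R) : path_lipschitz G1 -> path_lipschitz G2 -> path_lipschitz G3 ->
  measurable_fun setT h ->
  measurable_fun setT (fun w => join3 (G1 (h w)) (G2 (h w)) (G3 (h w))).
Proof.
move=> [k1 k10 lip1] [k2 k20 lip2] [k3 k30 lip3] mh.
apply: (measurableT_comp (f := fun z => join3 (G1 z) (G2 z) (G3 z))) => //.
apply: (measurability (@open (cpath t 'rV[R]_3))) => //.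
move=> _ [U oU <-]; rewrite setTI; apply: sub_sigma_algebra.
apply/cpath_openP => phi Uphi.
have /cpath_mx_nbhs[e e0 eU] : nbhs (join3 (G1 phi) (G2 phi) (G3 phi)) U.
  by move: oU; rewrite openE; apply.
(* The summand 1 makes [k] positive and larger than each constant, so the three bounds become
   strict. *)
pose k := 1 + k1 + k2 + k3; have k0 : 0 < k by rewrite /k; lra.
exists (e / k); first by rewrite divr_gt0.
move=> psi h'; have {}h' s : `|phi s - psi s| <= e / k by exact: ltW.
have ek : k * (e / k) = e by rewrite mulrC divfK ?gt_eqF.
have ek0 : 0 < e / k by rewrite divr_gt0.
have small c x : x <= c * (e / k) -> c + 1 <= k -> x < e.
  move=> xc ck; apply: le_lt_trans xc _; rewrite -[ltRHS]ek ltr_pM2r//; lra.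
apply: eU => s i j; rewrite ord1.
change (`|join3_fun (G1 phi) (G2 phi) (G3 phi) s 0 j -
  join3_fun (G1 psi) (G2 psi) (G3 psi) s 0 j| < e).
rewrite /join3_fun !mxE; case: j => -[|[|[|//]]] ? /=.
- by apply: small (lip1 _ _ _ h' s) _; rewrite /k; lra.
- by apply: small (lip2 _ _ _ h' s) _; rewrite /k; lra.
- by apply: small (lip3 _ _ _ h' s) _; rewrite /k; lra.
Qed.

Lemma path_lipschitz_comp G1 G2 :
  path_lipschitz G1 -> path_lipschitz G2 -> path_lipschitz (fun z => G1 (G2 z)).
Proof.
move=> [k1 k10 lip1] [k2 k20 lip2]; exists (k1 * k2); first exact: mulr_ge0.
by move=> phi psi e h s; rewrite -mulrA; apply: lip1 => u; exact: lip2.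
Qed.

Lemma path_lipschitz_id : path_lipschitz id.
Proof. by exists 1 => // phi psi e h s; rewrite mul1r. Qed.

Lemma path_lipschitz_shift k : path_lipschitz (fun z => shift_cpath z k).
Proof.
exists 1 => // phi psi e h s; rewrite mul1r.
change (`|(phi s + k) - (psi s + k)| <= e).
by rewrite opprD addrACA subrr addr0.
Qed.

Lemma path_lipschitz_Pbar : path_lipschitz (@Pbar R t).
Proof.
exists 3 => // phi psi e h s.
change (`|(phi s - 2 * past_min phi s) - (psi s - 2 * past_min psi s)| <= 3 * e).
have := past_min_lipschitz s h; have := h s; rewrite !ler_norml.
move: (phi s : R) (psi s : R) (past_min phi s) (past_min psi s) => x y p q.
by move=> /andP[? ?] /andP[? ?]; apply/andP; split; lra.
Qed.

Lemma path_lipschitz_unpitman x : path_lipschitz (@unpitman R t x).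
Proof.
exists 3 => // phi psi e h s.
change (`|unpitman_fun x phi s - unpitman_fun x psi s| <= 3 * e).
have := future_min_lipschitz s h; have := h s; have := h (timeT t).
rewrite /unpitman_fun !ler_norml.
move: (phi s : R) (psi s : R) (future_min phi s) (future_min psi s) (phi (timeT t) : R)
  (psi (timeT t) : R) => u v p q yT zT.
move=> /andP[? ?] /andP[? ?] /andP[? ?].
have [h1|h1] := leP p ((yT - x) / 2); have [h2|h2] := leP q ((zT - x) / 2);
  by apply/andP; split; lra.
Qed.

Lemma path_lipschitz_Mbar x : path_lipschitz (@Mbar R t x).
Proof.
have -> : @Mbar R t x = (fun z => unpitman x (Pbar z)).
  by apply/funext => z; exact: Mbar_unpitman.
by apply: path_lipschitz_comp; [exact: path_lipschitz_unpitman|exact: path_lipschitz_Pbar].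
Qed.

End lipschitz_paths.

(** * Transfer of expectations between the two bridges *)

Section pitman_integral.
Variables (R : realType) (t : {posnum R}).
Local Notation T := t%:num.
Implicit Types (P : probability (cpath t R) R) (rho : cpath t R).

Lemma ge0_integral_mrestr d (X : measurableType d) (m : {measure set X -> \bar R})
    (A : set X) (mA : measurable A) (f : X -> \bar R) :
  measurable_fun setT f -> (forall x, 0 <= f x)%E ->
  (\int[mrestr m mA]_x f x = \int[m]_(x in A) f x)%E.
Proof.
move=> mf f0; rewrite (@ge0_negligible_integral _ _ _ _ setT (~` A))//; last 2 first.
- exact: measurableC.
- by rewrite /= /mrestr setICl measure0.
rewrite setTD setCK; apply: eq_measure_integral => B mB BA.
by rewrite /= /mrestr; congr (m _); apply: setIidl.
Qed.

Lemma integral_pitman_measure P a (theta K : R) (K0 : 0 <= K) (g : cpath t R -> \bar R) :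
  measurable_fun setT g -> (forall z, 0 <= g z)%E ->
  (\int[pitman_measure P a theta K0]_z g z =
   K%:E * \int[P]_(rho in [set rho | (running_min rho T <= theta)%R])
     g (shift_cpath (Pbar rho) a))%E.
Proof.
move=> mg g0; rewrite /pitman_measure ge0_integral_mscale//=; congr (_ * _)%E.
have mZ := @measurable_pitman R t a.
rewrite [LHS](@ge0_integral_pushforward _ _ _ _ R _ mZ _ setT g)//.
rewrite preimage_setT ge0_integral_mrestr//; first exact: measurableT_comp.
by move=> x; exact: g0.
Qed.

Lemma running_min_past_min rho : running_min rho T = past_min rho (timeT t).
Proof. by rewrite -[in RHS](clip_val (timeT t)). Qed.

(** For the bridge from a to b the event of the theorem is certain, because the minimum is at most
    both end values; hence only one side carries a condition. *)
Lemma bridge_running_min (a b : R) P : bes3_bridge_law a b P ->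
  P [set rho | (running_min rho T <= Num.min a b)%R] = 1%E.
Proof.
move=> [ends _]; pose A := [set rho : cpath t R | (running_min rho T <= Num.min a b)%R].
have mA : measurable A by exact: measurable_running_min_le.
suff : P (~` A) = 0%E.
  rewrite probability_setC// -(fineK (fin_num_measure P _ mA)) -EFinB => -[h].
  by congr EFin; lra.
apply/negligibleP; first exact: measurableC.
apply: negligibleS ends => rho nA [rho0 rhoT _]; apply: nA.
rewrite /A /= running_min_past_min le_min; apply/andP; split.
- by rewrite -rho0; apply: past_min_le; change (0 <= T).
- by rewrite -rhoT; exact: past_min_le.
Qed.

End pitman_integral.

Section transfer.
Variables (R : realType) (t : {posnum R}).
Local Notation T := t%:num.
Variables (a b c : R) (P_ab P_c : probability (cpath t R) R).
Hypotheses (a_gt0 : 0 < a) (b_gt0 : 0 < b) (c_gt0 : 0 < c).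
Hypothesis abc : Num.min a b <= c <= Num.max a b.
Hypothesis law_ab : bes3_bridge_law a b P_ab.
Hypothesis law_c : bes3_bridge_law c (a + b - c) P_c.
Implicit Types rho : cpath t R.
Local Notation low := [set rho | (running_min rho T <= Num.min a b)%R].

Lemma pitman_measure_transfer (K : 0 <= killed T 0 a b) (K' : 0 <= killed T 0 c (a + b - c)) B :
  measurable B ->
  pitman_measure P_ab a (Num.min a b) K B = pitman_measure P_c c (Num.min a b) K' B.
Proof.
(* This is the bound (hi - lo) / 2 for hi = a + b and lo = |b - a|; the hypothesis on c says that
   |(a + b - c) - c| <= lo. *)
have -> : Num.min a b = (a + b - `|b - a|) / 2.
  by have [ab|ba] := leP a b; [rewrite ger0_norm ?subr_ge0//|rewrite ltr0_norm ?subr_lt0//];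
    field.
move: abc; have [ab|ba] := leP a b => /andP[h1 h2];
  [rewrite ger0_norm ?subr_ge0//|rewrite ltr0_norm ?subr_lt0//]; apply: pitman_law_unique => //;
  have := a_gt0; have := b_gt0; rewrite ?ler_norml; lra.
Qed.

Lemma pitman_integral_transfer (g : cpath t R -> \bar R) :
  measurable_fun setT g -> (forall z, 0 <= g z)%E ->
  (\int[P_ab]_rho g (shift_cpath (Pbar rho) a) =
   cond_expectation P_c low (fun rho => g (shift_cpath (Pbar rho) c)))%E.
Proof.
move=> mg g0; have mlow := @measurable_running_min_le R t (Num.min a b).
have K0 : 0 < killed T 0 a b by exact: killed_gt0.
have K0' : 0 < killed T 0 c (a + b - c).
  apply: killed_gt0 => //; move: abc; have := a_gt0; have := b_gt0.
  by have [ab|ba] := leP a b => ? ? /andP[]; lra.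
(* Equality of total masses reads killed T 0 a b = P_c low * killed T 0 c (a + b - c). *)
have := pitman_measure_transfer (ltW K0) (ltW K0') (@measurableT _ (cpath t R)).
rewrite !pitman_measureE.
have low_setT (w : R) : [set rho | [set: cpath t R] (shift_cpath (Pbar rho) w) /\
    (running_min rho T <= Num.min a b)%R] = low by apply/seteqP; split => rho //= -[].
rewrite !low_setT (bridge_running_min law_ab) mul1e => PE.
have int_ab : (\int[P_ab]_rho g (shift_cpath (Pbar rho) a) =
    \int[P_ab]_(rho in low) g (shift_cpath (Pbar rho) a))%E.
  rewrite (@ge0_negligible_integral _ _ _ _ setT (~` low))//.
  - by rewrite setTD setCK.
  - exact: measurableC.
  - by apply: (measurableT_comp mg); exact: measurable_pitman.
  - apply: etrans (probability_setC P_ab mlow) _.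
    by rewrite (bridge_running_min law_ab) subee.
have : (\int[pitman_measure P_ab a (Num.min a b) (ltW K0)]_z g z =
        \int[pitman_measure P_c c (Num.min a b) (ltW K0')]_z g z)%E.
  by apply: eq_measure_integral => B mB _; exact: pitman_measure_transfer.
rewrite !integral_pitman_measure// -int_ab /cond_expectation.
set I1 := integral _ _ _; set I2 := integral _ _ _.
have I20 : (0 <= I2)%E by exact: integral_ge0.
have [p Ep] : exists p, P_c low = p%:E.
  by exists (fine (P_c low)); rewrite fineK// fin_num_measure.
move: PE; rewrite Ep -EFinM => -[pK].
(* The conditioning event has positive probability, so the default value of [cond_expectation] does
   not occur. *)
have p0 : p != 0.
  by apply/eqP => p0; move: pK; rewrite p0 mul0r => h; move: K0; rewrite h ltxx.
rewrite inver (negbTE p0) pK EFinM (muleC p%:E) -muleA => h.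
have {h} : (p%:E * I1 = I2)%E.
  have := congr1 (fun z => (killed T 0 c (a + b - c))^-1%:E * z)%E h.
  by rewrite !muleA -!EFinM mulVf ?gt_eqF// !mul1r !mul1e.
by move=> <-; rewrite muleC muleA -EFinM mulVf// mul1e.
Qed.

End transfer.

Theorem theorem3p1 (R : realType) (t : {posnum R}) (a b c : R)
    (a_gt0 : 0 < a) (b_gt0 : 0 < b) (c_gt0 : 0 < c)
    (abc : Num.min a b <= c <= Num.max a b)
    (P_ab : probability (cpath t R) R)
    (P_c : probability (cpath t R) R)
    (law_ab : bes3_bridge_law a b P_ab)
    (law_c : bes3_bridge_law c (a + b - c) P_c)
    (F : cpath t 'rV[R]_3 -> \bar R)
    (F_meas : measurable_fun setT F) (F_ge0 : forall w, (0 <= F w)%E) :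
  (\int[P_ab]_rho
      F (join3 (shift_cpath rho (- a))
               (shift_cpath (Pbar rho) a)
               (Mbar (a + b - 2 * c) (shift_cpath rho (- a)))) =
   cond_expectation P_c
     [set rho | (past_min rho (timeT t) <= Num.min a b)%R]
     (fun rho => F (join3 (Mbar (b - a) (shift_cpath rho (- c)))
                          (shift_cpath (Pbar rho) c)
                          (shift_cpath rho (- c)))))%E.
Proof.
pose x := a + b - 2 * c.
pose g z := F (join3 (unpitman (b - a) z) z (unpitman x z)).
have mF G1 G2 G3 : path_lipschitz G1 -> path_lipschitz G2 -> path_lipschitz G3 ->
    measurable_fun setT (fun rho => F (join3 (G1 rho) (G2 rho) (G3 rho))).
  by move=> l1 l2 l3; apply: (measurableT_comp F_meas); exact: measurable_join3.
have mg : measurable_fun setT g.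
  apply: (mF (unpitman (b - a)) id (unpitman x)).
  - exact: path_lipschitz_unpitman.
  - exact: path_lipschitz_id.
  - exact: path_lipschitz_unpitman.
have lipP k : path_lipschitz (fun rho : cpath t R => shift_cpath (Pbar rho) k).
  exact: (path_lipschitz_comp (path_lipschitz_shift t k) (@path_lipschitz_Pbar R t)).
have lipM k y : path_lipschitz (fun rho : cpath t R => Mbar y (shift_cpath rho k)).
  exact: (path_lipschitz_comp (path_lipschitz_Mbar t y) (path_lipschitz_shift t k)).
have lipS k : path_lipschitz (fun rho : cpath t R => shift_cpath rho k).
  exact: path_lipschitz_shift.
have mgZ k : measurable_fun setT (fun rho : cpath t R => g (shift_cpath (Pbar rho) k)).
  by apply: (measurableT_comp mg); exact: measurable_pitman.
have shiftP rho k : Pbar (shift_cpath rho (- k)) = shift_cpath (Pbar rho) k :> cpath t R.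
  by rewrite Pbar_shift opprK.
transitivity (\int[P_ab]_rho g (shift_cpath (Pbar rho) a))%E.
  apply: ge0_ae_eq_integral => //; first exact: (mF _ _ _ (lipS (- a)) (lipP a) (lipM (- a) x)).
  - by move=> rho _; exact: F_ge0.
  (* Almost surely rho - a ends at b - a and is therefore fixed by [Mbar (b - a)]. *)
  case: law_ab => ends _; apply: filterS ends => rho [_ rhoT _] _.
  rewrite /g -shiftP -!Mbar_unpitman.
  rewrite (_ : Mbar (b - a) (shift_cpath rho (- a)) = shift_cpath rho (- a))//.
  by rewrite -[RHS]Mbar_end -rhoT.
rewrite (pitman_integral_transfer a_gt0 b_gt0 c_gt0 abc law_ab law_c mg); last first.
  by move=> z; exact: (F_ge0 (join3 _ _ _)).
rewrite /cond_expectation.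
have lowE : [set rho : cpath t R | (running_min rho t%:num <= Num.min a b)%R] =
    [set rho | (past_min rho (timeT t) <= Num.min a b)%R].
  by apply/seteqP; split => rho; rewrite /= running_min_past_min.
rewrite -!lowE; congr (_ / _)%E; apply: ge0_ae_eq_integral.
- exact: measurable_running_min_le.
- by apply: measurable_funTS; exact: mgZ.
- by apply: measurable_funTS; exact: (mF _ _ _ (lipM (- c) (b - a)) (lipP c) (lipS (- c))).
- by move=> rho _; exact: F_ge0.
- by move=> rho _; exact: F_ge0.
(* Here rho - c ends at (a + b - c) - c = x, so it is the third component that [Mbar] fixes. *)
case: law_c => ends _; apply: filterS ends => rho [_ rhoT _] _.
rewrite /g -shiftP -!Mbar_unpitman.
rewrite (_ : Mbar x (shift_cpath rho (- c)) = shift_cpath rho (- c))//.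
rewrite -[RHS]Mbar_end; congr (Mbar _ _).
by change (x = rho (timeT t) - c); rewrite rhoT /x; ring.
Qed.
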